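(* The following problem is decidable: given a class automaton, decide whether it accepts some bipartite data tree. Consequently, the following problem is also decidable: given an (Extended Regular) XPath query (boolean or unary) over data trees, decide whether it is satisfied in some bipartite data tree (for a unary query: whether it selects at least one node in some bipartite data tree).
   Context: Trees are finite, unranked, sibling-ordered, with nodes labeled by a finite alphabet. A data tree over $\Sigma$ is a pair $(t,\sim)$ where $t$ is a tree labeled by $\Sigma$ and $\sim$ is an equivalence relation on the nodes of $t$; a class is an equivalence class of $\sim$. A data tree is bipartite if its nodes can be split into two sets $X,Y$, each connected with respect to the child relation, such that every class has at most one node in $X$ and at most one node in $Y$. If $t,s$ are trees over $\Sigma,\Gamma$ with the same nodes, $t\otimes s$ is the tree over $\Sigma\times\Gamma$ with the same nodes, where each node carries its pair of labels; for a set $X$ of nodes of $t$, $t\otimes X$ is the tree over $\Sigma\times\{0,1\}$ obtained by adding the characteristic function of $X$ as second coordinate. A nondeterministic letter-to-letter transducer $f$ from $\Sigma$ to $\Gamma$ is a regular language of trees over $\Sigma\times\Gamma$; one writes $s\in f(t)$ when $t,s$ have the same nodes and $t\otimes s$ belongs to this language. A class automaton consists of an input alphabet $\Sigma$, a finite work alphabet $\Gamma$, a nondeterministic letter-to-letter transducer $f$ from $\Sigma$ to $\Gamma$, and a regular language of trees over $\Gamma\times\{0,1\}$ called the class condition (regular languages are given, e.g., by tree automata). It accepts a data tree $(t,\sim)$ over $\Sigma$ if there is some $s\in f(t)$ such that for every class $X$ of $\sim$ the tree $s\otimes X$ belongs to the class condition. Extended Regular XPath (called XPath for short) is defined inductively.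 (i) Let $\Gamma$ be a finite set of already defined unary XPath queries (empty in the induction base), and let $\varphi[x_1,\dots,x_m]$ be a formula of monadic second-order logic (with quantification over nodes and sets of nodes) that uses the queries of $\Gamma$ as unary predicates, unary predicates for the letters of the alphabet, and the binary child and next-sibling predicates, but does not use $\sim$ (other than inside the queries of $\Gamma$). Then $\varphi$ is an $m$-ary XPath query (boolean if $m=0$, unary if $m=1$). (ii) If $\varphi[x,y_1,y_2]$ is a ternary XPath query, then $\exists y_1\exists y_2\ (y_1\sim y_2\wedge\varphi[x,y_1,y_2])$ and $\exists y_1\exists y_2\ (y_1\not\sim y_2\wedge\varphi[x,y_1,y_2])$ are unary XPath queries (with free variable $x$). *)

(* Defs.v *)
From mathcomp Require Import all_boot.
Set Implicit Arguments.
Unset Strict Implicit.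
Unset Printing Implicit Defensive.

(** * Partial recursive functions and decidability *)

Inductive recf : nat -> Type :=
| RZero k : recf k
| RSucc : recf 1
| RProj k (i : 'I_k) : recf k
| RComp k m (f : recf m) (g : 'I_m -> recf k) : recf k
| RPrim k (f : recf k) (g : recf k.+2) : recf k.+1
| RMu k (f : recf k.+1) : recf k.

(* [reval f v y]: the partial function [f] is defined at [v], with value [y].
   In [RPrim], [s] lists the values of the recursion; the recursion argument
   comes first, and the step function receives the counter, the previous value
   and the parameters, in this order. *)
Fixpoint reval k (f : recf k) : k.-tuple nat -> nat -> Prop :=
  match f in recf k return k.-tuple nat -> nat -> Prop with
  | RZero _ => fun _ y => y = 0
  | RSucc => fun v y => y = (thead v).+1
  | RProj _ i => fun v y => y = tnth v i
  | RComp _ m f g => fun v y =>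
      exists2 w : m.-tuple nat,
        forall j, reval (g j) v (tnth w j) & reval f w y
  | RPrim _ f g => fun v y =>
      exists s : nat -> nat,
        [/\ reval f [tuple of behead v] (s 0),
            forall i, i < thead v ->
              reval g [tuple of i :: s i :: behead v] (s i.+1)
          & y = s (thead v)]
  | RMu _ f => fun v y =>
      reval f [tuple of y :: v] 0 /\
      forall z, z < y -> exists u, reval f [tuple of z :: v] u.+1
  end.

Definition decidable_problem (I : Type) (code : I -> nat) (P : I -> Prop) :=
  exists f : recf 1, forall i,
    (P i -> reval f [tuple code i] 1) /\ (~ P i -> reval f [tuple code i] 0).

(** * Trees and data trees *)

Inductive tree (A : Type) := Node of A & seq (tree A).

(* A node is the sequence of the child positions, counted from 0, leading to
   it from the root [::]; a set of nodes is a boolean predicate on addresses. *)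
Definition addr := seq nat.

Section Trees.
Variables A B : Type.

Definition root_label (t : tree A) := let: Node a _ := t in a.
Definition children (t : tree A) := let: Node _ ts := t in ts.

Fixpoint subtree (t : tree A) (p : addr) : option (tree A) :=
  if p is i :: p' then
    if onth (children t) i is Some u then subtree u p' else None
  else Some t.

Definition nodes (t : tree A) : pred addr := [pred p | isSome (subtree t p)].

Definition label (t : tree A) (p : addr) : option A :=
  omap root_label (subtree t p).

(* Only meaningful when [t] and [s] have the same nodes. *)
Fixpoint tensor (t : tree A) (s : tree B) : tree (A * B) :=
  let: Node a ts := t in let: Node b ss := s in
  Node (a, b) [seq fu.1 fu.2 | fu <- zip [seq tensor u | u <- ts] ss].

Fixpoint tensor_set (t : tree A) (X : pred addr) : tree (A * bool) :=
  let: Node a ts := t in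
  Node (a, X [::])
    [seq fi.1 (fun p => X (fi.2 :: p))
       | fi <- zip [seq tensor_set u | u <- ts] (iota 0 (size ts))].

End Trees.

Definition child : rel addr :=
  [rel p q | prefix p q && (size q == (size p).+1)].

Definition next_sibling (p q : addr) : Prop :=
  exists r i, p = rcons r i /\ q = rcons r i.+1.

(* The values of [dsim] outside the nodes of the tree are irrelevant. *)
Record data_tree (A : Type) := DataTree {
  dtree :> tree A;
  dsim : rel addr;
  dsim_equiv : {in nodes dtree & &, equivalence_rel dsim}
}.

Definition connected (X : pred addr) : Prop :=
  {in X &, forall p q, exists s : seq addr,
     [/\ path [rel x y | child x y || child y x] p s, all X s & last p s = q]}.

Definition bipartite (A : Type) (D : data_tree A) : Prop :=
  exists X Y : pred addr,
    [/\ forall p, (p \in nodes D) = (p \in X) || (p \in Y),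
        forall p, ~~ ((p \in X) && (p \in Y)),
        connected X, connected Y
      & {in X &, forall p q, dsim D p q -> p = q} /\
        {in Y &, forall p q, dsim D p q -> p = q}].

(** * Regular tree languages *)

Record nfa (A : Type) := Nfa {
  nfa_size : nat;
  nfa_init : seq 'I_nfa_size;
  nfa_trans : seq ('I_nfa_size * A * 'I_nfa_size);
  nfa_final : seq 'I_nfa_size
}.

Fixpoint nfa_accepts_from (A : eqType) (N : nfa A) (p : 'I_(nfa_size N))
    (w : seq A) : bool :=
  if w is a :: w' then
    [exists q, ((p, a, q) \in nfa_trans N) && nfa_accepts_from q w']
  else p \in nfa_final N.

Definition nfa_accepts (A : eqType) (N : nfa A) (w : seq A) : bool :=
  has (fun p => nfa_accepts_from p w) (nfa_init N).

(* Nondeterministic automata on unranked trees.  A rule [(a, N, q)] assigns the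
   state [q] to a node of label [a] if [N] accepts the word of states assigned
   to the children of this node. *)
Record tree_automaton (A : Type) := TreeAutomaton {
  ta_size : nat;
  ta_rules : seq (A * nfa 'I_ta_size * 'I_ta_size);
  ta_final : seq 'I_ta_size
}.

Fixpoint ta_reach (A : eqType) (M : tree_automaton A) (t : tree A)
    : pred 'I_(ta_size M) :=
  let: Node a ts := t in fun q =>
  has (fun r : A * nfa 'I_(ta_size M) * 'I_(ta_size M) =>
         [&& r.1.1 == a, r.2 == q
           & [exists w : (size ts).-tuple 'I_(ta_size M),
                nfa_accepts r.1.2 w && all2 (@ta_reach A M) ts w]])
      (ta_rules M).

Arguments ta_reach {A} M t q.

Definition ta_accepts (A : eqType) (M : tree_automaton A) (t : tree A) : bool :=
  has (ta_reach M t) (ta_final M).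

(** * Class automata *)

Definition transducer (n k : nat) := tree_automaton ('I_n * 'I_k)%type.

Definition transduces n k (f : transducer n k) (t : tree 'I_n) (s : tree 'I_k) :=
  nodes t =i nodes s /\ ta_accepts f (tensor t s).

(* Finite alphabets are the types ['I_n], up to a renaming of the letters. *)
Record class_automaton := ClassAutomaton {
  ca_input : nat;
  ca_work : nat;
  ca_transducer : transducer ca_input ca_work;
  ca_condition : tree_automaton ('I_ca_work * bool)%type
}.

Definition ca_accepts (C : class_automaton) (D : data_tree 'I_(ca_input C)) :=
  exists2 s : tree 'I_(ca_work C), transduces (ca_transducer C) D s
    & {in nodes D, forall x,
        ta_accepts (ca_condition C)
          (tensor_set s [pred y in nodes D | dsim D x y])}.

(** * Extended Regular XPath *)

(* [mso n G m k]: formulas over the alphabet ['I_n], with unary predicates from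
   [G], and with [m] free node variables and [k] free set variables.  A
   quantifier binds the variable 0 of its body and shifts the others.  The
   remaining connectives are definable. *)
Inductive mso (n : nat) (G : Type) (m k : nat) : Type :=
| MLabel (a : 'I_n) (x : 'I_m)
| MEq (x y : 'I_m)
| MChild (x y : 'I_m)
| MNext (x y : 'I_m)
| MIn (x : 'I_m) (Z : 'I_k)
| MQuery (u : G) (x : 'I_m)
| MNot (f : mso n G m k)
| MAnd (f g : mso n G m k)
| MExNode (f : mso n G m.+1 k)
| MExSet (f : mso n G m k.+1).

(* In [USim] and [UNotSim] the variables 0, 1, 2 are x, y_1, y_2. *)
Inductive unary_query (n : nat) : Type :=
| UMso (f : mso n (unary_query n) 1 0)
| USim (f : mso n (unary_query n) 3 0)
| UNotSim (f : mso n (unary_query n) 3 0).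

Definition boolean_query (n : nat) := mso n (unary_query n) 0 0.

Section Semantics.
Variables (n : nat) (D : data_tree 'I_n).

Section Mso.
Variables (G : Type) (interp : G -> addr -> Prop).

Fixpoint mso_sat m k (f : mso n G m k)
    (v : m.-tuple addr) (V : k.-tuple (pred addr)) {struct f} : Prop :=
  match f with
  | MLabel a x => label D (tnth v x) = Some a
  | MEq x y => tnth v x = tnth v y
  | MChild x y => child (tnth v x) (tnth v y)
  | MNext x y => next_sibling (tnth v x) (tnth v y)
  | MIn x Z => tnth V Z (tnth v x)
  | MQuery u x => interp u (tnth v x)
  | MNot f => ~ mso_sat f v V
  | MAnd f g => mso_sat f v V /\ mso_sat g v V
  | MExNode f => exists2 p, p \in nodes D & mso_sat f [tuple of p :: v] V
  | MExSet f => exists2 X : pred addr, {subset X <= nodes D}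
                  & mso_sat f v [tuple of X :: V]
  end.

End Mso.

Fixpoint selects (u : unary_query n) (x : addr) {struct u} : Prop :=
  match u with
  | UMso f => mso_sat selects f [tuple x] [tuple]
  | USim f => exists y1 y2,
      [/\ y1 \in nodes D, y2 \in nodes D, dsim D y1 y2
        & mso_sat selects f [tuple x; y1; y2] [tuple]]
  | UNotSim f => exists y1 y2,
      [/\ y1 \in nodes D, y2 \in nodes D, ~~ dsim D y1 y2
        & mso_sat selects f [tuple x; y1; y2] [tuple]]
  end.

Definition holds (f : boolean_query n) : Prop :=
  mso_sat selects f [tuple] [tuple].

End Semantics.

(** * Codes of the instances *)

Definition code_seq T (c : T -> nat) (s : seq T) := CodeSeq.code (map c s).

Definition code_pair T U (c : T -> nat) (d : U -> nat) (x : T * U) :=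
  CodeSeq.code [:: c x.1; d x.2].

Definition code_ord n : 'I_n -> nat := @nat_of_ord n.

Definition code_nfa A (c : A -> nat) (N : nfa A) :=
  CodeSeq.code
    [:: nfa_size N;
        code_seq (@code_ord _) (nfa_init N);
        code_seq (code_pair (code_pair (@code_ord _) c) (@code_ord _))
          (nfa_trans N);
        code_seq (@code_ord _) (nfa_final N)].

Definition code_ta A (c : A -> nat) (M : tree_automaton A) :=
  CodeSeq.code
    [:: ta_size M;
        code_seq (code_pair (code_pair c (code_nfa (@code_ord _))) (@code_ord _))
          (ta_rules M);
        code_seq (@code_ord _) (ta_final M)].

Definition code_class_automaton (C : class_automaton) :=
  CodeSeq.code
    [:: ca_input C; ca_work C;
        code_ta (code_pair (@code_ord _) (@code_ord _)) (ca_transducer C);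
        code_ta (code_pair (@code_ord _) nat_of_bool) (ca_condition C)].

Fixpoint code_mso n G (c : G -> nat) m k (f : mso n G m k) {struct f} : nat :=
  match f with
  | MLabel a x => CodeSeq.code [:: 0; nat_of_ord a; nat_of_ord x]
  | MEq x y => CodeSeq.code [:: 1; nat_of_ord x; nat_of_ord y]
  | MChild x y => CodeSeq.code [:: 2; nat_of_ord x; nat_of_ord y]
  | MNext x y => CodeSeq.code [:: 3; nat_of_ord x; nat_of_ord y]
  | MIn x Z => CodeSeq.code [:: 4; nat_of_ord x; nat_of_ord Z]
  | MQuery u x => CodeSeq.code [:: 5; c u; nat_of_ord x]
  | MNot f => CodeSeq.code [:: 6; code_mso c f]
  | MAnd f g => CodeSeq.code [:: 7; code_mso c f; code_mso c g]
  | MExNode f => CodeSeq.code [:: 8; code_mso c f]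
  | MExSet f => CodeSeq.code [:: 9; code_mso c f]
  end.

Fixpoint code_unary n (u : unary_query n) : nat :=
  match u with
  | UMso f => CodeSeq.code [:: 0; code_mso (@code_unary n) f]
  | USim f => CodeSeq.code [:: 1; code_mso (@code_unary n) f]
  | UNotSim f => CodeSeq.code [:: 2; code_mso (@code_unary n) f]
  end.

(* An instance of a query problem consists of the alphabet and the query. *)
Definition code_boolean_instance (q : {n : nat & boolean_query n}) :=
  CodeSeq.code [:: tag q; code_mso (@code_unary _) (tagged q)].

Definition code_unary_instance (q : {n : nat & unary_query n}) :=
  CodeSeq.code [:: tag q; code_unary (tagged q)].

(* The codes identify the instances. *)

#[local] Opaque CodeSeq.code.

Lemma code_inj (s1 s2 : seq nat) : CodeSeq.code s1 = CodeSeq.code s2 -> s1 = s2.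
Proof. exact: (can_inj CodeSeq.codeK). Qed.

Lemma code_seq_inj T (c : T -> nat) : injective c -> injective (code_seq c).
Proof. by move=> cI s1 s2 /code_inj; exact: inj_map. Qed.

Lemma code_pair_inj T U (c : T -> nat) (d : U -> nat) :
  injective c -> injective d -> injective (code_pair c d).
Proof. by move=> cI dI [x y] [x' y'] /code_inj [] /cI /= -> /dI /= ->. Qed.

Lemma code_ord_inj n : injective (@code_ord n).
Proof. exact: ord_inj. Qed.

Lemma code_nfa_inj A (c : A -> nat) : injective c -> injective (code_nfa c).
Proof.
move=> cI [n i t f] [n' i' t' f'] /code_inj [] /= en; subst n'.
have oI := @code_ord_inj n.
move=> /(code_seq_inj oI) -> + /(code_seq_inj oI) ->.
by move=> /(code_seq_inj (code_pair_inj (code_pair_inj oI cI) oI)) ->.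
Qed.

Lemma code_ta_inj A (c : A -> nat) : injective c -> injective (code_ta c).
Proof.
move=> cI [n r f] [n' r' f'] /code_inj [] /= en; subst n'.
have oI := @code_ord_inj n; move=> + /(code_seq_inj oI) ->.
have nI := code_nfa_inj oI.
by move=> /(code_seq_inj (code_pair_inj (code_pair_inj cI nI) oI)) ->.
Qed.

Lemma code_class_automaton_inj : injective code_class_automaton.
Proof.
move=> [n k f c] [n' k' f' c'] /code_inj [] /= en ek; subst n' k'.
have oI := @code_ord_inj; have bI : injective nat_of_bool by do 2 case.
move=> /(code_ta_inj (code_pair_inj (@oI _) (@oI _))) ->.
by move=> /(code_ta_inj (code_pair_inj (@oI _) bI)) ->.
Qed.

Lemma lt_code s i N : i \in s -> CodeSeq.code s <= N -> i < N.
Proof. by move=> /(allP (CodeSeq.ltn_code s)); apply: leq_trans. Qed.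

Lemma code_mso_inj n G (c : G -> nat) N :
    (forall u w, c u < N -> c u = c w -> u = w) ->
  forall m k (f g : mso n G m k),
    code_mso c f <= N -> code_mso c f = code_mso c g -> f = g.
Proof.
move=> cI m k; elim=> {}m {}k.
1-5: by move=> x y [] > /= _ /code_inj //= [] /ord_inj -> /ord_inj ->.
- move=> u x [] > /= leN /code_inj //= [] /cI -> => [/ord_inj -> //|].
  by apply: lt_code leN; rewrite !inE eqxx orbT.
- move=> f IHf [] > /= leN /code_inj //= [] /IHf -> //.
  by apply: ltnW; apply: lt_code leN; rewrite !inE eqxx orbT.
- move=> f IHf g IHg [] > /= leN /code_inj //= [] eqf eqg.
  have lef : code_mso c f <= N.
    by apply: ltnW; apply: lt_code leN; rewrite !inE eqxx orbT.
  have leg : code_mso c g <= N.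
    by apply: ltnW; apply: lt_code leN; rewrite !inE eqxx !orbT.
  by rewrite (IHf _ lef eqf) (IHg _ leg eqg).
- move=> f IHf [] > /= leN /code_inj //= [] /IHf -> //.
  by apply: ltnW; apply: lt_code leN; rewrite !inE eqxx orbT.
- move=> f IHf [] > /= leN /code_inj //= [] /IHf -> //.
  by apply: ltnW; apply: lt_code leN; rewrite !inE eqxx orbT.
Qed.

Lemma code_unary_inj n : injective (@code_unary n).
Proof.
suff H N : forall u w : unary_query n,
    code_unary u < N -> code_unary u = code_unary w -> u = w.
  by move=> u w; apply: (H (code_unary u).+1).
elim: N => // N IHN.
case=> f [] g; rewrite ltnS => leN /code_inj //= [] /(code_mso_inj IHN) -> //.
all: by apply: ltnW; apply: lt_code leN; rewrite !inE eqxx orbT.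
Qed.

Lemma code_boolean_instance_inj : injective code_boolean_instance.
Proof.
move=> [n f] [n' g] /code_inj [] /= en; subst n' => eq_fg.
by rewrite (code_mso_inj (fun u w _ => @code_unary_inj _ u w) (leqnn _) eq_fg).
Qed.

Lemma code_unary_instance_inj : injective code_unary_instance.
Proof.
by move=> [n f] [n' g] /code_inj [] /= en; subst n' => /code_unary_inj ->.
Qed.

(* Main.v *)
(* The nodes of a bipartite data tree form two sides, one of them consisting of the
   descendants of a node, and [dsim] is a partial matching between the sides.
   MSO properties and tree automata are turned into deterministic automata on
   binary trees.  A regular ternary relation only sees a node [y] on the other
   side from its two other arguments through one of boundedly many colours: the
   behaviour of the automaton on the part containing [y].  Annotating each node
   with its side, its colour, the colour of its partner and the answers to the
   queries, acceptance no longer depends on which matching respects the colours,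
   and such a matching exists as soon as the nodes of colour [k] with a partner
   of colour [l] on one side are as many as the converse ones on the other side.
   Hence satisfiability amounts to a run of a finite automaton along which
   finitely many weights sum to zero.  Such runs can be pumped down, because a
   long zero-sum sequence of bounded integer vectors splits into short zero-sum
   blocks; this bounds the size of a least model.  The models up to the bound are
   then enumerated and checked by an alternating recursive program. *)

Require Import Defs.
From mathcomp Require Import all_boot all_order all_algebra.
From mathcomp Require Import zify boolp.

Set Implicit Arguments.
Unset Strict Implicit.
Unset Printing Implicit Defensive.

(** * Recursive functions *)

(** Decidability requires a computable bound on the size of a least model, not a computable
    construction of automata. Automata are therefore only shown to exist, freely using excluded
    middle and choice, and the one effective datum kept about them is a bound on their number of
    states. Each logical operation costs a bounded number of exponentials, so this bound is recorded
    as the height of a tower, which merely adds up and in the end depends on the code of the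
    instance alone.

    Queries nest, and the truth of an inner one depends on the matching. For an instance of code
    [c], all queries of code below [c] are hence annotated together, with one colouring for each of
    them; as a query has a larger code than those inside it, induction on codes shows that the
    annotated answers are the true ones.

    The program that checks a model follows the original semantics and never refers to the automata.
    It is given by its calls instead of by recursion equations: a derivation of the value of a call
    is a finite table, so one unbounded search for a table evaluates every call that has a
    derivation, without any termination measure. *)

Definition recursive k (F : seq nat -> nat) :=
  exists r : recf k, forall v : k.-tuple nat, reval r v (F v).

Lemma recursive_ext k (F G : seq nat -> nat) :
  (forall v : k.-tuple nat, F v = G v) -> recursive k F -> recursive k G.
Proof. by move=> FG [r rP]; exists r => v; rewrite -FG. Qed.

Lemma recursive_proj k i : i < k -> recursive k (nth 0 ^~ i).
Proof. by move=> ik; exists (RProj (Ordinal ik)) => v /=; rewrite (tnth_nth 0). Qed.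

Lemma recursive_comp k F (G : seq (seq nat -> nat)) :
    recursive (size G) F ->
    (forall i, i < size G -> recursive k (nth (fun=> 0) G i)) ->
  recursive k (fun v => F [seq g v | g <- G]).
Proof.
move=> [r rP] recG.
have [g gP] := fin_all_exists (fun i : 'I_(size G) => recG i (ltn_ord i)).
exists (RComp r g) => v /=.
pose w := [tuple nth (fun=> 0) G i (v : seq nat) | i < size G].
exists w; first by move=> j; rewrite tnth_mktuple; apply: gP.
suff <- : w = [seq (g : seq nat -> nat) (v : seq nat) | g <- G] :> seq nat by apply: rP.
apply: (@eq_from_nth _ 0); first by rewrite size_map size_tuple.
move=> i; rewrite size_tuple => ilt.
rewrite (nth_map (fun=> 0)) //.
have := tnth_mktuple (fun i => nth (fun=> 0) G i (v : seq nat)) (Ordinal ilt).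
by rewrite (tnth_nth 0).
Qed.

(** A named recursor, which the syntactic rules for [comp1] can recognise as a primitive
    recursion. *)
Definition natrec (a : nat) (f : nat -> nat -> nat) (n : nat) : nat :=
  nat_rect (fun=> nat) a f n.

Lemma recursive_prim k F G : recursive k F -> recursive k.+2 G ->
  recursive k.+1
    (fun v => natrec (F (behead v)) (fun i y => G [:: i, y & behead v]) (head 0 v)).
Proof.
move=> [r rP] [s sP]; exists (RPrim r s) => v /=.
exists (fun n => natrec (F (behead v)) (fun i y => G [:: i, y & behead v]) n).
split=> [|i _|]; first exact: (rP [tuple of behead v]).
  exact: (sP [tuple of [:: i, _ & [tuple of behead v]]]).
by case/tupleP: v.
Qed.

Lemma recursive_mu k F (g : seq nat -> nat) : recursive k.+1 F ->
    (forall v : k.-tuple nat, F (g v :: v) = 0 /\ forall z, z < g v -> F (z :: v) != 0) ->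
  recursive k g.
Proof.
move=> [r rP] gP; exists (RMu r) => v /=; have [g0 gN] := gP v.
split=> [|z zlt]; first by have := rP [tuple of g v :: v]; rewrite /= g0.
exists (F (z :: v)).-1; rewrite prednK ?lt0n ?gN //.
exact: (rP [tuple of z :: v]).
Qed.

(** * Computable functions of one and two numbers; arithmetic *)

Definition comp1 (f : nat -> nat) := recursive 1 (fun v => f (nth 0 v 0)).
Definition comp2 (f : nat -> nat -> nat) :=
  recursive 2 (fun v => f (nth 0 v 0) (nth 0 v 1)).

Lemma comp1_ext f g : f =1 g -> comp1 f -> comp1 g.
Proof. by move=> fg; apply: recursive_ext => v; rewrite fg. Qed.

Lemma recursive_app1 k f F : comp1 f -> recursive k F -> recursive k (fun v => f (F v)).
Proof.
by move=> cf cF; apply: (@recursive_comp k (fun v => f (nth 0 v 0)) [:: F]) => // -[].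
Qed.

Lemma recursive_app2 k f F G : comp2 f -> recursive k F -> recursive k G ->
  recursive k (fun v => f (F v) (G v)).
Proof.
move=> cf cF cG.
by apply: (@recursive_comp k (fun v => f (nth 0 v 0) (nth 0 v 1)) [:: F; G]) => // -[|[]].
Qed.

Lemma comp1_id : comp1 id.
Proof. exact: recursive_proj. Qed.

Lemma comp1_comp f g : comp1 f -> comp1 g -> comp1 (fun x => f (g x)).
Proof. exact: recursive_app1. Qed.

Lemma comp1_comp2 f g h : comp2 f -> comp1 g -> comp1 h -> comp1 (fun x => f (g x) (h x)).
Proof. exact: recursive_app2. Qed.

Lemma comp2_comp f g : comp1 f -> comp2 g -> comp2 (fun x y => f (g x y)).
Proof. exact: recursive_app1. Qed.

Lemma comp2_comp2 f g h : comp2 f -> comp2 g -> comp2 h ->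
  comp2 (fun x y => f (g x y) (h x y)).
Proof. exact: recursive_app2. Qed.

Lemma comp2_fst : comp2 (fun x _ => x). Proof. exact: recursive_proj. Qed.
Lemma comp2_snd : comp2 (fun _ y => y). Proof. exact: recursive_proj. Qed.

Lemma recursive_succ k F : recursive k F -> recursive k (fun v => (F v).+1).
Proof.
apply: recursive_app1; exists RSucc => v /=.
by rewrite /thead (tnth_nth 0).
Qed.

Lemma recursive_const k n : recursive k (fun=> n).
Proof. by elim: n => [|n IHn]; [exists (RZero k) | apply: recursive_succ]. Qed.

Lemma comp1_const n : comp1 (fun=> n). Proof. exact: recursive_const. Qed.
Lemma comp1_succ f : comp1 f -> comp1 (fun x => (f x).+1).
Proof. exact: recursive_succ. Qed.

(* The recursion argument of [comp2_prim] is the second one. *)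
Lemma comp2_prim f (g : nat -> nat -> nat -> nat) :
  comp1 f -> recursive 3 (fun v => g (nth 0 v 2) (nth 0 v 0) (nth 0 v 1)) ->
  comp2 (fun x n => natrec (f x) (g x) n).
Proof.
move=> cf cg; have := @recursive_prim 1 (fun v => f (nth 0 v 0))
  (fun v => g (nth 0 v 2) (nth 0 v 0) (nth 0 v 1)) cf cg.
move=> /(@recursive_comp 2 _ [:: nth 0 ^~ 1; nth 0 ^~ 0]) H.
by apply: H => -[|[]] // _; apply: recursive_proj.
Qed.

Lemma comp2_add : comp2 addn.
Proof.
have : comp2 (fun x n => natrec x (fun _ y => y.+1) n).
  apply: (comp2_prim (f := id) (g := fun _ _ y => y.+1)); first exact: comp1_id.
  by apply: recursive_succ; apply: recursive_proj.
apply: recursive_ext => v; elim: (nth 0 v 1) => [|n /= ->]; rewrite ?addn0 ?addnS //.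
Qed.

Lemma comp2_mul : comp2 muln.
Proof.
have : comp2 (fun x n => natrec 0 (fun _ y => y + x) n).
  apply: (comp2_prim (f := fun=> 0) (g := fun x _ y => y + x)); first exact: comp1_const.
  by apply: recursive_app2; [exact: comp2_add | |]; apply: recursive_proj.
by apply: recursive_ext => v; elim: (nth 0 v 1) => [|n /= ->]; rewrite ?muln0 ?mulnS // addnC.
Qed.

Lemma comp2_exp : comp2 expn.
Proof.
have : comp2 (fun x n => natrec 1 (fun _ y => y * x) n).
  apply: (comp2_prim (f := fun=> 1) (g := fun x _ y => y * x)); first exact: comp1_const.
  by apply: recursive_app2; [exact: comp2_mul | |]; apply: recursive_proj.
by apply: recursive_ext => v; elim: (nth 0 v 1) => [|n /= ->]; rewrite ?expn0 ?expnS // mulnC.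
Qed.

Lemma comp1_pred : comp1 predn.
Proof.
have : comp2 (fun _ n => natrec 0 (fun i _ => i) n).
  apply: (comp2_prim (f := fun=> 0) (g := fun _ i _ => i)); first exact: comp1_const.
  exact: recursive_proj.
move=> /comp1_comp2 H; apply: comp1_ext (H _ _ comp1_id comp1_id) => n; by case: n.
Qed.

Lemma comp2_sub : comp2 subn.
Proof.
have : comp2 (fun x n => natrec x (fun _ y => y.-1) n).
  apply: (comp2_prim (f := id) (g := fun _ _ y => y.-1)); first exact: comp1_id.
  by apply: recursive_app1; [exact: comp1_pred | apply: recursive_proj].
by apply: recursive_ext => v; elim: (nth 0 v 1) => [|n /= ->]; rewrite ?subn0 ?subnS.
Qed.

Lemma comp1_odd : comp1 (fun n => odd n).
Proof.
have : comp2 (fun _ n => natrec 0 (fun _ y => 1 - y) n).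
  apply: (comp2_prim (f := fun=> 0) (g := fun _ _ y => 1 - y)); first exact: comp1_const.
  by apply: recursive_app2; [exact: comp2_sub | apply: recursive_const | apply: recursive_proj].
move=> /comp1_comp2 H; apply: comp1_ext (H _ _ comp1_id comp1_id).
by elim=> //= n ->; case: (odd n).
Qed.

Lemma comp1_half : comp1 half.
Proof.
have : comp2 (fun _ n => natrec 0 (fun i y => odd i + y) n).
  apply: (comp2_prim (f := fun=> 0) (g := fun _ i y => odd i + y)); first exact: comp1_const.
  apply: recursive_app2; [exact: comp2_add | | apply: recursive_proj => //].
  by apply: (@recursive_app1 3 (fun n => odd n) (nth 0 ^~ 0) comp1_odd); apply: recursive_proj.
move=> /comp1_comp2 H; apply: comp1_ext (H _ _ comp1_id comp1_id).
by elim=> //= n ->; rewrite uphalf_half.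
Qed.

Lemma comp2_iterhalf : comp2 (fun x n => iter n half x).
Proof.
have : comp2 (fun x n => natrec x (fun _ y => y./2) n).
  apply: (comp2_prim (f := id) (g := fun _ _ y => y./2)); first exact: comp1_id.
  by apply: recursive_app1; [exact: comp1_half | apply: recursive_proj].
by apply: recursive_ext => v; elim: (nth 0 v 1) => //= n ->.
Qed.

(** * Natural numbers as S-expressions *)

(** A bijection from pairs of numbers to positive numbers. With [0] for the empty list every number
    is a list of numbers, themselves lists, so no number is an ill-formed S-expression. *)
Definition ccons (a b : nat) : nat := 2 ^ a * b.*2.+1.
Definition lst := CodeSeq.decode.
Definition car z := head 0 (lst z).
Definition cdr z := CodeSeq.code (behead (lst z)).

Lemma code_cons a s : CodeSeq.code (a :: s) = ccons a (CodeSeq.code s).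
Proof. by []. Qed.

Lemma lst_code s : lst (CodeSeq.code s) = s. Proof. exact: CodeSeq.codeK. Qed.
Lemma code_lst z : CodeSeq.code (lst z) = z. Proof. exact: CodeSeq.decodeK. Qed.

Lemma lst_cons a b : lst (ccons a b) = a :: lst b.
Proof. by rewrite -{1}(code_lst b) -code_cons lst_code. Qed.

Lemma car_cons a b : car (ccons a b) = a. Proof. by rewrite /car lst_cons. Qed.
Lemma cdr_cons a b : cdr (ccons a b) = b. Proof. by rewrite /cdr lst_cons /= code_lst. Qed.
Lemma car0 : car 0 = 0. Proof. by []. Qed.
Lemma cdr0 : cdr 0 = 0. Proof. by []. Qed.
Lemma lst0 : lst 0 = [::]. Proof. by []. Qed.

Lemma cons_gt0 a b : 0 < ccons a b. Proof. by rewrite muln_gt0 expn_gt0. Qed.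

Lemma lst_car z : 0 < z -> lst z = car z :: lst (cdr z).
Proof.
rewrite -{1}(code_lst z) /car /cdr lst_code.
by case: (lst z) => //= a s _; rewrite lst_code.
Qed.

Lemma cons_car z : 0 < z -> z = ccons (car z) (cdr z).
Proof. by move=> z0; rewrite -{1}(code_lst z) (lst_car z0) code_cons code_lst. Qed.

Lemma cons_inj a b c d : ccons a b = ccons c d -> a = c /\ b = d.
Proof. by move=> e; split; [rewrite -(car_cons a b) e car_cons | rewrite -(cdr_cons a b) e cdr_cons]. Qed.

Lemma cdr_lt z : 0 < z -> cdr z < z.
Proof.
move=> z0; rewrite {2}(cons_car z0) /ccons.
apply: leq_trans (leq_pmull _ _); rewrite ?expn_gt0 //; lia.
Qed.

Lemma size_lst z : size (lst z) <= z.
Proof.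
elim/ltn_ind: z => z IHz; case: (posnP z) => [-> //|z0].
by rewrite (lst_car z0) /=; apply: leq_ltn_trans (IHz _ (cdr_lt z0)) (cdr_lt z0).
Qed.

Lemma comp2_cons : comp2 ccons.
Proof.
apply: (@comp2_comp2 muln (fun a _ => 2 ^ a) (fun _ b => b.*2.+1) comp2_mul).
  apply: (@comp2_comp2 expn (fun _ _ => 2) (fun a _ => a) comp2_exp).
    exact: recursive_const.
  exact: comp2_fst.
apply: (@comp2_comp (fun y => y.*2.+1) (fun _ y => y)); last exact: comp2_snd.
apply: comp1_succ; apply: (comp1_ext (f := fun y => 2 * y)) => [y|]; first by rewrite mul2n.
by apply: (@comp1_comp2 muln (fun=> 2) id comp2_mul); [apply: comp1_const | apply: comp1_id].
Qed.

Lemma iterhalf_cons a b n : n <= a -> iter n half (ccons a b) = ccons (a - n) b.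
Proof.
elim: n => [|n IHn] na /=; first by rewrite subn0.
rewrite IHn 1?ltnW //; have -> : a - n = (a - n.+1).+1 by lia.
by rewrite /ccons expnS -mulnA mul2n doubleK.
Qed.

Lemma iterhalf z n : 0 < z -> n <= car z -> iter n half z = ccons (car z - n) (cdr z).
Proof. by move=> z0 na; rewrite {1}(cons_car z0) iterhalf_cons. Qed.

(** [car z] is the 2-adic valuation of [z]: the least number of halvings that lead to an odd number,
    found by minimisation. The summand [z == 0] stops the search at once on the empty list. *)
Lemma comp1_car : comp1 car.
Proof.
pose F v := 1 - ((nth 0 v 1 == 0) + odd (iter (nth 0 v 0) half (nth 0 v 1))).
apply: (@recursive_mu 1 F).
  apply: recursive_app2; [exact: comp2_sub | exact: recursive_const |].
  apply: recursive_app2; first exact: comp2_add.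
    apply: (@recursive_app1 2 (fun n => n == 0) (nth 0 ^~ 1)); last exact: recursive_proj.
    apply: (comp1_ext (f := fun n => 1 - n)); first by case.
    by apply: (comp1_comp2 comp2_sub); [apply: comp1_const | apply: comp1_id].
  apply: (@recursive_app1 2 (fun n => odd n) _ comp1_odd).
  apply: (@recursive_app2 2 (fun x n => iter n half x) (nth 0 ^~ 1) (nth 0 ^~ 0)).
  - exact: comp2_iterhalf.
  - exact: recursive_proj.
  - exact: recursive_proj.
move=> v /=; rewrite /F /=; set z := nth 0 v 0.
have [->|z0] := posnP z; first by rewrite car0; split.
rewrite !add0n iterhalf // subnn /ccons mul1n /= odd_double.
split=> // y ylt; rewrite iterhalf ?(ltnW ylt) //.
have /prednK <- : 0 < car z - y by rewrite subn_gt0.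
by rewrite /ccons expnS -mulnA mul2n odd_double.
Qed.

Lemma comp1_cdr : comp1 cdr.
Proof.
(* After [car z] halvings a nonzero [z] has become [(cdr z).*2.+1]; one more halving drops the final
   bit. *)
apply: (comp1_ext (f := fun z => (iter (car z) half z)./2)) => [z|].
  have [->|z0] := posnP z; first by rewrite car0 cdr0.
  rewrite iterhalf // subnn /ccons mul1n.
  by rewrite /= uphalf_double.
apply: (comp1_comp comp1_half).
by apply: (@comp1_comp2 (fun x n => iter n half x) id car comp2_iterhalf); [apply: comp1_id | apply: comp1_car].
Qed.

Lemma comp_id : comp1 (fun x => x). Proof. exact: comp1_id. Qed.
Lemma comp_const n : comp1 (fun=> n). Proof. exact: comp1_const. Qed.
Lemma comp_succ f : comp1 f -> comp1 (fun x => (f x).+1). Proof. exact: comp1_succ. Qed.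
Lemma comp_pred f : comp1 f -> comp1 (fun x => (f x).-1).
Proof. exact: comp1_comp comp1_pred. Qed.
Lemma comp_car f : comp1 f -> comp1 (fun x => car (f x)).
Proof. exact: comp1_comp comp1_car. Qed.
Lemma comp_cdr f : comp1 f -> comp1 (fun x => cdr (f x)).
Proof. exact: comp1_comp comp1_cdr. Qed.
Lemma comp_cons f g : comp1 f -> comp1 g -> comp1 (fun x => ccons (f x) (g x)).
Proof. exact: comp1_comp2 comp2_cons. Qed.
Lemma comp_add f g : comp1 f -> comp1 g -> comp1 (fun x => f x + g x).
Proof. exact: comp1_comp2 comp2_add. Qed.
Lemma comp_mul f g : comp1 f -> comp1 g -> comp1 (fun x => f x * g x).
Proof. exact: comp1_comp2 comp2_mul. Qed.
Lemma comp_exp f g : comp1 f -> comp1 g -> comp1 (fun x => f x ^ g x).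
Proof. exact: comp1_comp2 comp2_exp. Qed.
Lemma comp_sub f g : comp1 f -> comp1 g -> comp1 (fun x => f x - g x).
Proof. exact: comp1_comp2 comp2_sub. Qed.

(** * Computable conditions, iteration and list operations *)

Lemma comp_negb (b : nat -> bool) : comp1 (fun x => b x) -> comp1 (fun x => ~~ b x).
Proof.
move=> cb; apply: (comp1_ext (f := fun x => 1 - b x)) => [x|]; first by case: (b x).
exact: (comp_sub (comp_const 1) cb).
Qed.

Lemma comp_leq f g : comp1 f -> comp1 g -> comp1 (fun x => f x <= g x).
Proof.
move=> cf cg; apply: (comp1_ext (f := fun x => 1 - (f x - g x))) => [x|].
  by case: leqP => /=; lia.
exact: (comp_sub (comp_const 1) (comp_sub cf cg)).
Qed.

Lemma comp_andb (b c : nat -> bool) :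
  comp1 (fun x => b x) -> comp1 (fun x => c x) -> comp1 (fun x => b x && c x).
Proof.
move=> cb cc; apply: (comp1_ext (f := fun x => b x * c x)) => [x|]; first by rewrite mulnb.
exact: (comp_mul cb cc).
Qed.

Lemma comp_orb (b c : nat -> bool) :
  comp1 (fun x => b x) -> comp1 (fun x => c x) -> comp1 (fun x => b x || c x).
Proof.
move=> cb cc; apply: (comp1_ext (f := fun x => ~~ (~~ b x && ~~ c x))) => [x|].
  by case: (b x); case: (c x).
exact: (comp_negb (comp_andb (comp_negb cb) (comp_negb cc))).
Qed.

Lemma comp_implyb (b c : nat -> bool) :
  comp1 (fun x => b x) -> comp1 (fun x => c x) -> comp1 (fun x => b x ==> c x).
Proof.
move=> cb cc; apply: (comp1_ext (f := fun x => ~~ b x || c x)) => [x|]; first by case: (b x).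
exact: (comp_orb (comp_negb cb) cc).
Qed.

Lemma comp_eq f g : comp1 f -> comp1 g -> comp1 (fun x => f x == g x).
Proof.
move=> cf cg; apply: (comp1_ext (f := fun x => (f x <= g x) && (g x <= f x))) => [x|].
  by rewrite eqn_leq.
exact: (comp_andb (comp_leq cf cg) (comp_leq cg cf)).
Qed.

Lemma comp_eqb (b c : nat -> bool) :
  comp1 (fun x => b x) -> comp1 (fun x => c x) -> comp1 (fun x => b x == c x).
Proof.
move=> cb cc; apply: (comp1_ext (f := fun x => (b x : nat) == (c x : nat))) => [x|].
  by case: (b x); case: (c x).
exact: comp_eq.
Qed.

Lemma comp_if (b : nat -> bool) f g : comp1 (fun x => b x) -> comp1 f -> comp1 g ->
  comp1 (fun x => if b x then f x else g x).
Proof.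
move=> cb cf cg; apply: (comp1_ext (f := fun x => b x * f x + (~~ b x) * g x)) => [x|].
  by case: (b x); rewrite !(mul0n, mul1n, addn0, add0n).
exact: (comp_add (comp_mul cb cf) (comp_mul (comp_negb cb) cg)).
Qed.

(* A function of several arguments is [comp1] when it is so as a function of
   the nested pair of its arguments. *)
Lemma comp_app2 (F : nat -> nat -> nat) f g :
  comp1 (fun z => F (car z) (cdr z)) -> comp1 f -> comp1 g -> comp1 (fun x => F (f x) (g x)).
Proof.
move=> cF cf cg; have := comp1_comp cF (comp_cons cf cg).
by apply: comp1_ext => x; rewrite car_cons cdr_cons.
Qed.

Lemma comp_natrec (G : nat -> nat -> nat -> nat) a n :
  comp1 a -> comp1 (fun z => G (car z) (car (cdr z)) (cdr (cdr z))) -> comp1 n ->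
  comp1 (fun x => natrec (a x) (G x) (n x)).
Proof.
move=> ca cG cn.
have : comp2 (fun x n => natrec (a x) (G x) n).
  apply: comp2_prim => //.
  have := @recursive_app1 3 _
    (fun v => ccons (nth 0 v 2) (ccons (nth 0 v 0) (nth 0 v 1))) cG.
  move=> H; apply: recursive_ext (H _) => [v|].
    by rewrite !(car_cons, cdr_cons).
  do ![apply: recursive_proj => // | apply: recursive_app2 comp2_cons _ _].
by move=> /comp1_comp2 H; apply: H => //; apply: comp_id.
Qed.

Lemma comp_iter (G : nat -> nat -> nat) a n :
  comp1 a -> comp1 (fun z => G (car z) (cdr z)) -> comp1 n ->
  comp1 (fun x => iter (n x) (G x) (a x)).
Proof.
move=> ca cG cn; apply: (comp1_ext (f := fun x => natrec (a x) (fun _ y => G x y) (n x))).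
  by move=> x; elim: (n x) => //= k ->.
apply: comp_natrec => //; apply: (comp_app2 cG).
  exact: comp_car comp_id.
exact: comp_cdr (comp_cdr comp_id).
Qed.

Lemma comp_foldl (F : nat -> nat -> nat -> nat) a l :
  comp1 (fun z => F (car z) (car (cdr z)) (cdr (cdr z))) -> comp1 a -> comp1 l ->
  comp1 (fun x => foldl (F x) (a x) (lst (l x))).
Proof.
move=> cF ca cl.
pose G x s := if cdr s == 0 then s else ccons (F x (car s) (car (cdr s))) (cdr (cdr s)).
apply: (comp1_ext (f := fun x => car (iter (l x) (G x) (ccons (a x) (l x))))).
  move=> x; suff H n m y : m <= n -> car (iter n (G x) (ccons y m)) = foldl (F x) y (lst m).
    exact: H.
  elim: n m y => [|n IHn] m y; first by rewrite leqn0 => /eqP ->; rewrite /= car_cons.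
  move=> mn; rewrite iterSr /G cdr_cons car_cons; case: eqVneq => [->|].
    by rewrite IHn.
  rewrite -lt0n => m0; rewrite IHn; first by rewrite (lst_car m0).
  exact: leq_trans (cdr_lt m0) mn.
apply/comp_car/comp_iter => //; first exact: comp_cons.
have c2 := comp_cdr comp_id; have c1 := comp_car comp_id.
apply: comp_if => //; first by apply: comp_eq (comp_const _); apply: comp_cdr.
apply: comp_cons; last exact: (comp_cdr (comp_cdr c2)).
have := comp1_comp cF (comp_cons c1 (comp_cons (comp_car c2) (comp_car (comp_cdr c2)))).
by apply: comp1_ext => z; rewrite !(car_cons, cdr_cons).
Qed.

Lemma comp_foldr (F : nat -> nat -> nat -> nat) a l :
  comp1 (fun z => F (car z) (car (cdr z)) (cdr (cdr z))) -> comp1 a -> comp1 l ->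
  comp1 (fun x => foldr (F x) (a x) (lst (l x))).
Proof.
move=> cF ca cl.
pose rv l := foldl (fun s e => ccons e s) 0 (lst l).
have rvE m : lst (rv m) = rev (lst m).
  rewrite /rv -(cats0 (rev _)) -lst0; elim: (lst m) 0 => //= e s IHs k.
  by rewrite IHs rev_cons cat_rcons lst_cons.
apply: (comp1_ext (f := fun x => foldl (fun y e => F x e y) (a x) (lst (rv (l x))))).
  by move=> x; rewrite rvE foldl_rev.
have c2 := comp_cdr comp_id; have c1 := comp_car comp_id.
apply: (comp_foldl (F := fun x y e => F x e y)) => //.
  have := comp1_comp cF (comp_cons c1 (comp_cons (comp_cdr c2) (comp_car c2))).
  by apply: comp1_ext => z; rewrite !(car_cons, cdr_cons).
apply: (comp_foldl (F := fun _ s e => ccons e s)) => //; last exact: comp_const.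
by apply: comp_cons; [apply: (comp_cdr c2) | apply: (comp_car c2)].
Qed.

Lemma comp_all (P : nat -> nat -> bool) l :
  comp1 (fun z => P (car z) (cdr z)) -> comp1 l -> comp1 (fun x => all (P x) (lst (l x))).
Proof.
move=> cP cl; pose F x e y : nat := P x e && (0 < y).
apply: (comp1_ext (f := fun x => foldr (F x) 1 (lst (l x)))).
  move=> x; elim: (lst _) => //= e s ->; rewrite /F; by case: (P x e); case: (all _ _).
apply: (comp_foldr (a := fun=> 1)) cl => //; last exact: comp_const.
have c2 := comp_cdr comp_id; have c1 := comp_car comp_id.
apply: comp_andb; last by apply: comp_leq; [apply: comp_const | apply: comp_cdr].
exact: (comp_app2 (F := fun x e => P x e)) (comp_car c2).
Qed.

Lemma comp_has (P : nat -> nat -> bool) l :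
  comp1 (fun z => P (car z) (cdr z)) -> comp1 l -> comp1 (fun x => has (P x) (lst (l x))).
Proof.
move=> cP cl; apply: (comp1_ext (f := fun x => ~~ all (fun e => ~~ P x e) (lst (l x)))).
  by move=> x; rewrite -has_predC /=; congr (nat_of_bool _); apply: eq_has => e /=; rewrite negbK.
apply: (comp_negb (comp_all (P := fun x e => ~~ P x e) _ cl)); exact: comp_negb.
Qed.

Lemma comp_mem f l : comp1 f -> comp1 l -> comp1 (fun x => f x \in lst (l x)).
Proof.
move=> cf cl; apply: (comp1_ext (f := fun x => has (fun e => e == f x) (lst (l x)))).
  by move=> x; rewrite -has_pred1.
apply: (comp_has (P := fun x e => e == f x)) => //.
by apply: comp_eq; [apply: comp_cdr comp_id | apply: comp1_comp cf (comp_car comp_id)].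
Qed.

Definition cmap F l := CodeSeq.code (map F (lst l)).
Definition cflat F l := CodeSeq.code (flatten [seq lst (F e) | e <- lst l]).
Definition ccat a b := CodeSeq.code (lst a ++ lst b).
Definition cfilter P l := CodeSeq.code (filter P (lst l)).
Definition ciota m n := CodeSeq.code (iota m n).
Definition cnth l n := nth 0 (lst l) n.

Lemma comp_map (F : nat -> nat -> nat) l :
  comp1 (fun z => F (car z) (cdr z)) -> comp1 l -> comp1 (fun x => cmap (F x) (l x)).
Proof.
move=> cF cl; apply: (comp1_ext (f := fun x => foldr (fun e s => ccons (F x e) s) 0 (lst (l x)))).
  by move=> x; rewrite /cmap; elim: (lst _) => //= e s ->.
apply: (comp_foldr (F := fun x e s => ccons (F x e) s)) (comp_const 0) cl.
have c2 := comp_cdr comp_id.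
by apply: comp_cons (comp_cdr c2); apply: comp_app2 cF (comp_car comp_id) (comp_car c2).
Qed.

Lemma comp_ccat f g : comp1 f -> comp1 g -> comp1 (fun x => ccat (f x) (g x)).
Proof.
move=> cf cg; apply: (comp1_ext (f := fun x => foldr (fun e s => ccons e s) (g x) (lst (f x)))).
  by move=> x; rewrite /ccat; elim: (lst (f x)) => /= [|e s ->]; rewrite ?code_lst.
by apply: (comp_foldr (F := fun _ e s => ccons e s)) => //; apply: comp_cons; do ![apply: comp_cdr | apply: comp_car | apply: comp_id].
Qed.

Lemma comp_cflat (F : nat -> nat -> nat) l :
  comp1 (fun z => F (car z) (cdr z)) -> comp1 l -> comp1 (fun x => cflat (F x) (l x)).
Proof.
move=> cF cl; apply: (comp1_ext (f := fun x => foldr (fun e s => ccat (F x e) s) 0 (lst (l x)))).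
  by move=> x; rewrite /cflat; elim: (lst _) => //= e s ->; rewrite /ccat lst_code.
apply: (comp_foldr (F := fun x e s => ccat (F x e) s)) (comp_const 0) cl.
have c2 := comp_cdr comp_id.
by apply: comp_ccat (comp_cdr c2); apply: comp_app2 cF (comp_car comp_id) (comp_car c2).
Qed.

Lemma comp_cfilter (P : nat -> nat -> bool) l :
  comp1 (fun z => P (car z) (cdr z)) -> comp1 l -> comp1 (fun x => cfilter (P x) (l x)).
Proof.
move=> cP cl; apply: (comp1_ext (f := fun x => cflat (fun e => if P x e then ccons e 0 else 0) (l x))).
  move=> x; rewrite /cflat /cfilter; congr CodeSeq.code.
  by elim: (lst _) => //= e s ->; case: (P x e); rewrite ?lst_cons.
apply: (comp_cflat (F := fun x e => if P x e then ccons e 0 else 0)) => //.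
by apply: comp_if => //; [apply: comp_cons (comp_const 0); apply: comp_cdr comp_id | apply: comp_const].
Qed.

Lemma comp_ciota m n : comp1 m -> comp1 n -> comp1 (fun x => ciota (m x) (n x)).
Proof.
move=> cm cn.
apply: (comp1_ext (f := fun x => natrec 0 (fun i s => ccat s (ccons (m x + i) 0)) (n x))).
  move=> x; rewrite /ciota; elim: (n x) => // k IHk; rewrite -[in RHS]addn1 iotaD [LHS]/= IHk.
  by rewrite /ccat lst_code lst_cons.
apply: (comp_natrec (G := fun x i s => ccat s (ccons (m x + i) 0))) (comp_const 0) _ cn.
have c2 := comp_cdr comp_id.
apply: comp_ccat (comp_cdr c2) (comp_cons _ (comp_const 0)).
by apply: comp_add (comp_car c2); apply: comp1_comp cm (comp_car comp_id).
Qed.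

Lemma comp_cnth l n : comp1 l -> comp1 n -> comp1 (fun x => cnth (l x) (n x)).
Proof.
move=> cl cn; apply: (comp1_ext (f := fun x => car (iter (n x) cdr (l x)))).
  move=> x; rewrite /cnth /car -nth0 -[n x in RHS]addn0 -nth_drop; congr nth.
  by elim: (n x) => //= [|k IHk]; rewrite ?drop0 // /cdr lst_code IHk -drop1 drop_drop add1n.
by apply/comp_car/(comp_iter (G := fun _ y => cdr y)) => //; apply/comp_cdr/comp_cdr/comp_id.
Qed.

(** [nat_of_bool] is itself a conditional, on which [comp_if] would apply forever; hence the failing
    case in front of it for the tests that no rule covers. *)
Ltac comp_step :=
  lazymatch goal with
    | |- comp1 (fun x => x) => exact: comp_id
    | |- comp1 (fun _ => ?n) => exact: comp_const
    | |- comp1 (fun x => ccons (@?f x) (@?g x)) => apply: (@comp_cons f g)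
    | |- comp1 (fun x => car (@?f x)) => apply: (@comp_car f)
    | |- comp1 (fun x => cdr (@?f x)) => apply: (@comp_cdr f)
    | |- comp1 (fun x => S (@?f x)) => apply: (@comp_succ f)
    | |- comp1 (fun x => predn (@?f x)) => apply: (@comp_pred f)
    | |- comp1 (fun x => addn (@?f x) (@?g x)) => apply: (@comp_add f g)
    | |- comp1 (fun x => muln (@?f x) (@?g x)) => apply: (@comp_mul f g)
    | |- comp1 (fun x => expn (@?f x) (@?g x)) => apply: (@comp_exp f g)
    | |- comp1 (fun x => subn (@?f x) (@?g x)) => apply: (@comp_sub f g)
    | |- comp1 (fun x => nat_of_bool (negb (@?b x))) => apply: (@comp_negb b)
    | |- comp1 (fun x => nat_of_bool (leq (@?f x) (@?g x))) => apply: (@comp_leq f g)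
    | |- comp1 (fun x => nat_of_bool (andb (@?b x) (@?c x))) => apply: (@comp_andb b c)
    | |- comp1 (fun x => nat_of_bool (orb (@?b x) (@?c x))) => apply: (@comp_orb b c)
    | |- comp1 (fun x => nat_of_bool (implb (@?b x) (@?c x))) => apply: (@comp_implyb b c)
    | |- comp1 (fun x => nat_of_bool (@eq_op _ (@?f x) (@?g x))) =>
        first [apply: (@comp_eq f g) | apply: (@comp_eqb f g)]
    | |- comp1 (fun x => natrec (@?a x) (@?G x) (@?n x)) => apply: (@comp_natrec G a n)
    | |- comp1 (fun x => iter (@?n x) (@?G x) (@?a x)) => apply: (@comp_iter G a n)
    | |- comp1 (fun x => foldr (@?G x) (@?a x) (lst (@?l x))) => apply: (@comp_foldr G a l)
    | |- comp1 (fun x => foldl (@?G x) (@?a x) (lst (@?l x))) => apply: (@comp_foldl G a l)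
    | |- comp1 (fun x => nat_of_bool (all (@?P x) (lst (@?l x)))) => apply: (@comp_all P l)
    | |- comp1 (fun x => nat_of_bool (has (@?P x) (lst (@?l x)))) => apply: (@comp_has P l)
    | |- comp1 (fun x => nat_of_bool (in_mem (@?f x) (mem (lst (@?l x))))) =>
        apply: (@comp_mem f l)
    | |- comp1 (fun x => cmap (@?F x) (@?l x)) => apply: (@comp_map F l)
    | |- comp1 (fun x => cflat (@?F x) (@?l x)) => apply: (@comp_cflat F l)
    | |- comp1 (fun x => cfilter (@?P x) (@?l x)) => apply: (@comp_cfilter P l)
    | |- comp1 (fun x => ccat (@?f x) (@?g x)) => apply: (@comp_ccat f g)
    | |- comp1 (fun x => ciota (@?f x) (@?g x)) => apply: (@comp_ciota f g)
    | |- comp1 (fun x => cnth (@?f x) (@?g x)) => apply: (@comp_cnth f g)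
    | H : ?P |- ?P => exact: H
    | |- comp1 (fun x => nat_of_bool _) => fail
    | _ => apply: comp_if
  end.
Ltac comp_tac := cbv beta zeta; repeat (comp_step; cbv beta zeta).

(** * Alternating programs *)

(* A call [x] is evaluated to a truth value from those of the calls in
   [lst (cdr (step x))]: their disjunction, the negation of their disjunction
   or their conjunction, for [car (step x)] equal to 0, 1 or 2. *)
Section Alternating.
Variable step : nat -> nat.

Let subcalls x := lst (cdr (step x)).
(** Two rules cover the three modes: a call has the value [val x] if all its subcalls have the value
    [arg x], and the opposite value as soon as one subcall has the value opposite to [arg x]. *)
Let arg x := 1 < car (step x).
Let val x := 0 < car (step x).

(** As a least fixed point this tolerates calls that run forever: they just have no value. *)
Inductive evaluates : nat -> bool -> Prop :=
| Evaluates_all x :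
    (forall d, d \in subcalls x -> evaluates d (arg x)) -> evaluates x (val x)
| Evaluates_has x d :
    d \in subcalls x -> evaluates d (~~ arg x) -> evaluates x (~~ val x).

Lemma evaluates_inj x b c : evaluates x b -> evaluates x c -> b = c.
Proof.
move=> evb; elim: evb c => {x b} [x _ IH|x d dx _ IH] c evc.
  inversion evc as [|y d dx evd]; subst => //.
  by have := IH _ dx _ evd; case: (arg x).
inversion evc as [y evd|]; subst => //.
by have := IH _ (evd _ dx); case: (arg x).
Qed.

Let justified (e t : nat) : bool :=
  let x := car e in
  (cdr e == val x) && all (fun d => ccons d (arg x) \in lst t) (subcalls x) ||
  (cdr e == ~~ val x) && has (fun d => ccons d (~~ arg x) \in lst t) (subcalls x).

(** A derivation of [evaluates] written as a list of pairs of a call and its value, each of which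
    follows from the pairs behind it. *)
Fixpoint table (s : seq nat) : bool :=
  if s is e :: s' then justified e (CodeSeq.code s') && table s' else true.

Lemma justified_sub e t t' : {subset lst t <= lst t'} -> justified e t -> justified e t'.
Proof.
rewrite /justified => tt' /orP[] /andP[-> /=].
  by move=> /allP H; apply/orP; left; apply/allP => d /H /tt'.
by case/hasP=> d dx dt; apply/orP; right; apply/hasP; exists d => //; apply: tt'.
Qed.

Lemma table_cat s t : table s -> table t -> table (s ++ t).
Proof.
elim: s => //= e s IHs /andP[je ts] tt; rewrite IHs // andbT.
by apply: justified_sub je => x; rewrite !lst_code mem_cat => ->.
Qed.

Lemma table_sound s x b : table s -> ccons x (nat_of_bool b) \in s -> evaluates x b.
Proof.
elim: s x b => //= e s IHs x b /andP[+ ts]; rewrite inE => /[swap].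
case/predU1P=> [<-|/(IHs _ _ ts) //]; rewrite /justified car_cons cdr_cons lst_code.
case/orP=> /andP[/eqP eb].
  have -> : b = val x by move: eb; case: b; case: (val x).
  by move=> /allP H; apply: Evaluates_all => d /H /(IHs _ _ ts).
have -> : b = ~~ val x by move: eb; case: b; case: (val x).
by move=> /hasP[d dx /(IHs _ _ ts)]; apply: Evaluates_has.
Qed.

Lemma table_complete x b : evaluates x b -> exists2 s, table s & ccons x (nat_of_bool b) \in s.
Proof.
elim=> {x b} [x _ IH|x d dx _ [s ts ds]].
  suff [s ts sP] : exists2 s, table s & forall d, d \in subcalls x -> ccons d (arg x) \in s.
    exists (ccons x (val x) :: s); rewrite ?mem_head //= ts andbT /justified.
    apply/orP; left; rewrite car_cons cdr_cons eqxx lst_code; exact/allP.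
  elim: (subcalls x) IH => [|d l IHl] IH; first by exists [::].
  have [|s ts sP] := IHl; first by move=> e el; apply: IH; rewrite inE el orbT.
  have [t tt dt] := IH d (mem_head _ _).
  exists (t ++ s); first exact: table_cat.
  by move=> e; rewrite inE mem_cat => /predU1P[->|/sP ->]; rewrite ?dt ?orbT.
exists (ccons x (~~ val x) :: s); rewrite ?mem_head //= ts andbT /justified.
apply/orP; right; rewrite car_cons cdr_cons eqxx lst_code.
by apply/hasP; exists d.
Qed.

Hypothesis comp_step : comp1 step.

Lemma comp_table : comp1 (fun t => table (lst t)).
Proof.
(* The recursion on [table] becomes a bounded quantification over suffixes: [iter e cdr t] is suffix
   number [e], it is [0] beyond the end, and [e < t] exceeds the length of the list. *)
pose ok e t := (iter e cdr t == 0) || justified (car (iter e cdr t)) (cdr (iter e cdr t)).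
apply: (comp1_ext (f := fun t => all (fun e => ok e t) (lst (ciota 0 t)))) => [t|].
  rewrite lst_code; congr nat_of_bool.
  elim/ltn_ind: t => t IHt; have [->|t0] := posnP t; first by rewrite lst0.
  rewrite (lst_car t0) /= code_lst -IHt ?cdr_lt //.
  have j0 : ok 0 t = justified (car t) (cdr t) by rewrite /ok /= (gtn_eqF t0).
  have jS n : ok n.+1 t = ok n (cdr t) by rewrite /ok iterSr.
  have it0 n m : n <= m -> iter m cdr n = 0.
    elim: m n => [|m IHm] n; first by rewrite leqn0 => /eqP.
    rewrite iterSr; have [-> _|n0 nm] := posnP n; first by rewrite cdr0 IHm.
    by apply: IHm; have := cdr_lt n0; lia.
  have -> : t = t.-1.+1 by lia.
  rewrite /= prednK // -j0; congr (_ && _).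
  apply/allP/allP => H e.
    rewrite mem_iota => /= elt; rewrite -jS; apply: H; rewrite mem_iota.
    by have := cdr_lt t0; lia.
  case: e => [|e]; rewrite mem_iota //= => elt; rewrite jS.
  have [le|gt] := ltnP e (cdr t); first by apply: H; rewrite mem_iota.
  by rewrite /ok it0.
have cs f : comp1 f -> comp1 (fun x => step (f x)) by move=> cf; apply: comp1_comp comp_step cf.
rewrite /ok /justified /val /arg /subcalls.
comp_tac.
all: try (apply: cs; comp_tac).
Qed.

(** The program searches for the least table that starts with an entry for [x] and returns the value
    in this entry; soundness of tables and determinism of [evaluates] make it the right one. *)
Theorem evaluates_recursive :
  exists r : recf 1, forall x b, evaluates x b -> reval r [tuple x] b.
Proof.
pose ok t x := table (lst t) && [&& 0 < t, 0 < car t & car (car t) == x].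
have [r rP] : recursive 2 (fun v => ~~ ok (nth 0 v 0) (nth 0 v 1)).
  have := @recursive_app1 2 (fun z => ~~ ok (car z) (cdr z)) (fun v => ccons (nth 0 v 0) (nth 0 v 1)).
  move=> H; apply: recursive_ext (H _ _) => [v||].
  - by rewrite car_cons cdr_cons.
  - rewrite /ok; apply: comp_negb; apply: comp_andb; last by comp_tac.
    exact: comp1_comp comp_table (comp_car comp_id).
  - by apply: recursive_app2 comp2_cons _ _; apply: recursive_proj.
have [s sP] : comp1 (fun t => cdr (car t)) by comp_tac.
exists (RComp s (fun _ : 'I_1 => RMu r)) => x b evb /=.
have exT : exists t, ok t x.
  have [t tt xt] := table_complete evb.
  have [t1 [t2 def_t]] : exists t1 t2, t = t1 ++ ccons x b :: t2.
    by case/splitPr: xt => t1 t2; exists t1, t2.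
  exists (CodeSeq.code (ccons x b :: t2)); rewrite /ok lst_code code_cons cons_gt0 !car_cons cons_gt0 eqxx.
  rewrite !andbT; move: tt; rewrite def_t; elim: t1 {def_t} => //= e t1 IH /andP[_ /IH].
  by move=> ->.
case: (ex_minnP exT) => t tok tmin; exists [tuple t] => [j|].
  have -> : tnth [tuple t] j = t by rewrite (tnth_nth 0) (ord1 j).
  split=> [|z zt]; first by have := rP [tuple t; x]; rewrite /= tok.
  exists 0; have := rP [tuple z; x]; rewrite /=.
  by case: (boolP (ok z x)) => // /tmin; rewrite leqNgt zt.
have := sP [tuple t]; rewrite /=.
suff -> : cdr (car t) = b by [].
case/and4P: tok => tt t0 ct /eqP cx.
have [b' eb'] : exists b' : bool, cdr (car t) = b'.
  move: tt; rewrite (lst_car t0) /= => /andP[+ _].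
  by case/orP=> /andP[/eqP -> _]; [exists (val (car (car t))) | exists (~~ val (car (car t)))].
rewrite eb'; congr nat_of_bool; apply: evaluates_inj evb.
by apply: table_sound tt _; rewrite -eb' -cx -cons_car // (lst_car t0) mem_head.
Qed.

End Alternating.

(** * Binary trees and automata *)

(* A binary tree stands for the forest whose first tree has root label [a] and
   children [l], and whose remaining trees are [r]; the address [i :: p] is the
   node [p] of the tree number [i] of the forest. *)
Inductive bt (A : Type) := Lf | Nd (a : A) (l r : bt A).
Arguments Lf {A}.

(** Renumbers the trees of a forest when another tree is put in front; the empty address, which is
    not a node, stays as it is. *)
Definition shift (p : addr) : addr := if p is i :: q then i.+1 :: q else [::].

Section BinaryTrees.
Variables A B C : Type.

Fixpoint blabel (b : bt A) (p : addr) : option A :=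
  match b, p with
  | Nd a l r, 0 :: p' => if p' is [::] then Some a else blabel l p'
  | Nd a l r, i.+1 :: p' => blabel r (i :: p')
  | _, _ => None
  end.

Definition bnodes (b : bt A) : pred addr := [pred p | isSome (blabel b p)].

Fixpoint bmapi (g : addr -> A -> B) (b : bt A) : bt B :=
  if b is Nd a l r then
    Nd (g [:: 0] a) (bmapi (fun p => g (0 :: p)) l) (bmapi (fun p => g (shift p)) r)
  else Lf.

Fixpoint bsize (b : bt A) : nat :=
  if b is Nd _ l r then (bsize l + bsize r).+1 else 0.

End BinaryTrees.

Definition bmap A B (g : A -> B) := bmapi (fun _ => g).

Lemma blabel_nil A (b : bt A) : blabel b [::] = None.
Proof. by case: b. Qed.

Lemma bnodes_nil A (b : bt A) : ([::] \in bnodes b) = false.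
Proof. by rewrite inE blabel_nil. Qed.

Lemma bnodes0 A (a : A) l r p : (0 :: p \in bnodes (Nd a l r)) = (p == [::]) || (p \in bnodes l).
Proof. by case: p. Qed.

Lemma blabelS A (a : A) l r p : blabel (Nd a l r) (shift p) = blabel r p.
Proof. by case: p => //=; rewrite blabel_nil. Qed.

Lemma bnodesS A (a : A) l r p : (shift p \in bnodes (Nd a l r)) = (p \in bnodes r).
Proof. by rewrite !inE blabelS. Qed.

Lemma bnodesP A (a : A) l r p : p \in bnodes (Nd a l r) ->
  [\/ p = [:: 0], exists2 q, q \in bnodes l & p = 0 :: q
    | exists2 q, q \in bnodes r & p = shift q].
Proof.
case: p => [|[|i] p] // pN; last by apply: Or33; exists (i :: p).
move: pN; rewrite bnodes0 => /predU1P[->|pl]; first exact: Or31.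
by apply: Or32; exists p.
Qed.

Lemma blabel_mapi A B (g : addr -> A -> B) b p :
  blabel (bmapi g b) p = omap (g p) (blabel b p).
Proof.
elim: b g p => [|a l IHl r IHr] g [|[|i] [|j p]] //=; first by rewrite IHl.
  by rewrite (IHr (fun p => g (shift p))).
by rewrite (IHr (fun p => g (shift p))).
Qed.

Lemma bnodes_mapi A B (g : addr -> A -> B) b : bnodes (bmapi g b) =i bnodes b.
Proof. by move=> p; rewrite !inE blabel_mapi; case: blabel. Qed.

Lemma blabel_inj A (b c : bt A) : blabel b =1 blabel c -> b = c.
Proof.
elim: b c => [|a l IHl r IHr] [|a' l' r'] // bc.
- by have := bc [:: 0].
- by have := bc [:: 0].
have [->] := bc [:: 0]; congr Nd.
  by apply: IHl => -[|i p]; rewrite ?blabel_nil //; have := bc [:: 0, i & p].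
by apply: IHr => -[|i p]; rewrite ?blabel_nil //; have := bc (i.+1 :: p).
Qed.

Lemma bmapi_eq A B (g h : addr -> A -> B) b :
  {in bnodes b, forall p, g p =1 h p} -> bmapi g b = bmapi h b.
Proof.
move=> gh; apply: blabel_inj => p; rewrite !blabel_mapi.
by have := gh p; rewrite inE; case: blabel => //= a -> .
Qed.

Lemma bmapi_comp A B C (g : addr -> B -> C) (h : addr -> A -> B) b :
  bmapi g (bmapi h b) = bmapi (fun p a => g p (h p a)) b.
Proof. by apply: blabel_inj => p; rewrite !blabel_mapi; case: blabel. Qed.

Lemma bsize_mapi A B (g : addr -> A -> B) b : bsize (bmapi g b) = bsize b.
Proof. by elim: b g => //= a l IHl r IHr g; rewrite IHl IHr. Qed.

Arguments blabel : simpl never.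

Definition has_at A (R : pred A) (c : bt A) p := exists2 x, blabel c p = Some x & R x.

Lemma has_at00 A (R : pred A) a l r : has_at R (Nd a l r) [:: 0] <-> R a.
Proof. by split=> [[x [<-]]|Ra] //; exists a. Qed.

Lemma has_at_cons0 A (R : pred A) a l r p :
  p != [::] -> has_at R (Nd a l r) (0 :: p) <-> has_at R l p.
Proof. by case: p. Qed.

Lemma has_atS A (R : pred A) a l r p : has_at R (Nd a l r) (shift p) <-> has_at R r p.
Proof. by rewrite /has_at blabelS. Qed.

Lemma has_at_node A (R : pred A) c p : has_at R c p -> p \in bnodes c.
Proof. by case=> x; rewrite inE => ->. Qed.

Lemma has_at_neq0 A (R : pred A) c p : has_at R c p -> p != [::].
Proof. by case: p => // -[x]; rewrite blabel_nil. Qed.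

Lemma has_atP A (R : pred A) a l r p : has_at R (Nd a l r) p ->
  [\/ p = [:: 0] /\ R a, exists2 q, has_at R l q & p = 0 :: q
    | exists2 q, has_at R r q & p = shift q].
Proof.
move=> pR; have [p0|[q ql p0]|[q qr p0]] := bnodesP (has_at_node pR); subst p; move: pR.
- by move=> /has_at00; constructor 1.
- have q0 : q != [::] by case: (q) ql; rewrite ?bnodes_nil.
  by move=> /(has_at_cons0 _ _ _ _ q0); constructor 2; exists q.
- by move=> /has_atS; constructor 3; exists q.
Qed.

(** * Deterministic tree automata and regular relations *)

Record aut (A : Type) := Aut {
  aut_state : finType;
  aut_leaf : aut_state;
  aut_step : A -> aut_state -> aut_state -> aut_state;
  aut_final : pred aut_state
}.

Fixpoint run A (M : aut A) (b : bt A) : aut_state M :=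
  if b is Nd a l r then aut_step a (run M l) (run M r) else aut_leaf M.

(** One level of the tower pays for a product of two automata as well as for a subset construction.
    Sizes of automata thus reduce to heights, which increase by a constant with every operation. *)
Fixpoint tow (h : nat) : nat := if h is h'.+1 then 2 ^ tow h' else 2.

Lemma tow_ge2 h : 2 <= tow h.
Proof. by elim: h => //= h IHh; apply: (@leq_pexp2l 2 1) => //; apply: ltnW. Qed.

Lemma tow_lt h : tow h < tow h.+1. Proof. exact: ltn_expl. Qed.

Lemma leq_tow h k : h <= k -> tow h <= tow k.
Proof.
move=> /subnK <-; elim: (k - h) => // n IHn.
exact: leq_trans IHn (ltnW (tow_lt _)).
Qed.

Lemma sqr_leq_exp2 x : 4 <= x -> x * x <= 2 ^ x.
Proof.
elim: x => // x IHx; rewrite ltnS leq_eqVlt => /predU1P[<- //|lt3x].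
by rewrite expnS; have := IHx lt3x; nia.
Qed.

Lemma tow_mul h : tow h * tow h <= tow h.+1.
Proof.
by case: h => // h; apply: sqr_leq_exp2; apply: (@leq_pexp2l 2 2) => //; apply: tow_ge2.
Qed.

Section Regular.
Variables (A : Type).

Definition marked (I J : finType) := (A * {ffun I -> bool} * {ffun J -> bool})%type.

Definition mark (I J : finType) (b : bt A) (v : I -> addr) (V : J -> pred addr) :
    bt (marked I J) :=
  bmapi (fun p a => (a, [ffun i => v i == p], [ffun j => V j p])) b.

Definition bpred (I J : finType) := bt A -> (I -> addr) -> (J -> pred addr) -> Prop.

(** Mere existence of an automaton with at most [tow h] states. The node variables must denote
    nodes, since the automaton sees a variable only through its mark. *)
Definition regular (I J : finType) h (R : bpred I J) :=
  exists2 M : aut (marked I J), #|aut_state M| <= tow h &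
    forall b v V, (forall i, v i \in bnodes b) ->
      R b v V <-> aut_final (run M (mark b v V)).

Variables (I J : finType).
Implicit Types R : bpred I J.

Lemma regular_ext h R R' :
    (forall b v V, (forall i, v i \in bnodes b) -> R b v V <-> R' b v V) ->
  regular h R -> regular h R'.
Proof. by move=> RR' [M hM MP]; exists M => // b v V vb; rewrite -RR' // MP. Qed.

Lemma regular_leq h k R : h <= k -> regular h R -> regular k R.
Proof. by move=> /leq_tow hk [M hM MP]; exists M; rewrite // (leq_trans hM). Qed.

Lemma regular_not h R : regular h R -> regular h (fun b v V => ~ R b v V).
Proof.
move=> [M hM MP].
exists (@Aut _ _ (aut_leaf M) (@aut_step _ M) (predC (@aut_final _ M))) => // b v V vb.
set N := Aut _ _ _.
have -> c : run N c = run M c by elim: c => //= a l -> r ->.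
by rewrite MP //=; split=> /negP.
Qed.

Lemma regular_and h R R' : regular h R -> regular h R' ->
  regular h.+1 (fun b v V => R b v V /\ R' b v V).
Proof.
move=> [M hM MP] [M' hM' MP'].
exists (@Aut _ (aut_state M * aut_state M')%type (aut_leaf M, aut_leaf M')
   (fun a p q => (aut_step a p.1 q.1, aut_step a p.2 q.2))
   (fun q => aut_final q.1 && aut_final q.2)).
  by rewrite card_prod; apply: leq_trans (tow_mul h); apply: leq_mul.
move=> b v V vb; set N := Aut _ _ _.
have -> c : run N c = (run M c, run M' c) by elim: c => //= a l -> r ->.
by rewrite MP // MP' //=; split=> [[-> ->]|/andP].
Qed.

Lemma regular_or h R R' : regular h R -> regular h R' ->
  regular h.+1 (fun b v V => R b v V \/ R' b v V).
Proof.
move=> /regular_not rR /regular_not rR'.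
apply: regular_ext (regular_not (regular_and rR rR')) => b v V _.
split=> [H|[rb|rb] []//].
by case: (pselect (R b v V)) => nR; [left | right; apply: contrapT => nR'; apply: H].
Qed.

Lemma regular_imp h R R' : regular h R -> regular h R' ->
  regular h.+1 (fun b v V => R b v V -> R' b v V).
Proof.
move=> /regular_not rR rR'; apply: regular_ext (regular_or rR rR') => b v V _.
by split=> [[]//|H]; case: (pselect (R b v V)); [right; auto | left].
Qed.

Lemma regular_iff h R R' : regular h R -> regular h R' ->
  regular h.+2 (fun b v V => R b v V <-> R' b v V).
Proof. by move=> rR rR'; apply: regular_and; apply: regular_imp. Qed.

Lemma regular_const h (P : Prop) : regular h (fun (_ : bt A) (_ : I -> addr) (_ : J -> pred addr) => P).
Proof.
exists (@Aut _ unit tt (fun _ _ _ => tt) (fun=> `[< P >])) => [|b v V _] /=.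
  by rewrite card_unit; apply: leq_trans (tow_ge2 h).
by split=> /asboolP.
Qed.

Lemma regular_all h (T : eqType) (s : seq T) (R : T -> bpred I J) :
    (forall t, t \in s -> regular h (R t)) ->
  regular (h + size s) (fun b v V => forall t, t \in s -> R t b v V).
Proof.
elim: s => [|t s IHs] Rs.
  by apply: regular_ext (regular_const _ True) => b v V _; split.
rewrite /= addnS; have rt := regular_leq (leq_addr (size s) h) (Rs t (mem_head _ _)).
apply: regular_ext (regular_and rt (IHs _)) => [b v V _|u us].
  split=> [[Rt H] u|H]; first by rewrite inE => /predU1P[->|/H].
  by split=> [|u us]; apply: H; rewrite inE ?eqxx ?us ?orbT.
by apply: Rs; rewrite inE us orbT.
Qed.

Definition aut_exists B (P : pred B) : aut B :=
  @Aut _ bool false (fun a p q => P a || p || q) id.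

Lemma run_exists B (P : pred B) (c : bt B) :
  run (aut_exists P) c <-> exists p, has_at P c p.
Proof.
elim: c => [|a l IHl r IHr] /=; first by split=> // -[p []].
split=> [/orP[/orP[Pa|/IHl[p pl]]|/IHr[p pr]]|[p pP]].
- by exists [:: 0]; apply/has_at00.
- by exists (0 :: p); apply/has_at_cons0 => //; apply: has_at_neq0 pl.
- by exists (shift p); apply/has_atS.
have [[_ ->]|[q ql _]|[q qr _]] := has_atP pP => //.
- by apply/orP; left; apply/orP; right; apply/IHl; exists q.
- by apply/orP; right; apply/IHr; exists q.
Qed.

Lemma regular_exists h (P : pred (marked I J)) :
  regular h (fun b v V => exists2 p, p \in bnodes b & exists2 a, blabel b p = Some a
    & P (a, [ffun i => v i == p], [ffun j => V j p])).
Proof.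
exists (aut_exists P); first by rewrite card_bool tow_ge2.
move=> b v V vb; apply: iff_trans (iff_sym (run_exists _ _)).
split=> [[p pb [a pa Pa]]|[p [x]]].
  by exists p, (a, [ffun i => v i == p], [ffun j => V j p]); rewrite // blabel_mapi pa.
rewrite blabel_mapi; case pa: blabel => [a|] // [<-] Pa.
by exists p; [rewrite inE pa | exists a].
Qed.

Lemma regular_label h (P : pred A) (i : I) :
  regular h (fun b v (_ : J -> pred addr) => exists2 a, blabel b (v i) = Some a & P a).
Proof.
apply: regular_ext (regular_exists h (fun x => P x.1.1 && x.1.2 i)) => b v V vb /=.
split=> [[p _ [a pa]]|[a pa Pa]].
  by rewrite ffunE => /andP[Pa /eqP ->]; exists a.
by exists (v i) => //; exists a; rewrite // Pa ffunE eqxx.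
Qed.

Lemma regular_eq h (i j : I) : regular h (fun (_ : bt A) v (_ : J -> pred addr) => v i = v j).
Proof.
apply: regular_ext (regular_exists h (fun x => x.1.2 i && x.1.2 j)) => b v V vb /=.
split=> [[p _ [a pa]]|vij]; first by rewrite !ffunE => /andP[/eqP -> /eqP ->].
have := vb i; rewrite inE; case pa: blabel => [a|] // _.
by exists (v i) => //; exists a; rewrite // !ffunE vij eqxx.
Qed.

Lemma regular_in h (i : I) (j : J) : regular h (fun (_ : bt A) (v : I -> addr) V => V j (v i)).
Proof.
apply: regular_ext (regular_exists h (fun x => x.1.2 i && x.2 j)) => b v V vb /=.
split=> [[p _ [a pa]]|vij]; first by rewrite !ffunE => /andP[/eqP ->].
have := vb i; rewrite inE; case pa: blabel => [a|] // _.
by exists (v i) => //; exists a; rewrite // !ffunE vij eqxx.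
Qed.

End Regular.

(** * Automata for the child and next-sibling relations *)

Section Child.
Variables (A : Type) (P Q : pred A).

(* First component: some root of the forest satisfies [Q]. *)
Definition aut_child : aut A :=
  @Aut _ (bool * bool)%type (false, false)
    (fun a l r => (Q a || r.1, (P a && l.1) || l.2 || r.2)) snd.

(** Here the first component tests the first root of the forest only: in [Nd a l r], the next
    sibling of the node labelled [a] is the first root of [r]. *)
Definition aut_next : aut A :=
  @Aut _ (bool * bool)%type (false, false)
    (fun a l r => (Q a, (P a && r.1) || l.2 || r.2)) snd.

Lemma child_shift p q : p != [::] -> child (shift p) q -> exists2 q', q = shift q' & child p q'.
Proof.
case: p => // i p _; rewrite /child /=; case: q => // -[|j] q //=.
by case: eqP => // -[<-] H; exists (i :: q) => //=; rewrite eqxx.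
Qed.

Lemma shift_child p q : p != [::] -> child p q -> child (shift p) (shift q).
Proof.
by case: p => // i p _; case: q => // j q; rewrite /child /=.
Qed.

Lemma run_child c :
  ((run aut_child c).1 <-> exists i, has_at Q c [:: i]) /\
  ((run aut_child c).2 <-> exists p q, [/\ has_at P c p, has_at Q c q & child p q]).
Proof.
elim: c => [|a l [IHl1 IHl2] r [IHr1 IHr2]] /=.
  by (split; split=> //); [case=> i [] | case=> p [q [[]]]].
split; split.
- move=> /orP[Qa|/IHr1[i ir]]; first by exists 0, a.
  by exists i.+1; apply/(has_atS _ _ _ _ [:: i]).
- move=> [[|i]]; first by case=> x [<-] ->.
  by move=> /(has_atS _ _ _ _ [:: i]) H; apply/orP; right; apply/IHr1; exists i.
- case/orP=> [/orP[/andP[Pa /IHl1[i il]]|/IHl2[p [q [pl ql pq]]]]|/IHr2[p [q [pr qr pq]]]].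
  + by exists [:: 0], [:: 0; i]; split=> //; exists a.
  + exists (0 :: p), (0 :: q); split; last by move: pq; rewrite /child.
      by apply/has_at_cons0 => //; apply: has_at_neq0 pl.
    by apply/has_at_cons0 => //; apply: has_at_neq0 ql.
  + exists (shift p), (shift q); split; try exact/has_atS.
    by apply: shift_child => //; apply: has_at_neq0 pr.
case=> p [q [pP qQ]]; have [[p0 Pa]|[p' p'l p0]|[p' p'r p0]] := has_atP pP; subst p.
- rewrite /child /= => /andP[pre /eqP sq].
  case: q pre sq qQ => // -[|//] [|i []] //= _ _ qQ.
  by rewrite Pa /=; apply/orP; left; apply/orP; left; apply/IHl1; exists i.
- rewrite /child; case: q qQ => // -[|//] q qQ pq.
  have q0 : q != [::] by case: (q) pq => //; rewrite /= andbC; case: (p').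
  apply/orP; left; apply/orP; right; apply/IHl2; exists p', q; split=> //.
  by move/(has_at_cons0 _ _ _ _ q0): qQ.
move=> /(child_shift (has_at_neq0 p'r))[q' def_q pq']; subst q.
by apply/orP; right; apply/IHr2; exists p', q'; split=> //; move/has_atS: qQ.
Qed.

Lemma next_cons0 p q i : p != [::] -> next_sibling (i :: p) q -> exists2 q', q = i :: q' & next_sibling p q'.
Proof.
move=> p0 [[|j r] [k [def_p ->]]]; first by case: def_p p0 => _ ->.
by case: def_p => -> ->; exists (rcons r k.+1) => //; exists r, k.
Qed.

Lemma next_shift p q : p != [::] -> next_sibling (shift p) q -> exists2 q', q = shift q' & next_sibling p q'.
Proof.
case: p => // i p _ [[|j r] [k [def_p ->]]]; case: def_p => e1 e2.
  by rewrite e2 -e1; exists [:: i.+1] => //; exists [::], i.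
by rewrite -e1 e2; exists (i :: rcons r k.+1) => //; exists (i :: r), k.
Qed.

Lemma cons_next p q i : next_sibling p q -> next_sibling (i :: p) (i :: q).
Proof. by case=> r [k [-> ->]]; exists (i :: r), k. Qed.

Lemma shift_next p q : next_sibling p q -> next_sibling (shift p) (shift q).
Proof. by case=> [[|j r]] [k [-> ->]]; [exists [::], k.+1 | exists (j.+1 :: r), k]. Qed.

Lemma run_next c :
  ((run aut_next c).1 <-> has_at Q c [:: 0]) /\
  ((run aut_next c).2 <-> exists p q, [/\ has_at P c p, has_at Q c q & next_sibling p q]).
Proof.
elim: c => [|a l [IHl1 IHl2] r [IHr1 IHr2]] /=.
  by (split; split=> //); [case | case=> p [q [[]]]].
split; split.
- by move=> Qa; exists a.
- by case=> x [<-] ->.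
- case/orP=> [/orP[/andP[Pa /IHr1 r0]|/IHl2[p [q [pl ql pq]]]]|/IHr2[p [q [pr qr pq]]]].
  + exists [:: 0], [:: 1]; split=> //; first by exists a.
    by exists [::], 0.
  + exists (0 :: p), (0 :: q); split; last exact: cons_next.
      by apply/has_at_cons0 => //; apply: has_at_neq0 pl.
    by apply/has_at_cons0 => //; apply: has_at_neq0 ql.
  + by exists (shift p), (shift q); split; [exact/has_atS | exact/has_atS | exact: shift_next].
case=> p [q [pP qQ]]; have [[p0 Pa]|[p' p'l p0]|[p' p'r p0]] := has_atP pP; subst p.
- move=> [[|j t] [k [e def_q]]].
    case: e def_q qQ => <- -> /= qQ.
    by apply/orP; left; apply/orP; left; rewrite Pa; apply/IHr1/(has_atS _ _ _ _ [:: 0]).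
  by case: e => _; case: t {def_q}.
- move=> /(next_cons0 (has_at_neq0 p'l))[q' def_q pq']; subst q.
  have q'0 : q' != [::] by case: pq' => t [k [_ ->]]; case: t.
  apply/orP; left; apply/orP; right; apply/IHl2; exists p', q'; split=> //.
  by move/(has_at_cons0 _ _ _ _ q'0): qQ.
move=> /(next_shift (has_at_neq0 p'r))[q' def_q pq']; subst q.
by apply/orP; right; apply/IHr2; exists p', q'; split=> //; move/has_atS: qQ.
Qed.

End Child.

Lemma has_at_mark A (I J : finType) (P : pred (marked A I J)) b v V p :
  has_at P (mark b v V) p <-> exists2 a, blabel b p = Some a
    & P (a, [ffun i => v i == p], [ffun j => V j p]).
Proof.
rewrite /has_at blabel_mapi; case: blabel => [a|] /=; last by split=> -[].
by split=> [[_ [<-]]|[_ [<-]]] Pa; eexists; eauto.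
Qed.

Lemma has_at_markv A (I J : finType) b v V p (i : I) : (forall i, v i \in bnodes b) ->
  has_at (fun x : marked A I J => x.1.2 i) (mark b v V) p <-> p = v i.
Proof.
move=> vb; apply: iff_trans (has_at_mark _ _ _ _ _) _.
split=> [[a _]|->]; first by rewrite ffunE => /eqP.
have := vb i; rewrite inE; case pa: blabel => [a|] // _.
by exists a; rewrite //= ffunE.
Qed.

Section Atoms.
Variables (A : Type) (I J : finType).

Lemma regular_child h (i j : I) :
  regular h.+1 (fun (_ : bt A) v (_ : J -> pred addr) => child (v i) (v j)).
Proof.
exists (aut_child (fun x : marked A I J => x.1.2 i) (fun x : marked A I J => x.1.2 j)).
  by rewrite card_prod card_bool; apply: leq_trans (tow_mul h); apply: leq_mul; apply: tow_ge2.
move=> b v V vb; apply: iff_trans (iff_sym (run_child _ _ _).2).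
split=> [vij|[p [q [/has_at_markv -> // /has_at_markv -> //]]]].
by exists (v i), (v j); split=> //; apply/has_at_markv.
Qed.

Lemma regular_next h (i j : I) :
  regular h.+1 (fun (_ : bt A) v (_ : J -> pred addr) => next_sibling (v i) (v j)).
Proof.
exists (aut_next (fun x : marked A I J => x.1.2 i) (fun x : marked A I J => x.1.2 j)).
  by rewrite card_prod card_bool; apply: leq_trans (tow_mul h); apply: leq_mul; apply: tow_ge2.
move=> b v V vb; apply: iff_trans (iff_sym (run_next _ _ _).2).
split=> [vij|[p [q [/has_at_markv -> // /has_at_markv -> //]]]].
by exists (v i), (v j); split=> //; apply/has_at_markv.
Qed.

Lemma run_map B C (g : B -> C) (M : aut C) :
  exists2 N : aut B, aut_state N = aut_state M & forall c, aut_final (run N c) = aut_final (run M (bmap g c)).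
Proof.
exists (@Aut _ _ (aut_leaf M) (fun a => aut_step (g a)) (@aut_final _ M)) => // c.
by set N := Aut _ _ _; have -> : run N c = run M (bmap g c) by elim: c => //= a l -> r ->.
Qed.

Lemma regular_sub h (I' J' : finType) (R : bpred A I J) (s : I -> I') (t : J -> J') :
  regular h R -> regular h (fun b v V => R b (fun i => v (s i)) (fun j => V (t j))).
Proof.
move=> [M hM MP].
pose g (x : marked A I' J') : marked A I J := (x.1.1, [ffun i => x.1.2 (s i)], [ffun j => x.2 (t j)]).
have [N hN NP] := run_map g M; exists N; first by rewrite hN.
move=> b v V vb; rewrite MP // NP /bmap /mark bmapi_comp.
have -> // : bmapi (fun p a => (a, [ffun i => v (s i) == p], [ffun j => V (t j) p])) b =
    bmapi (fun p a => g (a, [ffun i => v i == p], [ffun j => V j p])) b.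
apply: bmapi_eq => p _ a; rewrite /g /=; congr (_, _, _); by apply/ffunP => i; rewrite !ffunE.
Qed.

Lemma regular_map B h (g : B -> A) (R : bpred A I J) :
  regular h R -> regular h (fun b v V => R (bmap g b) v V).
Proof.
move=> [M hM MP].
pose f (x : marked B I J) : marked A I J := (g x.1.1, x.1.2, x.2).
have [N hN NP] := run_map f M; exists N; first by rewrite hN.
move=> b v V vb; rewrite MP ?NP /mark /bmap ?bmapi_comp // => i.
by rewrite bnodes_mapi.
Qed.

Definition ext T (x : T) (v : I -> T) (o : option I) : T := if o is Some i then v i else x.

End Atoms.

Lemma card_setT (T : finType) : #|{set T}| = 2 ^ #|T|.
Proof. by rewrite -[LHS]cardsT -powersetT card_powerset cardsT. Qed.

(** * Projection of a marked node and of a marked set *)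

Section Projections.
Variables (B C : Type) (f : bool -> B -> C) (M : aut C).

Definition set1run (c : bt B) (X : pred addr) := run M (bmapi (fun p => f (X p)) c).

(* First component: no node marked; second one: exactly one node marked. *)
Definition aut_exnode : aut B :=
  @Aut _ (aut_state M * {set aut_state M})%type (aut_leaf M, set0)
    (fun a p q => (aut_step (f false a) p.1 q.1,
       aut_step (f true a) p.1 q.1 |:
         ([set aut_step (f false a) p' q.1 | p' in p.2] :|:
          [set aut_step (f false a) p.1 q' | q' in q.2])))
    (fun q => [exists q' in q.2, aut_final q']).

Lemma run_exnode c :
  (run aut_exnode c).1 = set1run c pred0 /\
  forall q, q \in (run aut_exnode c).2 <-> exists2 p, p \in bnodes c & q = set1run c (pred1 p).
Proof.
elim: c => [|a l [IHl1 IHl2] r [IHr1 IHr2]] /=.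
  by split=> // q; rewrite inE; split=> // -[].
rewrite {1}IHl1 {1}IHr1; split=> // q; rewrite !inE IHl1 IHr1.
have e0 : set1run (Nd a l r) (pred1 [:: 0]) = aut_step (f true a) (set1run l pred0) (set1run r pred0).
  rewrite /set1run /=; congr (aut_step _ (run _ _) (run _ _)); apply: bmapi_eq => -[|i p].
  - by rewrite bnodes_nil.
  - by [].
  - by rewrite bnodes_nil.
  - by [].
have e1 p : p \in bnodes l ->
    set1run (Nd a l r) (pred1 (0 :: p)) = aut_step (f false a) (set1run l (pred1 p)) (set1run r pred0).
  move=> pl; rewrite /set1run /=; have p0 : p != [::] by case: (p) pl; rewrite ?bnodes_nil.
  congr (aut_step _ _ (run _ _)).
    by case: (p) p0.
  by apply: bmapi_eq => -[|i p']; rewrite ?bnodes_nil.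
have e2 p : p \in bnodes r ->
    set1run (Nd a l r) (pred1 (shift p)) = aut_step (f false a) (set1run l pred0) (set1run r (pred1 p)).
  move=> pr; rewrite /set1run /=; have p0 : p != [::] by case: (p) pr; rewrite ?bnodes_nil.
  case: p p0 {pr} => // j p _.
  congr (aut_step _ _ (run _ _)).
  by apply: bmapi_eq => -[|i p']; rewrite ?bnodes_nil.
split.
- case/or3P=> [/eqP ->|/imsetP[q' /IHl2[p pl ->] ->]|/imsetP[q' /IHr2[p pr ->] ->]].
  + by exists [:: 0].
  + by exists (0 :: p); rewrite ?e1 // bnodes0 pl orbT.
  + by exists (shift p); rewrite ?e2 // bnodesS.
case=> p pN ->; have [p0|[p' p'l p0]|[p' p'r p0]] := bnodesP pN; subst p.
- by rewrite e0 eqxx.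
- rewrite e1 //; apply/or3P; constructor 2; apply/imsetP; exists (set1run l (pred1 p')) => //.
  by apply/IHl2; exists p'.
- rewrite e2 //; apply/or3P; constructor 3; apply/imsetP; exists (set1run r (pred1 p')) => //.
  by apply/IHr2; exists p'.
Qed.

(** The subset construction for the automaton that guesses the mark of each node. *)
Definition aut_exset : aut B :=
  @Aut _ {set aut_state M} [set aut_leaf M]
    (fun a S T => \bigcup_(x : bool) [set aut_step (f x a) y.1 y.2 | y in setX S T])
    (fun S => [exists q in S, aut_final q]).

Lemma run_exset c q : q \in run aut_exset c <-> exists X, q = set1run c X.
Proof.
elim: c q => [|a l IHl r IHr] q /=.
  by rewrite inE; split=> [/eqP ->|[X ->]] //; exists pred0.
split=> [/bigcupP[x _ /imsetP[[q1 q2]]]|[X ->]].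
  rewrite inE /= => /andP[/IHl[X ->] /IHr[Y ->]] ->.
  (* The marked set is glued from the mark [x] of the first node and the sets found for its two
     subtrees. *)
  exists (fun p => match p with [::] => false | [:: 0] => x | 0 :: p' => X p'
                             | i.+1 :: p' => Y (i :: p') end).
  rewrite /set1run /=; congr (aut_step _ (run _ _) (run _ _)).
    by apply: bmapi_eq => -[|i p] //; rewrite bnodes_nil.
  by apply: bmapi_eq => -[|i p] //; rewrite bnodes_nil.
apply/bigcupP; exists (X [:: 0]) => //; apply/imsetP.
exists (set1run l (fun p => X (0 :: p)), set1run r (fun p => X (shift p))) => //.
by rewrite inE /=; apply/andP; split; [apply/IHl | apply/IHr]; eexists.
Qed.

End Projections.

Section Quantifiers.
Variables (A : Type) (I J : finType).

(** One level of the tower is for the powerset, the second for its product with the run on the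
    unmarked tree. *)
Lemma regular_exnode h (R : bpred A (option I) J) : regular h R ->
  regular h.+2 (fun b v V => exists2 p, p \in bnodes b & R b (ext p v) V).
Proof.
move=> [M hM MP].
pose f (m : bool) (x : marked A I J) : marked A (option I) J :=
  (x.1.1, [ffun o => ext m x.1.2 o], x.2).
exists (aut_exnode f M).
  rewrite card_prod card_setT; apply: leq_trans (tow_mul _); apply: leq_mul.
    exact: leq_trans hM (ltnW (tow_lt _)).
  by rewrite /= leq_exp2l.
move=> b v V vb.
have markE p : set1run f M (mark b v V) (pred1 p) = run M (mark b (ext p v) V).
  rewrite /set1run /mark bmapi_comp; congr run; apply: bmapi_eq => q _ a; rewrite /f /=.
  by congr (_, _, _); apply/ffunP => -[i|]; rewrite !ffunE //= ffunE.
have [_ H] := run_exnode f M (mark b v V).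
have -> : aut_final (run (aut_exnode f M) (mark b v V)) =
  [exists q in (run (aut_exnode f M) (mark b v V)).2, aut_final q] by [].
have vP p : p \in bnodes b -> forall o, ext p v o \in bnodes b by move=> pb [].
split=> [[p pb] /(MP _ _ _ (vP _ pb)) fR|/existsP[q /andP[/H[p]]]].
  apply/existsP; exists (run M (mark b (ext p v) V)).
  by rewrite fR andbT; apply/H; exists p; rewrite ?bnodes_mapi ?markE.
by rewrite bnodes_mapi markE => pb -> fR; exists p => //; apply/(MP _ _ _ (vP _ pb)).
Qed.

Lemma regular_exset h (R : bpred A I (option J)) : regular h R ->
  regular h.+1 (fun b v V => exists X : pred addr, R b v (@ext J (pred addr) X V)).
Proof.
move=> [M hM MP].
pose f (m : bool) (x : marked A I J) : marked A I (option J) :=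
  (x.1, [ffun o => ext m x.2 o]).
exists (aut_exset f M); first by rewrite card_setT /= leq_exp2l.
move=> b v V vb.
have markE X : set1run f M (mark b v V) X = run M (mark b v (@ext J (pred addr) X V)).
  rewrite /set1run /mark bmapi_comp; congr run; apply: bmapi_eq => q _ a; rewrite /f /=.
  by congr (_, _); apply/ffunP => -[i|]; rewrite !ffunE //= ffunE.
have -> : aut_final (run (aut_exset f M) (mark b v V)) =
  [exists q in run (aut_exset f M) (mark b v V), aut_final q] by [].
split=> [[X] /(MP _ _ _ vb) fR|/existsP[q /andP[/run_exset[X ->]]]].
  apply/existsP; exists (run M (mark b v (@ext J (pred addr) X V))).
  by rewrite fR andbT; apply/run_exset; exists X; rewrite markE.
by rewrite markE => fR; exists X; apply/(MP _ _ _ vb).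
Qed.

Lemma regular_allnode h (R : bpred A (option I) J) : regular h R ->
  regular h.+2 (fun b v V => forall p, p \in bnodes b -> R b (ext p v) V).
Proof.
move=> /regular_not/regular_exnode/regular_not; apply: regular_ext => b v V _.
split=> [H p pb|H [p pb []]]; last exact: H.
by apply: contrapT => nR; apply: H; exists p.
Qed.

End Quantifiers.

(** * Zero-sum sequences *)

Section ZeroSum.
Import GRing.Theory Num.Theory Order.TTheory.
Local Open Scope ring_scope.

(** The one-dimensional Steinitz lemma. Since the total is zero, some remaining element has the sign
    opposite to the current sum, or is zero; adding it next keeps the sum between [-M] and [M]. *)
Lemma zero_sum_order (T : eqType) (f : T -> int) (M : nat) (s : seq T) (x : int) :
    (`|x| <= M%:Z) -> {in s, forall e, `|f e| <= M%:Z} -> x + \sum_(e <- s) f e = 0 ->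
  exists2 s', perm_eq s' s & forall k, `|x + \sum_(e <- take k s') f e| <= M%:Z.
Proof.
move: {-1}(size s) (erefl (size s)) => n; elim: n s x => [|n IHn] s x.
  by move=> /size0nil -> xM _ _; exists [::] => // k; rewrite big_nil addr0.
move=> sn xM sM sum0.
have [e es xeM] : exists2 e, e \in s & `|x + f e| <= M%:Z.
  have [x0|x0] := lerP x 0.
    have [e es fe] : exists2 e, e \in s & 0 <= f e.
      apply/hasP; apply: contraT; rewrite -all_predC => /allP neg.
      have : \sum_(e <- s) f e < 0.
        case: s sn sM sum0 neg => // e s _ _ _ neg; rewrite big_cons.
        have fe : f e < 0 by rewrite ltNge; apply: neg; rewrite mem_head.
        suff : \sum_(j <- s) f j <= 0 by move=> H; rewrite -[ltRHS]addr0; apply: ltr_leD.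
        rewrite big_seq; apply: sumr_le0 => j js; rewrite leNgt.
        by have := neg j; rewrite /= inE js orbT -ltNge => /(_ isT) /ltW; rewrite leNgt.
      by lia.
    by exists e => //; have := sM _ es; lia.
  have [e es fe] : exists2 e, e \in s & f e <= 0.
    apply/hasP; apply: contraT; rewrite -all_predC => /allP pos.
    have : 0 <= \sum_(e <- s) f e.
      rewrite big_seq; apply: sumr_ge0 => j js.
      by have := pos j js; rewrite /= -ltNge => /ltW.
    by lia.
  by exists e => //; have := sM _ es; lia.
have ps := perm_to_rem es.
have [||||s' ps' s'P] := IHn (rem e s) (x + f e).
- by rewrite size_rem // sn.
- by [].
- by move=> j /mem_rem; apply: sM.
- by rewrite -addrA -(big_cons 0 +%R e (rem e s) xpredT f) -(perm_big _ ps).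
exists (e :: s'); first by rewrite perm_sym (perm_trans ps) // perm_cons perm_sym.
by case=> [|k] /=; rewrite ?big_nil ?addr0 // big_cons addrA.
Qed.

(** In a balanced order, two of the first [M.*2.+2] prefix sums coincide by the pigeonhole
    principle. The segment between them is a short zero-sum block, and the rest, still of sum zero,
    is treated by induction. *)
Lemma zero_sum_blocks1 (T : eqType) (f : T -> int) (M : nat) (s : seq T) :
    {in s, forall e, `|f e| <= M%:Z} -> \sum_(e <- s) f e = 0 ->
  exists2 bs : seq (seq T), perm_eq (flatten bs) s &
    {in bs, forall c, (size c <= M.*2.+1)%N /\ \sum_(e <- c) f e = 0}.
Proof.
move: {-1}(size s) (leqnn (size s)) => n; elim: n s => [|n IHn] s sn sM sum0.
  exists [::] => //; by case: s sn {sM sum0}.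
have [les|gts] := leqP (size s) M.*2.+1.
  by exists [:: s] => [|c]; rewrite /= ?cats0 // inE => /eqP ->.
have [] := @zero_sum_order T f M s 0 _ sM; rewrite ?add0r //.
move=> t pts tM; pose p k : int := \sum_(e <- take k t) f e.
have pM k : `|p k| <= M%:Z by have := tM k; rewrite add0r.
(* The prefix sums lie between [-M] and [M]; adding [M] turns them into indices below [M.*2.+1]. *)
pose g (k : 'I_M.*2.+2) : 'I_M.*2.+1 := inord (absz (p k + M%:Z)).
have [i [j [ij pij]]] : exists i j : nat, (i < j <= M.*2.+1)%N /\ p i = p j.
  have /injectivePn[i [j ij gij]] : ~~ injectiveb g.
    by apply/negP => /injectiveP/leq_card; rewrite !card_ord ltnn.
  have e : p i = p j.
    move: gij => /(congr1 val) /=; rewrite !inordK; by have := pM i; have := pM j; lia.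
  have [lij|lji|/ord_inj eij] := ltngtP i j; last by rewrite eij eqxx in ij.
    by exists i, j; rewrite lij -ltnS ltn_ord.
  by exists j, i; rewrite lji -ltnS ltn_ord.
have /andP[lij jM] := ij.
have tE : t = take i t ++ take (j - i) (drop i t) ++ drop j t.
  have -> : drop j t = drop (j - i) (drop i t) by rewrite drop_drop subnK // ltnW.
  by rewrite !cat_take_drop.
have st : size t = size s := perm_size pts.
set c := take (j - i) (drop i t) in tE.
have sc : size c = (j - i)%N by rewrite size_takel // size_drop; lia.
have c0 : \sum_(e <- c) f e = 0.
  have : p j = p i + \sum_(e <- c) f e.
    rewrite /p -big_cat /=; congr bigop; rewrite -[in LHS](subnKC (ltnW lij)) takeD //.
  by lia.
have prest : perm_eq (c ++ (take i t ++ drop j t)) s.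
  by rewrite -(permPr pts) [X in perm_eq _ X]tE perm_sym perm_catCA.
have [|||bs pbs bsP] := IHn (take i t ++ drop j t).
- have := perm_size prest; rewrite size_cat sc; lia.
- by move=> e er; apply: sM; rewrite -(perm_mem prest) mem_cat er orbT.
- by move: sum0; rewrite -(perm_big _ prest) big_cat /= c0 add0r.
exists (c :: bs); first by rewrite -(permPr prest) /= perm_cat2l.
move=> d; rewrite inE => /predU1P[->|/bsP //]; split=> //; rewrite sc; lia.
Qed.

(** If the blocks for [d'] weights have length at most [B], then their sums for one more weight are
    at most [B * M] in absolute value, and [(B * M).*2.+1] of them at most are grouped into a new
    block. *)
Fixpoint block_bound (d M : nat) : nat :=
  if d is d'.+1 then (block_bound d' M * (block_bound d' M * M).*2.+1)%N else 1%N.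

(* Grouping the blocks obtained for the first weights according to the last one. *)
Lemma zero_sum_blocks (T : eqType) (w : nat -> T -> int) (d M : nat) (s : seq T) :
    (forall k, (k < d)%N -> {in s, forall e, `|w k e| <= M%:Z}) ->
    (forall k, (k < d)%N -> \sum_(e <- s) w k e = 0) ->
  exists2 bs : seq (seq T), perm_eq (flatten bs) s &
    {in bs, forall c, (size c <= block_bound d M)%N /\
       forall k, (k < d)%N -> \sum_(e <- c) w k e = 0}.
Proof.
elim: d => [|d IHd] wM w0.
  exists [seq [:: e] | e <- s]; first by rewrite flatten_seq1.
  by move=> c /mapP[e _ ->].
have [||bs pbs bsP] := IHd.
- by move=> k kd; apply: wM; apply: ltnW.
- by move=> k kd; apply: w0; apply: ltnW.
pose f c := \sum_(e <- c) w d e.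
have fM : {in bs, forall c, `|f c| <= (block_bound d M * M)%N%:Z}.
  move=> c cb; have [sc _] := bsP c cb.
  have : `|f c| <= (size c * M)%N%:Z.
    have cs : {subset c <= s} by move=> e ec; rewrite -(perm_mem pbs); apply/flattenP; exists c.
    rewrite /f; elim: (c) cs => [|e c' IHc] cs; first by rewrite big_nil normr0.
    rewrite big_cons /= mulSn PoszD.
    apply: le_trans (ler_normD _ _) _; apply: lerD.
      by apply: wM => //; apply: cs; rewrite mem_head.
    by apply: IHc => x xc; apply: cs; rewrite inE xc orbT.
  by move=> H; apply: le_trans H _; rewrite lez_nat leq_mul2r sc orbT.
have [|gs pgs gsP] := zero_sum_blocks1 fM.
  by have := w0 d (ltnSn d); rewrite -(perm_big _ pbs) big_flatten.
exists [seq flatten g | g <- gs].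
  apply: perm_trans pbs.
  have -> : flatten [seq flatten g | g <- gs] = flatten (flatten gs).
    by elim: gs {pgs gsP} => //= g gs IHg; rewrite flatten_cat IHg.
  exact: perm_flatten.
move=> c /mapP[g ggs ->]; have [sg sg0] := gsP g ggs.
have gb : {subset g <= bs}.
  by move=> x xg; rewrite -(perm_mem pgs); apply/flattenP; exists g.
split=> [|k].
  apply: (@leq_trans (block_bound d M * size g)); last by rewrite leq_mul2l sg orbT.
  elim: (g) gb => [|x g' IHg] gb; first by rewrite muln0.
  rewrite /= size_cat mulnS leq_add //.
    by have [] := bsP x (gb _ (mem_head _ _)).
  by apply: IHg => y yg; apply: gb; rewrite inE yg orbT.
rewrite ltnS leq_eqVlt big_flatten /= => /predU1P[->|kd]; first exact: sg0.
by rewrite big_seq big1 // => x /gb /bsP[_ ->].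
Qed.

End ZeroSum.

(** * Pumping *)

Section Pumping.
Import GRing.Theory Num.Theory Order.TTheory.
Variables (A : Type) (M : aut A).
Local Notation Q := (aut_state M).

(* A context is the list of the frames [(a, s, c)] on the path from its root to
   its hole: a node of label [a] whose child other than the one on the path,
   the right one if [s], is [c]. *)
Definition frame := (A * bool * bt A)%type.
Implicit Types (fs : seq frame) (b u : bt A).

Definition fill1 (f : frame) b : bt A :=
  if f.1.2 then Nd f.1.1 b f.2 else Nd f.1.1 f.2 b.
Definition fill fs b := foldr fill1 b fs.

Definition frun1 (f : frame) (q : Q) : Q :=
  if f.1.2 then aut_step f.1.1 q (run M f.2) else aut_step f.1.1 (run M f.2) q.
Definition frun fs (q : Q) := foldr frun1 q fs.

Fixpoint bheight b := if b is Nd _ l r then (maxn (bheight l) (bheight r)).+1 else 0.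

(** A loop at the state [q] can be inserted wherever the run passes through [q], so this set tells
    which loops a tree can absorb. *)
Fixpoint states b : {set Q} :=
  run M b |: (if b is Nd _ l r then states l :|: states r else set0).

Fixpoint bsum (w : A -> int) b : int :=
  if b is Nd a l r then (w a + bsum w l + bsum w r)%R else 0%R.

Definition fsize fs := sumn [seq (bsize f.2).+1 | f <- fs].
Definition fsum (w : A -> int) fs : int := (\sum_(f <- fs) (w f.1.1 + bsum w f.2))%R.

Lemma fill_cat fs gs b : fill (fs ++ gs) b = fill fs (fill gs b).
Proof. exact: foldr_cat. Qed.

Lemma run_fill fs b : run M (fill fs b) = frun fs (run M b).
Proof. by elim: fs => //= -[[a []] c] fs IH /=; rewrite /frun1 /= -IH. Qed.

Lemma bsize_fill fs b : bsize (fill fs b) = fsize fs + bsize b.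
Proof.
elim: fs => // -[[a s] c] fs IH; rewrite /fsize /= -/(fsize fs).
by case: s => /=; rewrite -/(fill fs b) IH; lia.
Qed.

Lemma bsum_fill w fs b : bsum w (fill fs b) = (fsum w fs + bsum w b)%R.
Proof.
elim: fs => [|[[a s] c] fs IH]; first by rewrite /fsum big_nil add0r.
by rewrite /fsum big_cons -/(fsum w fs); case: s => /=; rewrite -/(fill fs b) IH; lia.
Qed.

Lemma run_states b : run M b \in states b.
Proof. by case: b => *; rewrite !inE eqxx. Qed.

Lemma states_fill fs b : states b \subset states (fill fs b).
Proof.
elim: fs => //= -[[a []] c] fs IH; apply: subset_trans IH _; apply/subsetP => q.
  by rewrite /= !inE => ->; rewrite orbT.
by rewrite /= !inE => ->; rewrite !orbT.
Qed.

Lemma fill_states fs b u : run M b = run M u -> states b \subset states u ->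
  states (fill fs b) \subset states (fill fs u).
Proof.
move=> rb sb; elim: fs => //= -[[a s] c] fs IH.
have rE : run M (fill fs b) = run M (fill fs u) by rewrite !run_fill rb.
by case: s => /=; rewrite rE; apply: setUS; [apply: setSU | apply: setUS].
Qed.

Lemma states_sub q b : q \in states b -> exists fs u, b = fill fs u /\ run M u = q.
Proof.
elim: b => [|a l IHl r IHr] /=; first by rewrite !inE orbF => /eqP ->; exists [::], Lf.
rewrite !inE => /or3P[/eqP ->|/IHl[fs [u [-> <-]]]|/IHr[fs [u [-> <-]]]].
- by exists [::], (Nd a l r).
- by exists ((a, true, r) :: fs), u.
- by exists ((a, false, l) :: fs), u.
Qed.

Lemma spine b : exists2 fs, b = fill fs Lf & size fs = bheight b.
Proof.
elim: b => [|a l [fs -> hl] r [gs -> hr]]; first by exists [::].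
rewrite /=; case: leqP => _.
  by exists ((a, false, fill fs Lf) :: gs); rewrite //= -hr.
by exists ((a, true, fill gs Lf) :: fs); rewrite //= -hl.
Qed.

Lemma subtree_height n b : n <= bheight b -> exists fs u, b = fill fs u /\ bheight u = n.
Proof.
elim: b => [|a l IHl r IHr] /=; first by rewrite leqn0 => /eqP ->; exists [::], Lf.
rewrite leq_eqVlt => /predU1P[->|]; first by exists [::], (Nd a l r).
rewrite ltnS leq_max => /orP[/IHl[fs [u [-> <-]]]|/IHr[fs [u [-> <-]]]].
  by exists ((a, true, r) :: fs), u.
by exists ((a, false, l) :: fs), u.
Qed.

Lemma bsize_height b : bsize b < 2 ^ bheight b.
Proof.
elim: b => //= a l IHl r IHr; rewrite expnS.
have := leq_pexp2l (isT : 0 < 2) (leq_maxl (bheight l) (bheight r)).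
have := leq_pexp2l (isT : 0 < 2) (leq_maxr (bheight l) (bheight r)).
lia.
Qed.

(** The number of pairs of a state and a set of visited states, for the pigeonhole argument on a
    path. *)
Definition pump_height := #|Q| * 2 ^ #|Q|.

(** On a longest path of a subtree of height exactly [pump_height], two subtrees agree in their
    state and in their visited states. Agreement in the latter means that cutting the loop between
    them loses no state; the exact height of the subtree bounds the size of the loop. *)
Lemma find_pump b : pump_height <= bheight b -> exists fs gs u,
  [/\ b = fill fs (fill gs u), 0 < size gs, frun gs (run M u) = run M u,
      states (fill gs u) = states u & bsize (fill gs u) <= 2 ^ pump_height].
Proof.
move=> /subtree_height[fs0 [t [-> ht]]].
have [fs tE sfs] := spine t; rewrite ht in sfs.
pose g (k : 'I_pump_height.+1) : Q * {set Q} :=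
  let u := fill (drop k fs) Lf in (run M u, states u).
have [i [j [/andP[ij jN] [gr gs]]]] : exists i j : nat, i < j <= pump_height /\
    run M (fill (drop i fs) Lf) = run M (fill (drop j fs) Lf) /\
    states (fill (drop i fs) Lf) = states (fill (drop j fs) Lf).
  have /injectivePn[i [j ij gij]] : ~~ injectiveb g.
    apply/negP => /injectiveP/leq_card; rewrite card_prod card_ord.
    by rewrite -[#|{set _}|]cardsT -powersetT card_powerset cardsT ltnn.
  case: gij => gr gs; have [lij|lji|/ord_inj eij] := ltngtP i j; last by rewrite eij eqxx in ij.
    by exists i, j; rewrite lij -ltnS ltn_ord.
  by exists j, i; rewrite lji -ltnS ltn_ord.
have dE : drop i fs = take (j - i) (drop i fs) ++ drop j fs.
  have -> : drop j fs = drop (j - i) (drop i fs) by rewrite drop_drop subnK // ltnW.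
  by rewrite cat_take_drop.
exists (fs0 ++ take i fs), (take (j - i) (drop i fs)), (fill (drop j fs) Lf).
have e1 : fill (take (j - i) (drop i fs)) (fill (drop j fs) Lf) = fill (drop i fs) Lf.
  by rewrite -fill_cat -dE.
have e2 : fill (take i fs) (fill (drop i fs) Lf) = t by rewrite -fill_cat cat_take_drop -tE.
rewrite e1 fill_cat e2; split=> //; first by rewrite size_takel ?size_drop; lia.
  by rewrite -run_fill e1.
have : bsize (fill (drop i fs) Lf) <= bsize t.
  by rewrite -e2 [X in _ <= X]bsize_fill leq_addl.
by move=> H; apply: leq_trans H _; rewrite -ht ltnW // bsize_height.
Qed.

Definition pump (S : {set Q}) gs :=
  fsize gs <= 2 ^ pump_height /\ exists2 q, q \in S & frun gs q = q.

(** Loops are cut out until the tree is low. Since each cut preserves the set of visited states,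
    every loop can still be inserted into the final core. Membership of loops is [List.In], as the
    labels need not have decidable equality. *)
Lemma decompose b : exists b0 (ps : seq (seq frame)),
  [/\ bsize b0 <= 2 ^ pump_height, run M b0 = run M b,
      forall gs, List.In gs ps -> pump (states b0) gs
    & forall w, bsum w b = (bsum w b0 + \sum_(gs <- ps) fsum w gs)%R].
Proof.
suff [b0 [ps [h0 r0 sb0 psP wE]]] : exists b0 (ps : seq (seq frame)),
  [/\ bsize b0 <= 2 ^ pump_height, run M b0 = run M b, states b0 = states b,
      forall gs, List.In gs ps -> pump (states b) gs
    & forall w, bsum w b = (bsum w b0 + \sum_(gs <- ps) fsum w gs)%R].
  by exists b0, ps; split; rewrite ?sb0.
have [n] := ubnP (bsize b); elim: n b => // n IHn b; rewrite ltnS => bn.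
have [/find_pump[fs [gs [u [def_b gs0 rgs sgs zgs]]]]|hb] := leqP pump_height (bheight b); last first.
  exists b, [::]; split=> // [|w]; last by rewrite big_nil addr0.
  apply: leq_trans (ltnW (bsize_height _)) _; rewrite leq_exp2l //; exact: ltnW.
have fgs : 0 < fsize gs by case: (gs) gs0.
have [|b0 [ps [h0 r0 sb0 psP wE]]] := IHn (fill fs u).
  by move: bn; rewrite def_b !bsize_fill; lia.
have rE : run M (fill gs u) = run M u by rewrite run_fill.
have sE : states (fill fs u) = states b.
  by rewrite def_b; apply/eqP; rewrite eqEsubset !fill_states ?sgs.
exists b0, (gs :: ps); split=> //.
- by rewrite r0 def_b !run_fill rgs.
- by rewrite sb0.
- move=> g [<-|/psP]; last by rewrite sE.
  split; first by move: zgs; rewrite bsize_fill; lia.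
  exists (run M u) => //; rewrite -sE; apply: (subsetP (states_fill fs u)).
  exact: run_states.
- move=> w; rewrite def_b big_cons !bsum_fill; have := wE w; rewrite bsum_fill => e; rewrite addrCA e addrCA; reflexivity.
Qed.

(** Inserting a loop only adds visited states, so the remaining loops keep a place. *)
Lemma insert b (ps : seq (seq frame)) : (forall gs, List.In gs ps -> pump (states b) gs) ->
  exists b', [/\ run M b' = run M b, bsize b' <= bsize b + size ps * 2 ^ pump_height
    & forall w, bsum w b' = (bsum w b + \sum_(gs <- ps) fsum w gs)%R].
Proof.
elim: ps b => [|gs ps IHps] b psP.
  by exists b; split=> // [|w]; rewrite ?addn0 // big_nil addr0.
have [zgs [q qb rgs]] := psP gs (or_introl erefl).
have [fs [u [def_b ru]]] := states_sub qb.
have rE : run M (fill gs u) = run M u by rewrite run_fill ru.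
have [|b' [rb' zb' wb']] := IHps (fill fs (fill gs u)).
  move=> g /(@or_intror (gs = g)) /psP[zg [p pb rg]]; split=> //; exists p => //.
  apply: (subsetP _ p pb); rewrite def_b; apply: fill_states => //.
  exact: states_fill.
exists b'; split.
- by rewrite rb' def_b !run_fill ru rgs.
- by move: zb'; rewrite def_b !bsize_fill /= mulSn; lia.
- by move=> w; rewrite wb' def_b !bsum_fill big_cons -!addrA; congr (_ + _)%R; rewrite addrCA; reflexivity.
Qed.

Lemma bsum_bound w b : (forall a, `|w a| <= 1)%R -> (`|bsum w b| <= (bsize b)%:Z)%R.
Proof.
move=> w1; elim: b => [|a l IHl r IHr] //=; have := w1 a; lia.
Qed.

Lemma fsum_bound w gs : (forall a, `|w a| <= 1)%R -> (`|fsum w gs| <= (fsize gs)%:Z)%R.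
Proof.
move=> w1; elim: gs => [|f gs IH]; first by rewrite /fsum big_nil.
rewrite /fsum big_cons -/(fsum w gs) /fsize /= -/(fsize gs).
have := w1 f.1.1; have := bsum_bound f.2 w1; lia.
Qed.

End Pumping.

(** The core and each loop have at most [2 ^ (n * 2 ^ n)] nodes, which also bounds their weights, as
    a letter weighs at most 1. At most [block_bound] loops are put back into the core. *)
Definition pump_bound (n d : nat) : nat :=
  (block_bound d (2 ^ (n * 2 ^ n))).+1 * 2 ^ (n * 2 ^ n).

Lemma leq_block_bound d d' m m' : d <= d' -> m <= m' -> block_bound d m <= block_bound d' m'.
Proof.
move=> /subnK <- mm'; apply: (@leq_trans (block_bound d m')).
  elim: d => //= d IHd; apply: leq_mul => //.
  by rewrite ltnS leq_double leq_mul.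
elim: (d' - d) => //= k IHk; apply: leq_trans IHk _.
by apply: leq_pmulr.
Qed.

Lemma leq_pump_bound n n' d d' : n <= n' -> d <= d' -> pump_bound n d <= pump_bound n' d'.
Proof.
move=> nn dd; have H : 2 ^ (n * 2 ^ n) <= 2 ^ (n' * 2 ^ n').
  by rewrite leq_exp2l // leq_mul // leq_exp2l.
by apply: leq_mul => //; rewrite ltnS leq_block_bound.
Qed.

(** The weights of the core and of all the loops form a zero-sum sequence of bounded vectors, which
    is split into short zero-sum blocks. Only the loops in the block of the core are kept; the
    weights then still vanish, and the state at the root is unchanged. *)
Theorem pumping A (M : aut A) (d : nat) (w : nat -> A -> int) (b : bt A) :
    (forall k a, `|w k a| <= 1)%R -> (forall k, k < d -> bsum (w k) b = 0%R) ->
  exists b', [/\ run M b' = run M b, forall k, k < d -> bsum (w k) b' = 0%R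
    & bsize b' <= pump_bound #|aut_state M| d].
Proof.
move=> w1 w0; have [b0 [ps [h0 r0 psP wE]]] := decompose M b.
(* Index [0] stands for the core and [i.+1] for loop number [i]. The blocks consist of these
   numbers, because the loops themselves have no decidable equality. *)
pose v k e : int := if e is i.+1 then fsum (w k) (nth [::] ps i) else bsum (w k) b0.
have pumpP i : i < size ps -> pump (states M b0) (nth [::] ps i).
  move=> ip; apply: psP; elim: (ps) i ip => //= g s IH [|i] ip; first by left.
  by right; apply: IH.
have sumE k : (\sum_(e <- iota 0 (size ps).+1) v k e = bsum (w k) b)%R.
  rewrite wE /= big_cons /=; congr (_ + _)%R.
  rewrite -[1]/(1 + 0) iotaDl big_map [RHS](big_nth [::]) /index_iota subn0.
  exact: eq_bigr.
have [||bs pbs bsP] := @zero_sum_blocks _ v d (2 ^ pump_height M) (iota 0 (size ps).+1).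
- move=> k _ [|i]; rewrite mem_iota /= => ip.
    by have := bsum_bound b0 (w1 k); move: h0; lia.
  have [zi _] := pumpP i ip.
  by have := fsum_bound (nth [::] ps i) (w1 k); move: zi; lia.
- by move=> k kd; rewrite sumE w0.
(* The block that contains the core. *)
have /flattenP[c cbs c0] : 0 \in flatten bs by rewrite (perm_mem pbs) mem_iota.
have [zc sc] := bsP c cbs.
have uc : uniq c.
  have : uniq (flatten bs) by rewrite (perm_uniq pbs) iota_uniq.
  case/splitPr: cbs => s1 s2; rewrite flatten_cat cat_uniq /= cat_uniq.
  by case/and3P=> _ _ /andP[].
have c'P e : e \in rem 0 c -> exists2 i, e = i.+1 & i < size ps.
  rewrite mem_rem_uniq // !inE => /andP[]; case: e => // i _ ic; exists i => //.
  have : i.+1 \in flatten bs by apply/flattenP; exists c.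
  by rewrite (perm_mem pbs) mem_iota.
have [|b' [rb' zb' wb']] := @insert _ M b0 [seq nth [::] ps e.-1 | e <- rem 0 c].
  move=> g; elim: (rem 0 c) c'P => //= e s IH c'P [<-|]; last first.
    by apply: IH => x xs; apply: c'P; rewrite inE xs orbT.
  by have [i -> ip] := c'P e (mem_head _ _); apply: pumpP.
exists b'; split.
- by rewrite rb'.
- move=> k kd; rewrite wb' big_map -[RHS](sc k kd) (perm_big _ (perm_to_rem c0)) big_cons /=.
  congr (_ + _)%R; rewrite big_seq [RHS]big_seq; apply: eq_bigr => e /c'P[i -> _].
  by [].
- apply: leq_trans zb' _; rewrite size_map size_rem // /pump_bound -/(pump_height M).
  have : size c <= block_bound d (2 ^ pump_height M) by [].
  move: (2 ^ pump_height M) h0 => N; move: (block_bound d N) => B h0 cB.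
  apply: (@leq_trans (N + B * N)); last by rewrite mulSn.
  by apply: leq_add => //; rewrite leq_mul2r (leq_trans (leq_pred _)) ?orbT.
Qed.

(** * Trees as binary trees *)

Lemma forest_ind A (P : seq (tree A) -> Prop) :
  P [::] -> (forall a ts us, P ts -> P us -> P (Node a ts :: us)) -> forall ts, P ts.
Proof.
move=> P0 PS.
have PT : forall t us, P us -> P (t :: us).
  fix PT 1 => -[a ts] us Pus; apply: PS => //.
  by elim: ts => // t ts IHts; apply: PT.
by elim=> // t ts; apply: PT.
Qed.

Fixpoint toF A (b : bt A) : seq (tree A) :=
  if b is Nd a l r then Node a (toF l) :: toF r else [::].

Lemma toF_surj A (ts : seq (tree A)) : exists b, toF b = ts.
Proof.
elim/forest_ind: ts => [|a _ _ [l <-] [r <-]]; first by exists Lf.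
by exists (Nd a l r).
Qed.

Lemma blabel_toF A (b : bt A) i p : blabel b (i :: p) = obind (fun t => label t p) (onth (toF b) i).
Proof.
elim: b i p => [|a l IHl r IHr] [|i] p //=; last by rewrite -IHr.
by case: p => //= j p; rewrite /blabel -/(blabel l _) IHl /label /=; case: (onth _ j).
Qed.

Lemma label_root A (a : A) l p : label (Node a (toF l)) p = blabel (Nd a l Lf) (0 :: p).
Proof. by rewrite blabel_toF. Qed.

Lemma nodes_root A (a : A) l p : (p \in nodes (Node a (toF l))) = (0 :: p \in bnodes (Nd a l Lf)).
Proof. by rewrite [in RHS]inE -label_root inE /label; case: subtree. Qed.

Lemma bnodes_root A (a : A) l q : q \in bnodes (Nd a l Lf) -> exists p, q = 0 :: p.
Proof. by case: q => [|[|i] p] //; rewrite ?bnodes_nil //; exists p. Qed.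

(** * Regularity of MSO formulas *)

Lemma sumn_size_code (s : seq nat) : sumn s + size s <= CodeSeq.code s.
Proof.
elim: s => // x s IHs; rewrite code_cons /ccons /=.
by have : x < 2 ^ x by [apply: ltn_expl]; nia.
Qed.

Lemma sumn_code (s : seq nat) : sumn s <= CodeSeq.code s.
Proof. exact: leq_trans (leq_addr _ _) (sumn_size_code s). Qed.

Section Mso.
Variables (n : nat) (G A : Type) (letter : A -> 'I_n) (bq : G -> A -> bool).

Definition vcons T m (x : T) (v : 'I_m -> T) (i : 'I_m.+1) : T := ext x v (unlift ord0 i).

(** The query predicates are read off the labels, which makes the formula plain MSO. That the labels
    tell the truth about the queries is a separate condition. *)
Fixpoint bsat m k (f : mso n G m k) (b : bt A) (v : 'I_m -> addr) (V : 'I_k -> pred addr) : Prop :=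
  match f with
  | MLabel a x => has_at (fun l => letter l == a) b (v x)
  | MEq x y => v x = v y
  | MChild x y => child (v x) (v y)
  | MNext x y => next_sibling (v x) (v y)
  | MIn x Z => V Z (v x)
  | MQuery u x => has_at (bq u) b (v x)
  | MNot f => ~ bsat f b v V
  | MAnd f g => bsat f b v V /\ bsat g b v V
  | MExNode f => exists2 p, p \in bnodes b & bsat f b (vcons p v) V
  | MExSet f => exists2 X : pred addr, {subset X <= bnodes b} & bsat f b v (vcons X V)
  end.

Fixpoint mso_height m k (f : mso n G m k) : nat :=
  match f with
  | MNot f => mso_height f
  | MAnd f g => (maxn (mso_height f) (mso_height g)).+1
  | MExNode f => (mso_height f).+2
  | MExSet f => (mso_height f).+1
  | _ => 1
  end.

(** The height of the automaton is thus bounded by the code of the formula, the only quantity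
    available to the program. *)
Lemma mso_height_code (c : G -> nat) m k (f : mso n G m k) : mso_height f <= code_mso c f.
Proof.
have le2 i x y : x <= y -> x + i <= CodeSeq.code [:: i; y].
  by move=> xy; apply: leq_trans (sumn_code _); rewrite /= addn0 addnC leq_add2l.
have code_gt0 x s : 0 < CodeSeq.code (x :: s) by rewrite code_cons cons_gt0.
elim: f => {m k} m k.
1-6: by move=> *; apply: code_gt0.
- by move=> f IHf; apply: leq_trans (le2 6 _ _ IHf); rewrite leq_addr.
- move=> f IHf g IHg; apply: leq_trans (sumn_code [:: 7; code_mso c f; code_mso c g]).
  change (maxn (mso_height f) (mso_height g) < 7 + (code_mso c f + (code_mso c g + 0))).
  lia.
- by move=> f IHf; apply: leq_trans (le2 8 _ _ IHf); change ((mso_height f).+2 <= mso_height f + 8); lia.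
- by move=> f IHf; apply: leq_trans (le2 9 _ _ IHf); change ((mso_height f).+1 <= mso_height f + 9); lia.
Qed.

(** An automaton sees a set only through the marks on nodes, so restricting the set to the nodes
    changes nothing. *)
Lemma regular_exsubset h (I J : finType) (R : bpred A I (option J)) : regular h R ->
  regular h.+1 (fun b v V => exists2 X : pred addr, {subset X <= bnodes b} & R b v (@ext J (pred addr) X V)).
Proof.
move=> rR; apply: regular_ext (regular_exset rR) => b v V vb.
split=> [[X RX]|[X _ RX]]; last by exists X.
exists [pred p in bnodes b | X p] => [p /andP[] //|].
have [M _ MP] := rR; apply/MP => //; move/MP: RX => /(_ vb).
suff -> : mark b v (@ext J (pred addr) X V) = mark b v (@ext J (pred addr) [pred p in bnodes b | X p] V) by [].
apply: bmapi_eq => p pb a; congr (_, _).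
by apply/ffunP => -[j|]; rewrite !ffunE //= pb.
Qed.

Lemma regular_mso m k (f : mso n G m k) : regular (mso_height f) (bsat f).
Proof.
elim: f => {m k} m k /=.
- by move=> a x; apply: (regular_label _ _ (fun l => letter l == a)).
- by move=> x y; apply: regular_eq.
- by move=> x y; apply: regular_child.
- by move=> x y; apply: regular_next.
- by move=> x Z; apply: regular_in.
- by move=> u x; apply: (regular_label _ _ (bq u)).
- by move=> f; apply: regular_not.
- move=> f rf g rg; apply: regular_and.
    by apply: regular_leq rf; apply: leq_maxl.
  by apply: regular_leq rg; apply: leq_maxr.
- move=> f /(@regular_sub _ _ _ _ (option 'I_m) 'I_k _ (unlift ord0) id).
  by move=> /regular_exnode; apply: regular_ext.
- move=> f /(@regular_sub _ _ _ _ 'I_m (option 'I_k) _ id (unlift ord0)).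
  by move=> /regular_exsubset; apply: regular_ext.
Qed.

Variables (a : A) (l : bt A).
Let b := Nd a l Lf.

Definition lift_set (X : pred addr) : pred addr :=
  fun q => if q is 0 :: p then X p else false.

Lemma vcons_lift T T' (g : T -> T') m (x : T) (v : m.-tuple T) :
  (fun i => g (tnth [tuple of x :: v] i)) = vcons (g x) (fun i => g (tnth v i)).
Proof.
apply/funext => i; rewrite /vcons; case: (unliftP ord0 i) => [j ->|->] /=.
  by rewrite tnthS.
by rewrite tnth0.
Qed.

(** Labels are assumed correct only for queries of code below [N], which are all that can occur in a
    formula of code at most [N]. This is what an induction on the codes of nested queries
    provides. *)
Lemma bsat_mso (D : data_tree 'I_n) (interp : G -> addr -> Prop) (c : G -> nat) (N : nat) :
    dtree D = Node (letter a) (toF (bmap letter l)) ->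
    (forall u p, c u < N -> p \in nodes D -> interp u p <-> has_at (bq u) b (0 :: p)) ->
  forall m k (f : mso n G m k) v V, code_mso c f <= N -> (forall i, tnth v i \in nodes D) ->
    mso_sat D interp f v V <->
    bsat f b (fun i => 0 :: tnth v i) (fun j => lift_set (tnth V j)).
Proof.
move=> Dt interpP.
have Db p : (p \in nodes D) = (0 :: p \in bnodes b).
  by rewrite Dt nodes_root -(bnodes_mapi (fun _ => letter) b).
move=> m k; elim=> {m k} m k.
- move=> d x v V _ vD /=; have := vD x; rewrite Db inE.
  rewrite Dt label_root -[Nd (letter a) _ _]/(bmap letter b) blabel_mapi /has_at.
  case: blabel => //= e _; by split=> [[<-]|[e' [<-] /eqP -> //]]; exists e.
- by move=> x y v V _ _ /=; split=> [->|[]].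
- by move=> x y v V _ _.
- move=> x y v V _ _ /=; split=> [/cons_next //|[[|j r] [i [e1 e2]]]].
    by case: e1 e2 => <- _ [].
  by case: e1 e2 => _ e1 [_ e2]; exists r, i.
- by [].
- move=> u x v V le vD; apply: interpP => //.
  by apply: lt_code le; rewrite !inE eqxx orbT.
- move=> f IHf v V le vD /=; have {}IHf := IHf v V; rewrite IHf //.
  by apply: ltnW; apply: lt_code le; rewrite !inE eqxx orbT.
- move=> f IHf g IHg v V le vD /=; rewrite IHf ?IHg //.
    by apply: ltnW; apply: lt_code le; rewrite !inE eqxx !orbT.
  by apply: ltnW; apply: lt_code le; rewrite !inE eqxx !orbT.
- move=> f IHf v V le vD /=.
  have lef : code_mso c f <= N by apply: ltnW; apply: lt_code le; rewrite !inE eqxx orbT.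
  have vD' p : p \in nodes D -> forall i, tnth [tuple of p :: v] i \in nodes D.
    by move=> pD i; case: (unliftP ord0 i) => [j ->|->]; rewrite ?tnthS ?tnth0.
  split=> [[p pD /(IHf _ _ lef (vD' _ pD))]|[q qb]].
    by rewrite (vcons_lift (fun p => 0 :: p)) => sf; exists (0 :: p); rewrite -?Db.
  have [p def_q] := bnodes_root qb; subst q; rewrite -(vcons_lift (fun p => 0 :: p)) => sf.
  by exists p; rewrite ?Db //; apply/(IHf _ _ lef (vD' _ _)); rewrite ?Db.
- move=> f IHf v V le vD /=.
  have lef : code_mso c f <= N by apply: ltnW; apply: lt_code le; rewrite !inE eqxx orbT.
  split=> [[X XD /(IHf _ _ lef vD)]|[X Xb]].
    rewrite (vcons_lift lift_set) => sf; exists (lift_set X) => // -[|[|i] p] // Xp.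
    by rewrite -Db; apply: XD.
  have -> : X = lift_set (fun p => X (0 :: p)).
    apply/funext => q; case Xq: (X q); last by case: q Xq => [|[]].
    by have [p def_q] := bnodes_root (Xb _ Xq); subst q.
  rewrite -(vcons_lift lift_set) => /(IHf _ _ lef vD) sf.
  by exists (fun p => X (0 :: p)) => // p Xp; rewrite Db; apply: Xb.
Qed.

End Mso.

(** * Regularity of tree automata *)

Section TreeAutomata.
Variables (B : eqType) (M : tree_automaton B).
Local Notation Q := 'I_(ta_size M).

Lemma ta_reach_Node a ts q : ta_reach M (Node a ts) q =
  has (fun r : B * nfa Q * Q => [&& r.1.1 == a, r.2 == q
           & [exists w : (size ts).-tuple Q,
                nfa_accepts r.1.2 w && all2 (ta_reach M) ts w]]) (ta_rules M).
Proof. by []. Qed.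

Definition forest_accepts (N : nfa Q) (p : 'I_(nfa_size N)) (ts : seq (tree B)) : bool :=
  [exists w : (size ts).-tuple Q, nfa_accepts_from p w && all2 (ta_reach M) ts w].

Lemma forest_accepts_nil N (p : 'I_(nfa_size N)) :
  forest_accepts p [::] = (p \in nfa_final N).
Proof.
apply/existsP/idP => [[w]|pf]; first by rewrite tuple0 /= andbT.
by exists [tuple]; rewrite /= andbT.
Qed.

Lemma forest_accepts_cons N (p : 'I_(nfa_size N)) t ts :
  forest_accepts p (t :: ts) = [exists q, ta_reach M t q &&
    [exists p', ((p, q, p') \in nfa_trans N) && forest_accepts p' ts]].
Proof.
apply/existsP/existsP => [[w]|[q /andP[tq /existsP[p' /andP[tr /existsP[w /andP[wf wr]]]]]]].
  case/tupleP: w => q w /= /andP[/existsP[p' /andP[tr wf]] /andP[tq wr]].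
  exists q; rewrite tq /=; apply/existsP; exists p'; rewrite tr /=.
  by apply/existsP; exists w; rewrite wf.
exists [tuple of q :: w]; apply/andP; split; last by rewrite /= tq wr.
by apply/existsP; exists p'; rewrite tr.
Qed.

Lemma ta_reach_forest a ts q : ta_reach M (Node a ts) q =
  has (fun r : B * nfa Q * Q => [&& r.1.1 == a, r.2 == q
           & has (fun p => forest_accepts p ts) (nfa_init r.1.2)]) (ta_rules M).
Proof.
rewrite ta_reach_Node; apply: eq_has => r; congr [&& _, _ & _].
apply/existsP/hasP => [[w /andP[/hasP[p pi pw] wr]]|[p pi /existsP[w /andP[pw wr]]]].
  by exists p => //; apply/existsP; exists w; rewrite pw.
by exists w; rewrite wr andbT; apply/hasP; exists p.
Qed.

Local Notation rule r := (tnth (in_tuple (ta_rules M)) r).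
Local Notation S := {r : 'I_(size (ta_rules M)) & 'I_(nfa_size (rule r).1.2)}.

(** The leaf is the empty forest at the right end of a list of siblings, so the horizontal automata
    are run backwards: the first component collects the rules and horizontal states from which the
    word of the forest is accepted. The second one, the possible states at the first root, is read
    only at acceptance. *)
Definition aut_ta : aut B :=
  @Aut _ ({set S} * {set Q})%type
    ([set x : S | tagged x \in nfa_final (rule (tag x)).1.2], set0)
    (fun a l r =>
       let Z := [set q | [exists i, [&& (rule i).1.1 == a, (rule i).2 == q
                  & [exists p, (p \in nfa_init (rule i).1.2) && (Tagged (fun r => 'I_(nfa_size (rule r).1.2)) p \in l.1)]]]] in
       ([set x : S | [exists q in Z, exists p', ((tagged x, q, p') \in nfa_trans (rule (tag x)).1.2)
             && (Tagged (fun r => 'I_(nfa_size (rule r).1.2)) p' \in r.1)]], Z))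
    (fun x => has (fun q => q \in x.2) (ta_final M)).

Lemma run_ta b : run aut_ta b =
  ([set x : S | forest_accepts (tagged x) (toF b)],
   if b is Nd a l _ then [set q | ta_reach M (Node a (toF l)) q] else set0).
Proof.
elim: b => [|a l IHl r IHr] /=.
  by congr pair; apply/setP => x; rewrite !inE forest_accepts_nil.
rewrite IHl IHr /=; set Z := (Z in (_, Z) = _).
have ZE : Z = [set q | ta_reach M (Node a (toF l)) q].
  apply/setP => q; rewrite !inE ta_reach_forest.
  rewrite -[X in has _ X]/(tval (in_tuple (ta_rules M))).
  apply/existsP/has_tnthP => -[i /and3P[ra rq]].
    move=> /existsP[p /andP[pi]]; rewrite inE => pl; exists i.
    by rewrite ra rq; apply/hasP; exists p.
  move=> /hasP[p pi pl]; exists i; rewrite ra rq; apply/existsP; exists p.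
  by rewrite pi inE.
congr pair => //; apply/setP => x; rewrite !inE forest_accepts_cons.
apply: eq_existsb => q; rewrite inE; congr (_ && _).
  by have /setP/(_ q) := ZE; rewrite !inE.
by apply: eq_existsb => p'; rewrite inE.
Qed.

(** [aut_ta] has 2 to the power of the predecessor of this number many states. *)
Definition ta_height := (\sum_(r : 'I_(size (ta_rules M))) nfa_size (rule r).1.2 + ta_size M).+1.

Definition bta (b : bt B) : bool := if b is Nd a l _ then ta_accepts M (Node a (toF l)) else false.

Lemma leq_exp2_tow k : 2 ^ k <= tow k.+1.
Proof.
rewrite /= leq_exp2l //; elim: k => // k IHk; apply: leq_ltn_trans IHk (tow_lt k).
Qed.

Lemma regular_ta A (I J : finType) (g : A -> B) :
  regular ta_height (fun b (_ : I -> addr) (_ : J -> pred addr) => bta (bmap g b)).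
Proof.
apply: (@regular_map B I J A _ g (fun b _ _ => bta b)).
have [N hN NP] := run_map (fun x : marked B I J => x.1.1) aut_ta.
exists N => [|b v V _].
  rewrite hN card_prod !card_setT card_ord card_tagged -expnD /ta_height.
  set s := sumn _; set s' := \sum_ _ _.
  have -> : s = s'.
    rewrite /s /s' sumnE big_map enumT; apply: eq_bigr => i _; exact: card_ord.
  exact: leq_exp2_tow.
rewrite NP /bmap /mark bmapi_comp.
have -> : bmapi (fun _ a => a) b = b by elim: (b) => //= a l -> r ->.
rewrite run_ta /bta /ta_accepts; case: b => [|a l r] /=.
  by split=> // /hasP[q _]; rewrite inE.
by split=> /hasP[q qf]; [move=> tq | rewrite inE => tq]; apply/hasP; exists q; rewrite ?inE.
Qed.

Lemma ta_height_code (c : B -> nat) : ta_height <= code_ta c M.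
Proof.
have := sumn_size_code [:: ta_size M;
        code_seq (code_pair (code_pair c (code_nfa (@code_ord _))) (@code_ord _))
          (ta_rules M);
        code_seq (@code_ord _) (ta_final M)].
rewrite -/(code_ta c M) /= /ta_height.
have : \sum_(r : 'I_(size (ta_rules M))) nfa_size (rule r).1.2 <=
    code_seq (code_pair (code_pair c (code_nfa (@code_ord _))) (@code_ord _)) (ta_rules M).
  apply: leq_trans (sumn_code _); rewrite sumnE big_map (big_tnth _ _ (ta_rules M)) /=.
  apply: leq_sum => r _; set rr := rule r.
  have le_code x t y : x \in t -> y <= x -> y <= CodeSeq.code t.
    by move=> xt yx; apply: leq_trans yx (ltnW (lt_code xt (leqnn _))).
  apply: (le_code (code_pair c (code_nfa (@code_ord _)) rr.1)); first by rewrite inE eqxx.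
  apply: (le_code (code_nfa (@code_ord _) rr.1.2)); first by rewrite !inE eqxx orbT.
  by apply: (le_code (nfa_size rr.1.2)); rewrite ?inE ?eqxx.
move: (code_ta c M) (code_seq _ _) (code_seq _ _) => C X Y; lia.
Qed.
End TreeAutomata.

(** * Bipartitions *)

Lemma childP p q : reflect (exists i, q = rcons p i) (child p q).
Proof.
apply: (iffP andP) => [[/prefixP[t ->]]|[i ->]]; last by rewrite prefix_rcons size_rcons.
rewrite size_cat => /eqP st; have : size t = 1 by lia.
by case: t {st} => [|i []] // _; exists i; rewrite cats1.
Qed.

(* One part of the bipartition, [s], consists of the descendants of a node. *)
Definition good_side (N s : pred addr) : Prop :=
  [/\ forall p, p \in N -> s p -> exists2 q, q \in N & child q p,
      forall p q, p \in N -> q \in N -> child p q -> s p -> s q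
    & forall p q p' q', p \in N -> q \in N -> p' \in N -> q' \in N ->
        child p q -> child p' q' -> ~~ s p -> s q -> ~~ s p' -> s q' -> q = q'].

Lemma prefix_rconsE (T : eqType) (p q : seq T) i : prefix p (rcons q i) = (p == rcons q i) || prefix p q.
Proof.
apply/idP/idP => [|/predU1P[->|]]; rewrite ?prefix_refl //; last first.
  by move=> pq; apply: prefix_trans pq (prefix_rcons _ _).
case/prefixP => t; case/lastP: t => [|t j] e; first by rewrite e cats0 eqxx.
by move: e; rewrite -rcons_cat => /rcons_inj[-> _]; rewrite prefix_prefix orbT.
Qed.

Lemma prefix_anti (T : eqType) (p q : seq T) : prefix p q -> prefix q p -> p = q.
Proof.
move=> /prefixP[t ->] /prefixP[u /(congr1 size)]; rewrite !size_cat => e.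
by case: t e => [|? ?] /=; rewrite ?cats0 //; lia.
Qed.

Local Notation adj := [rel x y | child x y || child y x].

(** A path enters the subtree of [p] only through [p] itself, which is not in [Z]. *)
Lemma avoid_path (Z : pred addr) p x s : ~~ Z p -> ~~ prefix p x ->
  path adj x s -> all Z s -> ~~ prefix p (last x s).
Proof.
move=> Zp; elim: s x => //= y s IHs x px /andP[xy ys] /andP[Zy Zs]; apply: IHs => //.
case/orP: xy => /childP[i e]; last first.
  by apply: contra px; rewrite e prefix_rconsE => ->; rewrite orbT.
by rewrite e prefix_rconsE (negPf px) orbF; apply: contra Zp => /eqP ->; rewrite -e.
Qed.

(** A path leaves the subtree of [q] only through the parent [p] of [q], which is not in [Z]. *)
Lemma stay_path (Z : pred addr) p q x s : ~~ Z p -> child p q -> prefix q x ->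
  path adj x s -> all Z s -> prefix q (last x s).
Proof.
move=> Zp pq; elim: s x => //= y s IHs x px /andP[xy ys] /andP[Zy Zs]; apply: IHs => //.
case/orP: xy => /childP[i e]; first by rewrite e prefix_rconsE px orbT.
move: px; rewrite e prefix_rconsE => /predU1P[qE|//].
case/childP: pq => j qE'; move: Zp; rewrite qE' in qE.
by case/rcons_inj: qE => -> _; rewrite Zy.
Qed.

Section Sides.
Variables (A : Type) (D : data_tree A).

Lemma nodes_nil : [::] \in nodes D. Proof. by rewrite inE; case: (dtree D). Qed.

Lemma nodes_rcons (t : tree A) p i : rcons p i \in nodes t -> p \in nodes t.
Proof.
elim: p t => [|j p IHp] t; first by rewrite inE.
by rewrite !inE /=; case: onth => // u; apply: IHp.
Qed.

(** The part without the root serves as [s]. It is closed under children, because the other part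
    links the root to each of its nodes without entering the subtree of a node of [s]. Its entry is
    unique, because a path inside it between two entries can leave the subtree of neither, which
    makes each entry a prefix of the other. *)
Lemma bipartite_side : bipartite D -> exists2 s, good_side (nodes D) s &
  forall p q, p \in nodes D -> q \in nodes D -> s p = s q -> dsim D p q -> p = q.
Proof.
case=> X [Y [XY disj cX cY [simX simY]]].
wlog rX : X Y XY disj cX cY simX simY / [::] \in X.
  move=> H; have := nodes_nil; rewrite XY => /orP[|rY]; first exact: (H X Y).
  apply: (H Y X) => //; first by move=> p; rewrite XY orbC.
  by move=> p; rewrite andbC.
have NX p : p \in nodes D -> ~~ Y p -> p \in X by rewrite XY => /orP[//|Yp /negP].
have YN p : Y p -> p \notin X by move=> Yp; have := disj p; rewrite [p \in Y]Yp andbT.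
exists Y; last first.
  move=> p q pD qD; case Yq: (Y q) => Yp pq; first exact: simY pq.
  by apply: simX pq; apply: NX; rewrite // ?Yp ?Yq.
split.
- move=> p pD Yp; case/lastP: p pD Yp => [_ /YN|p i pD _]; first by rewrite rX.
  by exists p; [apply: nodes_rcons pD | apply/childP; exists i].
- move=> p q pD qD pq Yp; apply: contraT => /(NX _ qD) qX.
  have [s [ps sX lq]] := cX _ _ rX qX.
  have p0 : p != [::] by apply: contraTneq Yp => ->; apply/negP => /YN; rewrite rX.
  have p0' : ~~ prefix p [::] by case: (p) p0.
  have := avoid_path (YN _ Yp) p0' ps sX; rewrite lq; case/childP: pq => i ->.
  by rewrite prefix_rcons.
move=> p q p' q' pD qD p'D q'D pq p'q' Yp Yq Yp' Yq'.
have [s [ps sY lq]] := cY _ _ Yq Yq'; have [s' [ps' sY' lq']] := cY _ _ Yq' Yq.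
apply: prefix_anti.
  by have := stay_path Yp pq (prefix_refl q) ps sY; rewrite lq.
by have := stay_path Yp' p'q' (prefix_refl q') ps' sY'; rewrite lq'.
Qed.

Lemma bipartite_of_side s : good_side (nodes D) s ->
    (forall p q, p \in nodes D -> q \in nodes D -> s p = s q -> dsim D p q -> p = q) ->
  bipartite D.
Proof.
move=> [s1 s2 s3] sim.
exists [pred p in nodes D | ~~ s p], [pred p in nodes D | s p]; split.
- by move=> p; rewrite [in RHS]inE [X in _ || X]inE; case: (s p); rewrite ?andbT ?andbF ?orbF.
- by move=> p; rewrite !inE /=; case: (s p); rewrite ?andbF.
- set X := [pred p in _ | _].
  (* Connectedness is shown by paths to and from a fixed node, here the root. *)
  have link p : p \in X -> (exists u, [/\ path adj p u, all X u & last p u = [::]]) /\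
                          (exists u, [/\ path adj [::] u, all X u & last [::] u = p]).
    elim/last_ind: p => [|p i IHp] pX; first by split; exists [::].
    have /andP[piD sp] := pX; have pD := nodes_rcons piD.
    have pc : child p (rcons p i) by apply/childP; exists i.
    have pX' : p \in X by rewrite inE /= pD; apply: contra sp; apply: s2.
    have [[u [pu uX lu]] [u' [pu' uX' lu']]] := IHp pX'; split.
      exists (p :: u); split; [by rewrite [path _ _ _]/= pc orbT | by apply/andP; split; [apply: pX' |] | by []].
    exists (rcons u' (rcons p i)); split; last by rewrite last_rcons.
      by rewrite rcons_path pu' lu' /= pc.
    by rewrite all_rcons uX' andbT.
  move=> p q /link[[u [pu uX lu]] _] /link[_ [u' [pu' uX' lu']]]; exists (u ++ u').
  by rewrite cat_path pu lu pu' all_cat uX uX' last_cat lu.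
- set Y := [pred p in _ | _].
  (* On this side the fixed node is the entry [c]. It is found separately for each [p]; uniqueness
     of entries identifies the results afterwards. *)
  have link p : p \in Y -> exists2 c, exists q, [/\ q \in nodes D, c \in Y, ~~ s q & child q c] &
      (exists u, [/\ path adj p u, all Y u & last p u = c]) /\
      (exists u, [/\ path adj c u, all Y u & last c u = p]).
    elim/last_ind: p => [|p i IHp] pY; have /andP[piD sp] := pY.
      by have [q _ /childP[i]] := s1 _ piD sp; case: q.
    have pD := nodes_rcons piD.
    have pc : child p (rcons p i) by apply/childP; exists i.
    have [sp'|sp'] := boolP (s p); last first.
      by exists (rcons p i); [exists p | split; exists [::]].
    have pY' : p \in Y by rewrite inE /= pD.
    have [c ec [[u [pu uX lu]] [u' [pu' uX' lu']]]] := IHp pY'; exists c => //; split.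
      exists (p :: u); split; [by rewrite [path _ _ _]/= pc orbT | by apply/andP; split; [apply: pY' |] | by []].
    exists (rcons u' (rcons p i)); split; last by rewrite last_rcons.
      by rewrite rcons_path pu' lu' /= pc.
    by rewrite all_rcons uX' andbT.
  move=> p q /link[c [x [xD /andP[cD sc] sx xc]] [[u [pu uX lu]] _]].
  move=> /link[c' [x' [xD' /andP[cD' sc'] sx' xc']] [_ [u' [pu' uX' lu']]]].
  have e := s3 _ _ _ _ xD cD xD' cD' xc xc' sx sc sx' sc'; exists (u ++ u').
  by rewrite cat_path pu lu e pu' all_cat uX uX' last_cat lu e.
split=> p q /andP[pD sp] /andP[qD sq]; apply: sim => //.
  by rewrite (negPf sp) (negPf sq).
by rewrite sp sq.
Qed.

End Sides.

(** * Colourings *)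

(** The tree at the node [c] without its right siblings; hence the result is a letter and a forest,
    not a binary subtree. *)
Fixpoint bsub A (b : bt A) (c : addr) : option (A * bt A) :=
  match b, c with
  | Nd a l r, 0 :: c' => if c' is [::] then Some (a, l) else bsub l c'
  | Nd a l r, i.+1 :: c' => bsub r (i :: c')
  | _, _ => None
  end.

Lemma bsub_node A (b : bt A) c : c \in bnodes b -> exists al, bsub b c = Some al.
Proof.
elim: b c => [|a l IHl r IHr] [|[|i] c] //=.
  by case: c => [|j c]; [exists (a, l) | apply: IHl].
exact: (IHr (i :: c)).
Qed.

Lemma bsub_mapi A B (g h : addr -> A -> B) b c :
  (forall p, prefix c p -> g p =1 h p) -> bsub (bmapi g b) c = bsub (bmapi h b) c.
Proof.
elim: b g h c => [|a l IHl r IHr] g h [|[|i] c] gh //=.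
  case: c gh => [|j c] gh; last by apply: IHl => p cp; apply: gh.
  congr (Some (_, _)); first exact: gh.
  by apply: bmapi_eq => p _ a'; apply: gh; case: p.
apply: (IHr (fun p => g (shift p)) (fun p => h (shift p)) (i :: c)) => -[|j p] //= cp.
by apply: gh.
Qed.

(** The tree at [c] acts on a run as a map from the state of its right siblings to the state of the
    binary subtree at [c]. Trees with the same map are interchangeable. *)
Lemma run_replace B (M : aut B) b1 b2 c al1 al2 :
    (forall p, ~~ prefix c p -> blabel b1 p = blabel b2 p) ->
    bsub b1 c = Some al1 -> bsub b2 c = Some al2 ->
    (forall q, aut_step al1.1 (run M al1.2) q = aut_step al2.1 (run M al2.2) q) ->
  run M b1 = run M b2.
Proof.
elim: b1 b2 c => [|a1 l1 IHl r1 IHr] [|a2 l2 r2] c //; case: c => [|[|i] c] //= b12.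
  have er : r1 = r2.
    apply: blabel_inj => -[|i p]; first by rewrite !blabel_nil.
    by have := b12 (i.+1 :: p) isT; rewrite /= /blabel.
  case: c b12 => [|j c] b12; first by move=> [<-] [<-] /= ->; rewrite er.
  move=> s1 s2 st; have [->] := b12 [:: 0] isT; rewrite er; congr aut_step.
  apply: (IHl l2 (j :: c)) => // -[|i p]; first by rewrite !blabel_nil.
  by move=> jp; apply: (b12 [:: 0, i & p]).
move=> s1 s2 st; have [->] := b12 [:: 0] isT.
have -> : l1 = l2.
  apply: blabel_inj => -[|j p]; first by rewrite !blabel_nil.
  by have := b12 [:: 0, j & p] isT.
congr aut_step; apply: (IHr r2 (i :: c)) => // -[|j p]; first by rewrite !blabel_nil.
by move=> jp; apply: (b12 (j.+1 :: p)).
Qed.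

Lemma bnodes_rcons A (b : bt A) p i : p != [::] -> rcons p i \in bnodes b -> p \in bnodes b.
Proof.
elim: b p => [|a l IHl r IHr] [|[|j] p] // _; last first.
  by rewrite -[rcons _ _]/(shift (j :: rcons p i)) -[j.+1 :: p]/(shift (j :: p)) !bnodesS; apply: (IHr (j :: p)).
rewrite rcons_cons !bnodes0; have [-> //|p0] := eqVneq p [::].
by case: eqP => [|_]; [case: (p) | apply: IHl].
Qed.

Lemma side_cut A (b : bt A) (s : pred addr) y : good_side (bnodes b) s -> y \in bnodes b -> s y ->
  exists2 c, c \in bnodes b & forall p, p \in bnodes b -> s p = prefix c p.
Proof.
move=> [s1 s2 s3].
have entry p : p \in bnodes b -> s p -> exists c q,
    [/\ c \in bnodes b, q \in bnodes b & child q c] /\ [/\ ~~ s q, s c & prefix c p].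
  elim/last_ind: p => [|p i IHp] pb sp; first by rewrite bnodes_nil in pb.
  have [q qb qp] := s1 _ pb sp; have [j /rcons_inj[epq _]] := childP _ _ qp; subst q.
  have [sp'|sp'] := boolP (s p); last by exists (rcons p i), p; rewrite prefix_refl.
  have [c [q [H [sq sc cp]]]] := IHp qb sp'; exists c, q; split=> //; split=> //.
  by apply: prefix_trans cp (prefix_rcons _ _).
move=> yb sy; have [c [q [[cb qb qc] [sq sc cy]]]] := entry y yb sy; exists c => // p pb.
apply/idP/idP => [sp|].
  have [c' [q' [[cb' qb' qc'] [sq' sc' cy']]]] := entry p pb sp.
  by rewrite (s3 q c q' c').
elim/last_ind: p pb => [|p i IHp] pb; first by rewrite bnodes_nil in pb.
rewrite prefix_rconsE => /predU1P[<- //|cp].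
have p0 : p != [::] by case: (p) cp cb => //; case: (c); rewrite ?bnodes_nil.
have pb' := bnodes_rcons p0 pb.
by apply: (s2 p) => //; [apply/childP; exists i | apply: IHp].
Qed.

Definition v3 (x y z : addr) : 'I_3 -> addr := fun i => nth [::] [:: x; y; z] i.

Lemma v3_in (N : pred addr) x y z :
  x \in N -> y \in N -> z \in N -> forall i, v3 x y z i \in N.
Proof. by move=> xN yN zN [[|[|[|]]]]. Qed.

Lemma v3_rel (P : addr -> addr -> Prop) x y z x' y' z' :
  P x x' -> P y y' -> P z z' -> forall i, P (v3 x y z i) (v3 x' y' z' i).
Proof. by move=> Px Py Pz [[|[|[|]]]]. Qed.

(* The truth of [R x z y] and [R x y z] does not depend on the choice of [y]
   among the nodes of its colour, when [y] is not on the side of [x] and [z]. *)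
Definition respects A J (R : bpred A 'I_3 J) (K : eqType) (b : bt A) (s : pred addr)
    (V : J -> pred addr) (kappa : addr -> K) : Prop :=
  forall x z y y', x \in bnodes b -> z \in bnodes b -> y \in bnodes b -> y' \in bnodes b ->
    s x = s z -> s y = s y' -> s x != s y -> kappa y = kappa y' ->
    (R b (v3 x z y) V -> R b (v3 x z y') V) /\ (R b (v3 x y z) V -> R b (v3 x y' z) V).

Lemma finite_colour (T : finType) (k : nat) : #|T| <= k -> exists f : T -> 'I_k, injective f.
Proof.
move=> Tk; exists (fun x => widen_ord Tk (enum_rank x)) => x y /(congr1 val) /= e.
by apply: enum_rank_inj; apply: val_inj.
Qed.

(** One side is the tree at a node [c], and all that the automaton learns about it is the map [tau]
    on states. A node inside is coloured by the map that it causes alone; a node outside by the maps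
    that two nodes inside can cause so as to make [R] true together with it. The factors count at
    most [tow (h + 4)] pairs of sets of maps and as many pairs of maps, whence [h + 5]. *)
Lemma colouring A J h (R : bpred A 'I_3 J) b s V : regular h R -> good_side (bnodes b) s ->
  exists kappa : addr -> 'I_(tow (h + 5)), respects R b s V kappa.
Proof.
move=> [M hM MP] sb.
have [[y0 [y0b sy0]]|none] := pselect (exists y, y \in bnodes b /\ s y); last first.
  have kpos : 0 < tow (h + 5) by apply: leq_trans (tow_ge2 _).
  exists (fun=> Ordinal kpos) => x z y y' xb zb yb y'b _ _ sxy.
  by case: none; case sx: (s x) sxy; case sy: (s y) => // _; [exists x | exists y].
have [c cb sc] := side_cut sb y0b sy0.
pose T := {ffun aut_state M -> aut_state M}.
pose tau v : T := if bsub (mark b v V) c is Some al then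
    [ffun q => aut_step al.1 (run M al.2) q] else [ffun q => q].
pose Pout u u' := u = u' \/ ~~ prefix c u /\ ~~ prefix c u'.
pose Pin u u' := u = u' \/ prefix c u /\ prefix c u'.
have tau_eq v v' : (forall i, Pout (v i) (v' i)) -> tau v = tau v'.
  move=> vv'; rewrite /tau /mark; rewrite (bsub_mapi _ (h := (fun p a => (a, [ffun i => v' i == p], [ffun j => V j p])))) //.
  move=> p cp a; congr (_, _, _); apply/ffunP => i; rewrite !ffunE.
  have [-> //|[nv nv']] := vv' i.
  by have [e|_] := eqVneq (v i) p; have [e'|_] := eqVneq (v' i) p => //; move: nv nv'; rewrite ?e ?e' cp.
have R_eq v v' : (forall i, v i \in bnodes b) -> (forall i, v' i \in bnodes b) -> tau v = tau v' ->
    (forall i, Pin (v i) (v' i)) -> R b v V -> R b v' V.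
  move=> vb vb' tv vv' /(MP _ _ _ vb) fR; apply/(MP _ _ _ vb').
  have -> // : run M (mark b v' V) = run M (mark b v V).
  have [al1 e1] : exists al, bsub (mark b v V) c = Some al by apply: bsub_node; rewrite bnodes_mapi.
  have [al2 e2] : exists al, bsub (mark b v' V) c = Some al by apply: bsub_node; rewrite bnodes_mapi.
  apply: (run_replace _ e2 e1) => [p cp|q]; last first.
    by move: tv; rewrite /tau e1 e2 => /ffunP/(_ q); rewrite !ffunE.
  rewrite !blabel_mapi; case: blabel => //= a; congr (Some (_, _, _)).
  apply/ffunP => i; rewrite !ffunE; have [-> //|[nv nv']] := vv' i.
  by have [e|_] := eqVneq (v i) p; have [e'|_] := eqVneq (v' i) p => //; move: nv nv' cp; rewrite ?e ?e' => *; exfalso; apply/negP; eauto.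
(* The two sets serve the nodes [y] outside, the two maps those inside, one for each order of the
   arguments. The address [[::]] is not a node and thus leaves no mark. *)
pose C y : {set T} * {set T} * (T * T) :=
  ([set t | `[< exists x z, [/\ x \in bnodes b, z \in bnodes b, s x, s z & tau (v3 x z y) = t /\ R b (v3 x z y) V] >]],
   [set t | `[< exists x z, [/\ x \in bnodes b, z \in bnodes b, s x, s z & tau (v3 x y z) = t /\ R b (v3 x y z) V] >]],
   (tau (v3 [::] [::] y), tau (v3 [::] y [::]))).
have [f fI] : exists f : {set T} * {set T} * (T * T) -> 'I_(tow (h + 5)), injective f.
  apply: finite_colour; rewrite !card_prod !card_setT.
  have cT : #|T| <= tow (h + 2).
    rewrite card_ffun addn2 /=; set q := #|_|.
    have q0 : 0 < q by apply/card_gt0P; exists (aut_leaf M).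
    apply: (@leq_trans (2 ^ (q * q))).
      by rewrite expnM leq_exp2r // ltnW // ltn_expl.
    rewrite leq_exp2l //; apply: leq_trans (tow_mul h); exact: leq_mul.
  have c2 : 2 ^ #|T| * 2 ^ #|T| <= tow (h + 4).
    by rewrite (addnS h 3); apply: leq_trans (tow_mul _); apply: leq_mul; rewrite (addnS h 2) [tow _]/= leq_exp2l.
  have c1 : #|T| * #|T| <= tow (h + 4).
    apply: (@leq_trans (tow (h + 3))); last by apply: leq_tow; rewrite leq_add2l.
    by rewrite (addnS h 2); apply: leq_trans (tow_mul _); apply: leq_mul.
  by rewrite (addnS h 4); apply: leq_trans (tow_mul _); apply: leq_mul.
have cnil : ~~ prefix c [::] by case: (c) cb; rewrite ?bnodes_nil.
exists (fun y => f (C y)) => x z y y' xb zb yb y'b sxz syy sxy /fI eC.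
have nc u : u \in bnodes b -> s u = false -> ~~ prefix c u by move=> ub; rewrite sc // => ->.
have pc u : u \in bnodes b -> s u -> prefix c u by move=> ub; rewrite sc.
(* Here [x] and [z] are inside. The colour of [y'] yields another pair inside with the same map that
   satisfies [R] together with [y']; as the map is the same, this pair can be exchanged for [x] and
   [z]. *)
case sx: (s x) sxz sxy => /esym sz; case sy: (s y) syy => // /esym sy' _.
  case: eC => /setP e1 /setP e2 _ _; split=> Ry.
    have := e1 (tau (v3 x z y)); rewrite !inE (asboolT (ex_intro _ x (ex_intro _ z _))) //.
    move=> /esym/asboolP[x' [z' [x'b z'b sx' sz' [et]]]].
    apply: (R_eq (v3 x' z' y')); [exact: v3_in | exact: v3_in | rewrite et; apply: tau_eq |].
      by apply: (v3_rel (P := Pout)); [left | left | right; rewrite !nc].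
    by apply: (v3_rel (P := Pin)); [right; rewrite !pc | right; rewrite !pc | left].
  have := e2 (tau (v3 x y z)); rewrite !inE (asboolT (ex_intro _ x (ex_intro _ z _))) //.
  move=> /esym/asboolP[x' [z' [x'b z'b sx' sz' [et]]]].
  apply: (R_eq (v3 x' y' z')); [exact: v3_in | exact: v3_in | rewrite et; apply: tau_eq |].
    by apply: (v3_rel (P := Pout)); [left | right; rewrite !nc | left].
  by apply: (v3_rel (P := Pin)); [right; rewrite !pc | left | right; rewrite !pc].
have tE1 u : u \in bnodes b -> tau (v3 x z u) = tau (v3 [::] [::] u).
  by move=> ub; apply/tau_eq/(v3_rel (P := Pout)); [right; rewrite cnil nc | right; rewrite cnil nc | left].
have tE2 u : u \in bnodes b -> tau (v3 x u z) = tau (v3 [::] u [::]).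
  by move=> ub; apply/tau_eq/(v3_rel (P := Pout)); [right; rewrite cnil nc | left | right; rewrite cnil nc].
case: eC => _ _ e1 e2; split; [apply: (R_eq (v3 x z y)) | apply: (R_eq (v3 x y z))].
all: try exact: v3_in.
- by rewrite !tE1.
- by apply: (v3_rel (P := Pin)); [left | left | right; rewrite !pc].
- by rewrite !tE2.
- by apply: (v3_rel (P := Pin)); [left | right; rewrite !pc | left].
Qed.

(** * Matchings *)

Fixpoint bnodes_seq A (b : bt A) : seq addr :=
  if b is Nd _ l r then
    [:: 0] :: [seq 0 :: p | p <- bnodes_seq l] ++ [seq shift p | p <- bnodes_seq r]
  else [::].

Lemma mem_bnodes_seq A (b : bt A) : bnodes_seq b =i bnodes b.
Proof.
elim: b => [|a l IHl r IHr] p /=; first by rewrite inE.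
rewrite inE mem_cat; apply/or3P/idP => [[/eqP -> //|/mapP[q]|/mapP[q]]|].
- by rewrite IHl => ql ->; rewrite bnodes0 ql orbT.
- by rewrite IHr => qr ->; rewrite bnodesS.
move=> pN; have [->|[q ql ->]|[q qr ->]] := bnodesP pN.
- by rewrite eqxx; constructor 1.
- by constructor 2; apply: map_f; rewrite IHl.
- by constructor 3; apply: map_f; rewrite IHr.
Qed.

Lemma shift_inj : injective shift.
Proof. by move=> [|i p] [|j q] //= [-> ->]. Qed.

Lemma bnodes_seq_uniq A (b : bt A) : uniq (bnodes_seq b).
Proof.
elim: b => //= a l IHl r IHr; rewrite cat_uniq !map_inj_uniq ?IHl ?IHr //=; last 2 first.
- exact: shift_inj.
- by move=> p q [].
rewrite mem_cat !andbT; apply/andP; split.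
  apply/norP; split; apply/mapP => -[q]; rewrite mem_bnodes_seq; case: q => [|i q] //.
  by rewrite bnodes_nil.
by apply/hasPn => _ /mapP[q _ ->]; apply/mapP => -[p _]; case: q.
Qed.

Lemma size_bnodes_seq A (b : bt A) : size (bnodes_seq b) = bsize b.
Proof. by elim: b => //= a l <- r <-; rewrite size_cat !size_map. Qed.

Section Matching.
Import GRing.Theory Num.Theory.
Variables (A : Type) (K : finType).

(* Letter, side, colour and colour of the partner, if any. *)
Definition ann := (A * bool * K * option K)%type.

Definition annotate (b : bt A) (s : pred addr) (kappa : addr -> K) (pi : addr -> option K) :
    bt ann :=
  bmapi (fun p a => (a, s p, kappa p, pi p)) b.

Variables (b : bt A) (s : pred addr) (kappa : addr -> K) (pi : addr -> option K).

Definition matching (mt : rel addr) : Prop :=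
  [/\ {in bnodes b &, forall p q, mt p q -> [/\ s p != s q, pi p = Some (kappa q) & mt q p]},
      {in bnodes b & &, forall p q q', mt p q -> mt p q' -> q = q'}
    & {in bnodes b, forall p k, pi p = Some k -> exists2 q, q \in bnodes b & mt p q}].

Definition group (c : bool) (k l : K) : seq addr :=
  [seq p <- bnodes_seq b | [&& s p == c, kappa p == k & pi p == Some l]].

Lemma groupP c k l p :
  p \in group c k l = [&& s p == c, kappa p == k, pi p == Some l & p \in bnodes b].
Proof. by rewrite mem_filter mem_bnodes_seq -!andbA. Qed.

Lemma leq_group mt c k l : matching mt -> size (group c k l) <= size (group (~~ c) l k).
Proof.
move=> [m1 m2 m3].
have partner p : exists q, p \in group c k l -> q \in group (~~ c) l k /\ mt q p.
  have [|_] := boolP (p \in group c k l); last by exists p.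
  rewrite groupP => /and4P[/eqP sp /eqP kp /eqP pp pb].
  have [q qb pq] := m3 p pb l pp; exists q => _.
  have [spq pp' qp] := m1 p q pb qb pq; have [_ pq' _] := m1 q p qb pb qp.
  split=> //; rewrite groupP qb pq' kp eqxx andbT -sp.
  by move: pp'; rewrite pp => -[->]; rewrite eqxx andbT; case: (s p) spq; case: (s q).
have [f fP] := boolp.choice partner.
rewrite -(size_map f); apply: uniq_leq_size => [|_ /mapP[p pg ->]]; last by have [] := fP p pg.
rewrite map_inj_in_uniq ?filter_uniq ?bnodes_seq_uniq // => p q pg qg e.
have [fp pm] := fP p pg; have [fq qm] := fP q qg; move: fp pg qg.
rewrite !groupP => /and4P[_ _ _ fb] /and4P[_ _ _ pb] /and4P[_ _ _ qb].
by apply: (m2 (f p)) => //; rewrite e.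
Qed.

Lemma matching_group mt k l : matching mt -> size (group false k l) = size (group true l k).
Proof.
by move=> m; apply/eqP; rewrite eqn_leq (leq_group false k l m) (leq_group true l k m).
Qed.

(** Opposite groups of the same size are matched in the order of their enumerations. *)
Lemma group_matching : (forall k l, size (group false k l) = size (group true l k)) ->
  exists mt, matching mt.
Proof.
move=> eg; have {}eg c k l : size (group c k l) = size (group (~~ c) l k) by case: c.
exists (fun p q => [&& s p != s q, pi p == Some (kappa q), pi q == Some (kappa p)
   & index p (group (s p) (kappa p) (kappa q)) == index q (group (s q) (kappa q) (kappa p))]).
split.
- move=> p q pb qb /and4P[spq /eqP pp pq /eqP ->]; split=> //.
  by rewrite eq_sym spq pq pp !eqxx.
- move=> p q q' pb qb q'b /and4P[spq /eqP pp pq /eqP epq] /and4P[spq' /eqP pp' pq' /eqP epq'].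
  have kq : kappa q = kappa q' by move: pp'; rewrite pp => -[].
  have sq : s q = s q' by move: spq spq'; case: (s p); case: (s q); case: (s q').
  move: epq'; rewrite -kq epq -sq => /(congr1 (nth [::] (group (s q) (kappa q) (kappa p)))).
  rewrite !nth_index // groupP ?pq' ?q'b ?pq ?qb -?sq -?kq !eqxx //.
move=> p pb l pp; set g := group (s p) (kappa p) l.
have pg : p \in g by rewrite groupP pb pp !eqxx.
pose q := nth [::] (group (~~ s p) l (kappa p)) (index p g).
have iq : index p g < size (group (~~ s p) l (kappa p)) by rewrite -eg index_mem.
have qg : q \in group (~~ s p) l (kappa p) by apply: mem_nth.
have := qg; rewrite groupP => /and4P[/eqP sq /eqP kq /eqP pq qb].
exists q => //; rewrite sq kq pp pq !eqxx /=; apply/andP; split; first by case: (s p).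
by rewrite /q index_uniq ?filter_uniq ?bnodes_seq_uniq.
Qed.

(** Summed over the tree this is the difference between the sizes of two groups that must be matched
    with each other. *)
Definition weight (kl : K * K) (x : ann) : int :=
  ([&& x.1.1.2 == false, x.1.2 == kl.1 & x.2 == Some kl.2]%:R
   - [&& x.1.1.2 == true, x.1.2 == kl.2 & x.2 == Some kl.1]%:R)%R.

Lemma weight_bound kl x : (`|weight kl x| <= 1)%R.
Proof.
rewrite /weight; case: [&& _, _ & _]; case: [&& _, _ & _] => //=; by rewrite ?subr0 ?sub0r ?normrN ?normr1.
Qed.

Lemma bsum_weight k l : bsum (weight (k, l)) (annotate b s kappa pi) =
  ((size (group false k l))%:Z - (size (group true l k))%:Z)%R.
Proof.
rewrite /group !size_filter; elim: b s kappa pi => //= a l' IHl r IHr s' kappa' pi'.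
rewrite /annotate /= -/(annotate l' _ _ _) -/(annotate r _ _ _) IHl IHr /weight /=.
rewrite !count_cat !count_map !natz !PoszD /preim /= !opprD.
have H (u v w x y z : int) : (u - v + (w - x) + (y - z) = u + (w + y) + (- v + (- x - z)))%R by lia.
exact: H.
Qed.

End Matching.

(** * Annotated trees *)

Section Combinators.
Variables (A : Type) (J : finType).
Implicit Types I : finType.

Definition bAll I (R : bpred A (option I) J) : bpred A I J :=
  fun b v V => forall p, p \in bnodes b -> R b (ext p v) V.
Definition bEx I (R : bpred A (option I) J) : bpred A I J :=
  fun b v V => exists2 p, p \in bnodes b & R b (ext p v) V.
Definition bAnd I (R R' : bpred A I J) : bpred A I J := fun b v V => R b v V /\ R' b v V.
Definition bOr I (R R' : bpred A I J) : bpred A I J := fun b v V => R b v V \/ R' b v V.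
Definition bImp I (R R' : bpred A I J) : bpred A I J := fun b v V => R b v V -> R' b v V.
Definition bNot I (R : bpred A I J) : bpred A I J := fun b v V => ~ R b v V.
Definition bChild I (i j : I) : bpred A I J := fun b v V => child (v i) (v j).
Definition bEq I (i j : I) : bpred A I J := fun b v V => v i = v j.
Definition bLabel I (P : pred A) (i : I) : bpred A I J := fun b v V => has_at P b (v i).
Definition bLabel2 I (T : finType) (g : A -> T) (P : option T -> option T -> bool) (i j : I) :
    bpred A I J :=
  fun b v V => P (omap g (blabel b (v i))) (omap g (blabel b (v j))).
Definition bTernary I (R : bpred A 'I_3 J) (i j k : I) : bpred A I J :=
  fun b v V => R b (v3 (v i) (v j) (v k)) V.

(** The condition is split according to the value of [g] at the first node, so that each conjunct
    tests the nodes separately; the number of conjuncts appears in the height. *)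
Lemma regular_bLabel2 h I (T : finType) (g : A -> T) (P : option T -> option T -> bool) (i j : I) :
  regular (h.+1 + #|T|) (bLabel2 g P i j).
Proof.
have := @regular_all A I J h.+1 T (enum T) (fun t b v V =>
   (exists2 x, blabel b (v i) = Some x & g x == t) ->
   (exists2 x, blabel b (v j) = Some x & P (Some t) (Some (g x)))).
rewrite -cardE => H; apply: regular_ext (H _) => [b v V vb|t _]; last first.
  apply: regular_imp; first exact: (regular_label _ _ (fun x => g x == t)).
  exact: (regular_label _ _ (fun x => P (Some t) (Some (g x)))).
rewrite /bLabel2; have := vb i; have := vb j; rewrite !inE.
case: (blabel b (v i)) => [x|] //; case: (blabel b (v j)) => [y|] // _ _ /=.
split=> [/(_ (g x)) |Pxy t _ [x' [<-] /eqP <-]]; last by exists y.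
by rewrite mem_enum => /(_ isT) []; [exists x | move=> y' [->]].
Qed.

Lemma regular_bTernary h I (R : bpred A 'I_3 J) (i j k : I) : regular h R -> regular h (bTernary R i j k).
Proof.
pose s (l : 'I_3) := nth i [:: i; j; k] l.
move=> /(@regular_sub _ _ _ _ _ _ _ s id); apply: regular_ext => b v V _; rewrite /bTernary.
have -> // : (fun l => v (s l)) = v3 (v i) (v j) (v k).
by apply/funext => -[[|[|[|]]]].
Qed.

Lemma regular_bAll h I (R : bpred A (option I) J) : regular h R -> regular h.+2 (bAll R).
Proof. exact: regular_allnode. Qed.
Lemma regular_bEx h I (R : bpred A (option I) J) : regular h R -> regular h.+2 (bEx R).
Proof. exact: regular_exnode. Qed.
Lemma regular_bAnd h I (R R' : bpred A I J) : regular h R -> regular h R' -> regular h.+1 (bAnd R R').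
Proof. exact: regular_and. Qed.
Lemma regular_bOr h I (R R' : bpred A I J) : regular h R -> regular h R' -> regular h.+1 (bOr R R').
Proof. exact: regular_or. Qed.
Lemma regular_bImp h I (R R' : bpred A I J) : regular h R -> regular h R' -> regular h.+1 (bImp R R').
Proof. exact: regular_imp. Qed.
Lemma regular_bNot h I (R : bpred A I J) : regular h R -> regular h (bNot R).
Proof. exact: regular_not. Qed.
Lemma regular_bChild h I (i j : I) : regular h.+1 (bChild i j).
Proof. exact: regular_child. Qed.
Lemma regular_bEq h I (i j : I) : regular h (bEq i j).
Proof. exact: regular_eq. Qed.
Lemma regular_bLabel h I (P : pred A) (i : I) : regular h (bLabel P i).
Proof. exact: regular_label. Qed.

End Combinators.

Ltac regular_tac :=
  repeat lazymatch goal with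
   | |- regular _ (bAll _) => apply: regular_bAll
   | |- regular _ (bEx _) => apply: regular_bEx
   | |- regular _ (bAnd _ _) => apply: regular_bAnd
   | |- regular _ (bOr _ _) => apply: regular_bOr
   | |- regular _ (bImp _ _) => apply: regular_bImp
   | |- regular _ (bNot _) => apply: regular_bNot
   | |- regular _ (bEq _ _) => exact: regular_bEq
   | |- regular _ (bLabel _ _) => exact: regular_bLabel
   | |- regular _ (bChild _ _) => exact: regular_bChild
   | |- regular _ (bTernary _ _ _ _) => apply: regular_bTernary
   end.

Section Annotated.
Variables (A : Type) (K : finType) (k0 : K) (J : finType).
Local Notation ann := (ann A K).
Implicit Types (t : bt ann) (I : finType).

Definition base (x : ann) : A := x.1.1.1.
Definition side t (p : addr) : bool := oapp (fun x => x.1.1.2) false (blabel t p).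
Definition col t (p : addr) : K := oapp (fun x => x.1.2) k0 (blabel t p).
Definition pcol t (p : addr) : option K := oapp snd None (blabel t p).

Lemma annotateE t : t = annotate (bmap base t) (side t) (col t) (pcol t).
Proof.
apply: blabel_inj => p; rewrite /annotate !blabel_mapi /side /col /pcol.
by case: blabel => [[[[a s] k] o]|].
Qed.

Lemma side_annotate b s kappa pi p : p \in bnodes b -> side (annotate b s kappa pi) p = s p.
Proof. by rewrite inE /side blabel_mapi; case: blabel. Qed.
Lemma col_annotate b s kappa pi p : p \in bnodes b -> col (annotate b s kappa pi) p = kappa p.
Proof. by rewrite inE /col blabel_mapi; case: blabel. Qed.
Lemma pcol_annotate b s kappa pi p : p \in bnodes b -> pcol (annotate b s kappa pi) p = pi p.
Proof. by rewrite inE /pcol blabel_mapi; case: blabel. Qed.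

Lemma bmap_annotate b s kappa pi : bmap base (annotate b s kappa pi) = b.
Proof. by apply: blabel_inj => p; rewrite /annotate !blabel_mapi; case: blabel. Qed.

Definition info (x : ann) : bool * K * option K := (x.1.1.2, x.1.2, x.2).
Definition info_size := #|{: bool * K * option K}|.

Definition iside (o : option (bool * K * option K)) := oapp (fun x => x.1.1) false o.
Definition icol (o : option (bool * K * option K)) := oapp (fun x => x.1.2) k0 o.
Definition ipcol (o : option (bool * K * option K)) := oapp snd None o.

Definition bSide I (i : I) : bpred ann I J := bLabel (fun x => x.1.1.2) i.
Definition bSameSide I (i j : I) : bpred ann I J := bLabel2 info (fun x y => iside x == iside y) i j.
Definition bSameCol I (i j : I) : bpred ann I J := bLabel2 info (fun x y => icol x == icol y) i j.
Definition bPartner I (i j : I) : bpred ann I J := bLabel2 info (fun x y => ipcol x == Some (icol y)) i j.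

Lemma bSideE I (i : I) t v (V : J -> pred addr) : bSide i t v V <-> side t (v i).
Proof.
rewrite /bSide /bLabel /has_at /side; case: blabel => [x|] /=; last by split=> [[]|].
by split=> [[_ [<-]]|] // sx; exists x.
Qed.

Lemma bSameSideE I (i j : I) t v (V : J -> pred addr) : bSameSide i j t v V <-> side t (v i) = side t (v j).
Proof.
rewrite /bSameSide /bLabel2 /side.
by case: (blabel t (v i)) => [x|]; case: (blabel t (v j)) => [y|] /=; split=> /eqP.
Qed.

Lemma bSameColE I (i j : I) t v (V : J -> pred addr) : bSameCol i j t v V <-> col t (v i) = col t (v j).
Proof.
rewrite /bSameCol /bLabel2 /col.
by case: (blabel t (v i)) => [x|]; case: (blabel t (v j)) => [y|] /=; split=> /eqP.
Qed.

Lemma bPartnerE I (i j : I) t v (V : J -> pred addr) : bPartner i j t v V <-> pcol t (v i) = Some (col t (v j)).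
Proof.
rewrite /bPartner /bLabel2 /pcol /col.
by case: (blabel t (v i)) => [x|]; case: (blabel t (v j)) => [y|] /=; split=> /eqP.
Qed.

Lemma regular_bSide h (I : finType) (i : I) : regular h (bSide i). Proof. exact: regular_bLabel. Qed.
Lemma regular_bSameSide h (I : finType) (i j : I) : regular (h.+1 + info_size) (bSameSide i j).
Proof. exact: regular_bLabel2. Qed.
Lemma regular_bSameCol h (I : finType) (i j : I) : regular (h.+1 + info_size) (bSameCol i j).
Proof. exact: regular_bLabel2. Qed.
Lemma regular_bPartner h (I : finType) (i j : I) : regular (h.+1 + info_size) (bPartner i j).
Proof. exact: regular_bLabel2. Qed.

End Annotated.

(** * Regularity of the conditions on annotated trees *)

Section AnnotatedFormulas.
Variables (A : Type) (K : finType) (k0 : K) (J : finType).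
Local Notation ann := (ann A K).
Implicit Types (t : bt ann) (I : finType).
Local Notation isz := (info_size K).

(* In the heights, the numeral bounds the nesting of the combinators. *)
Lemma regular_good_side (I : finType) h : regular (h + isz + 20) (fun t (_ : I -> addr) (_ : J -> pred addr) => good_side (bnodes t) (side t)).
Proof.
have r1 : regular (h + isz + 20) (bAnd (bAll (bImp (bSide None) (bEx (bChild None (Some None)))))
  (bAnd (bAll (bAll (bImp (bChild (Some None) None) (bImp (bSide (Some None)) (bSide None)))))
   (bAll (bAll (bAll (bAll (bImp (bChild (Some (Some (Some None))) (Some (Some None)))
      (bImp (bChild (Some None) None) (bImp (bNot (bSide (Some (Some (Some None)))))
       (bImp (bSide (Some (Some None))) (bImp (bNot (bSide (Some None))) (bImp (bSide None)
          (bEq (Some (Some None)) None))))))))))) : bpred ann I J)).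
  rewrite [_ + 20]addnC; regular_tac; exact: regular_bSide.
apply: regular_ext r1 => t v V _; split=> [[H1 [H2 H3]]|[H1 H2 H3]].
  split.
  - move=> p pt sp; have [|q qt qp] := H1 p pt; first exact/bSideE.
    by exists q.
  - by move=> p q pt qt pq sp; apply/(bSideE None t (ext q (ext p v)) V)/(H2 p pt q qt pq)/bSideE.
  - move=> p q p' q' pt qt p't q't pq p'q' sp sq sp' sq'.
    apply: (H3 p pt q qt p' p't q' q't pq p'q'); do ?[by apply/bSideE].
      by move=> /bSideE; apply/negP.
    by move=> /bSideE; apply/negP.
split; [|split].
- move=> p pt /bSideE sp; have [q qt qp] := H1 p pt sp; by exists q.
- by move=> p pt q qt pq /bSideE sp; apply/bSideE; apply: (H2 p q).
move=> p pt q qt p' p't q' q't pq p'q' sp /bSideE sq sp' /bSideE sq'.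
apply: (H3 p q p' q') => //; apply/negP => s; [apply: sp | apply: sp']; exact/bSideE.
Qed.


Definition single B (t : bt B) : Prop := exists a l, t = Nd a l Lf.

Lemma regular_single B (I : finType) h :
  regular h.+1 (fun (t : bt B) (_ : I -> addr) (_ : J -> pred addr) => single t).
Proof.
exists (@Aut _ (bool * bool)%type (true, false) (fun _ _ q => (false, q.1)) snd).
  by rewrite card_prod card_bool; apply: leq_trans (tow_mul h); apply: leq_mul; apply: tow_ge2.
move=> b v V _; set M := Aut _ _ _.
have r1 (c : bt (marked B I J)) : (run M c).1 = if c is Lf then true else false by case: c.
case: b => [|a l [|a' l' r']] /=; first by split=> // -[a [l]].
  by split=> // _; exists a, l.
by split=> // -[a'' [l'' []]].
Qed.

Lemma regular_respects h (R : bpred A 'I_3 J) : regular h R ->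
  regular (h + isz + 20) (fun t (_ : void -> addr) V =>
    respects R (bmap (@base A K) t) (side t) V (col k0 t)).
Proof.
move=> /(regular_map (@base A K)); set R' := (X in regular h X) => rR'.
pose x : option (option (option (option void))) := Some (Some (Some None)).
pose z : option (option (option (option void))) := Some (Some None).
pose y : option (option (option (option void))) := Some None.
pose y' : option (option (option (option void))) := None.
have r1 : regular (h + isz + 20) (bAll (bAll (bAll (bAll
   (bImp (bSameSide x z) (bImp (bSameSide y y') (bImp (bNot (bSameSide x y))
     (bImp (bSameCol k0 y y') (bAnd
        (bImp (bTernary R' x z y) (bTernary R' x z y'))
        (bImp (bTernary R' x y z) (bTernary R' x y' z)))))))))) : bpred ann void J).
  rewrite [_ + 20]addnC; regular_tac.
  all: try by apply: regular_leq rR'; rewrite /isz; lia.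
  all: try by apply: regular_leq (@regular_bSameSide _ _ _ 0 _ _ _); lia.
  by apply: regular_leq (@regular_bSameCol _ _ _ _ 0 _ _ _); lia.
apply: regular_ext r1 => t v V _; split=> H.
  move=> x' z' y1 y2; rewrite !bnodes_mapi => xt zt y1t y2t sxz syy sxy cy.
  apply: (H x' xt z' zt y1 y1t y2 y2t); [exact/bSameSideE | exact/bSameSideE | | exact/bSameColE].
  by move=> /bSameSideE /= e; rewrite e eqxx in sxy.
move=> x' xt z' zt y1 y1t y2 y2t /bSameSideE sxz /bSameSideE syy sxy /bSameColE cy.
apply: H; rewrite ?bnodes_mapi //.
by apply/eqP => e; apply: sxy; apply/bSameSideE.
Qed.

Section Queries.
Variables (B : Type) (b : bt B) (s : pred addr) (kappa : addr -> K) (pi : addr -> option K).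
Variables (R : addr -> addr -> addr -> Prop) (x : addr).
Local Notation N := (bnodes b).

(** Two equivalent nodes are equal or lie on different sides. In the second case one of them, [z],
    is on the side of [x], and the other is replaced by any node [y] with the colour [pi z] of the
    partner of [z], so that the matching is not mentioned. *)
Definition sim_query : Prop :=
  (exists2 y, y \in N & R x y y) \/
  (exists2 z, z \in N & exists2 y, y \in N &
     (s z = s x /\ ~ s y = s x) /\ pi z = Some (kappa y) /\ (R x z y \/ R x y z)).

(* When [y] has the colour of the partner of [z], it need not be that partner. *)
Definition unsim_query : Prop :=
  (exists2 z, z \in N & exists2 y, y \in N & ~ z = y /\ s z = s y /\ R x z y) \/
  (exists2 z, z \in N & exists2 y, y \in N &
     (s z = s x /\ ~ s y = s x) /\
     (~ pi z = Some (kappa y) \/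
      exists2 y', y' \in N & ~ y = y' /\ s y = s y' /\ kappa y = kappa y') /\
     (R x z y \/ R x y z)).

End Queries.

Lemma regular_sim_query h (R : bpred A 'I_3 J) (I : finType) (i : I) : regular h R ->
  regular (h + isz + 20) (fun t v V => sim_query t (side t) (col k0 t) (pcol t)
     (fun x y z => R (bmap (@base A K) t) (v3 x y z) V) (v i)).
Proof.
move=> /(regular_map (@base A K)); set R' := (X in regular h X) => rR'.
pose x : option (option I) := Some (Some i).
pose z : option (option I) := Some None.
pose y : option (option I) := None.
have r1 : regular (h + isz + 20) (bOr (bEx (bTernary R' (Some i) None None))
   (bEx (bEx (bAnd (bAnd (bSameSide z x) (bNot (bSameSide y x)))
      (bAnd (bPartner k0 z y) (bOr (bTernary R' x z y) (bTernary R' x y z)))))) : bpred ann I J).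
  rewrite [_ + 20]addnC; regular_tac.
  all: try by apply: regular_leq rR'; rewrite /isz; lia.
  all: try by apply: regular_leq (@regular_bSameSide _ _ _ 0 _ _ _); lia.
  by apply: regular_leq (@regular_bPartner _ _ _ _ 0 _ _ _); lia.
apply: regular_ext r1 => t v V _; split=> [[H|[z' zt [y' yt [[szx syx] [/bPartnerE pzy H]]]]]|].
- by left.
- right; exists z' => //; exists y' => //; split=> //; split; first by move/bSameSideE: szx.
  by move=> e; apply: syx; apply/bSameSideE.
- case=> [H|[z' zt [y' yt [[szx syx] [pzy H]]]]]; first by left.
  right; exists z' => //; exists y' => //; split; last by split=> //; apply/bPartnerE.
  by split; [apply/bSameSideE | move/bSameSideE].
Qed.

Lemma regular_unsim_query h (R : bpred A 'I_3 J) (I : finType) (i : I) : regular h R ->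
  regular (h + isz + 20) (fun t v V => unsim_query t (side t) (col k0 t) (pcol t)
     (fun x y z => R (bmap (@base A K) t) (v3 x y z) V) (v i)).
Proof.
move=> /(regular_map (@base A K)); set R' := (X in regular h X) => rR'.
pose x : option (option I) := Some (Some i).
pose z : option (option I) := Some None.
pose y : option (option I) := None.
have r1 : regular (h + isz + 20) (bOr
   (bEx (bEx (bAnd (bNot (bEq z y)) (bAnd (bSameSide z y) (bTernary R' x z y)))))
   (bEx (bEx (bAnd (bAnd (bSameSide z x) (bNot (bSameSide y x)))
      (bAnd (bOr (bNot (bPartner k0 z y))
        (bEx (bAnd (bNot (bEq (Some y) None)) (bAnd (bSameSide (Some y) None) (bSameCol k0 (Some y) None)))))
      (bOr (bTernary R' x z y) (bTernary R' x y z)))))) : bpred ann I J).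
  rewrite [_ + 20]addnC; regular_tac.
  all: try by apply: regular_leq rR'; rewrite /isz; lia.
  all: try by apply: regular_leq (@regular_bSameSide _ _ _ 0 _ _ _); lia.
  all: try by apply: regular_leq (@regular_bSameCol _ _ _ _ 0 _ _ _); lia.
  by apply: regular_leq (@regular_bPartner _ _ _ _ 0 _ _ _); lia.
apply: regular_ext r1 => t v V _; split.
  case=> [[z' zt [y' yt [zy [szy Rzy]]]]|[z' zt [y' yt [[szx syx] [H HR]]]]].
    by left; exists z' => //; exists y' => //; split=> //; split=> //; move/bSameSideE: szy.
  right; exists z' => //; exists y' => //; split.
    by split; [move/bSameSideE: szx | move=> e; apply: syx; apply/bSameSideE].
  split=> //; case: H => [np|[y2 y2t [yy2 [sy cy]]]].
    by left=> e; apply: np; apply/bPartnerE.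
  by right; exists y2 => //; split=> //; split; [move/bSameSideE: sy | move/bSameColE: cy].
case=> [[z' zt [y' yt [zy [szy Rzy]]]]|[z' zt [y' yt [[szx syx] [H HR]]]]].
  by left; exists z' => //; exists y' => //; split=> //; split=> //; apply/bSameSideE.
right; exists z' => //; exists y' => //; split.
  by split; [apply/bSameSideE | move/bSameSideE].
split=> //; case: H => [np|[y2 y2t [yy2 [sy cy]]]]; first by left=> /bPartnerE.
by right; exists y2 => //; split=> //; split; [apply/bSameSideE | apply/bSameColE].
Qed.

End AnnotatedFormulas.

(** * Queries through colours and queries through a matching *)

Section QueriesCorrect.
Variables (A : Type) (K : finType) (J : finType) (b : bt A) (s : pred addr).
Variables (kappa : addr -> K) (pi : addr -> option K) (mt : rel addr).
Variables (R : bpred A 'I_3 J) (V : J -> pred addr).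
Hypothesis mtP : matching b s kappa pi mt.
Hypothesis resp : respects R b s V kappa.
Local Notation N := (bnodes b).
Local Notation Rx := (fun x y z => R b (v3 x y z) V).

Lemma side_cases x y z : s y != s z -> s y = s x /\ ~ s z = s x \/ s z = s x /\ ~ s y = s x.
Proof. by case: (s x); case: (s y); case: (s z) => //; [left | right | right | left]. Qed.

(** From right to left, [y] is exchanged for the true partner of [z], which has its colour and its
    side; [respects] keeps [R] true. *)
Lemma sim_queryP x : x \in N ->
  (exists2 y, y \in N & exists2 z, z \in N & (y = z \/ mt y z) /\ Rx x y z) <->
  sim_query b s kappa pi Rx x.
Proof.
move=> xb; have [m1 m2 m3] := mtP; split.
  case=> y yb [z zb [[<-|yz] Ryz]]; first by left; exists y.
  have [syz py zy] := m1 y z yb zb yz; have [_ pz _] := m1 z y zb yb zy.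
  right; case: (side_cases x syz) => e; [exists y => //; exists z | exists z => //; exists y] => //.
    by split=> //; split=> //; left.
  by split=> //; split=> //; right.
case=> [[y yb Ry]|[z zb [y yb [[szx syx] [pz H]]]]]; first by exists y => //; exists y => //; split=> //; left.
have [q qb zq] := m3 z zb _ pz; have [szq pz' qz] := m1 z q zb qb zq.
have kq : kappa y = kappa q by move: pz'; rewrite pz => -[].
have sxy : s x != s y by apply/eqP => e; apply: syx.
have syq : s y = s q by move: szq sxy; rewrite szx; case: (s x); case: (s y); case: (s q).
have [r1 r2] := resp xb zb yb qb (esym szx) syq sxy kq.
case: H => [/r1 H|/r2 H]; [exists z => //; exists q => // | exists q => //; exists z => //].
  by split=> //; right.
by split=> //; right.
Qed.

(** If [y] happens to be the partner of [z], a second node of the same colour and side takes its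
    place: it is unmatched with [z], since partners are unique. *)
Lemma unsim_queryP x : x \in N ->
  (exists2 y, y \in N & exists2 z, z \in N & ~ (y = z \/ mt y z) /\ Rx x y z) <->
  unsim_query b s kappa pi Rx x.
Proof.
move=> xb; have [m1 m2 m3] := mtP; split.
  case=> y yb [z zb [nyz Ryz]].
  have [syz|syz] := eqVneq (s y) (s z).
    by left; exists y => //; exists z => //; split=> [e|]; [apply: nyz; left | split].
  have H u w : u \in N -> w \in N -> ~ mt u w -> s u != s w ->
      ~ pi u = Some (kappa w) \/ exists2 y', y' \in N & ~ w = y' /\ s w = s y' /\ kappa w = kappa y'.
    move=> ub wb nuw suw; case: (pselect (pi u = Some (kappa w))) => [pu|]; last by left.
    right; have [q qb uq] := m3 u ub _ pu; have [suq pu' qu] := m1 u q ub qb uq.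
    exists q => //; split; first by move=> e; apply: nuw; rewrite e.
    split; last by move: pu'; rewrite pu => -[].
    by move: suw suq; case: (s u); case: (s w); case: (s q).
  right; case: (side_cases x syz) => e.
    exists y => //; exists z => //; split=> //; split; last by left.
    by apply: H => // yz; apply: nyz; right.
  exists z => //; exists y => //; split=> //; split; last by right.
  apply: H => //; last by rewrite eq_sym.
  by move=> zy; apply: nyz; right; have [] := m1 z y zb yb zy.
case=> [[z zb [y yb [nzy [szy Rzy]]]]|[z zb [y yb [[szx syx] [H HR]]]]].
  exists z => //; exists y => //; split=> // -[//|zy].
  by have [] := m1 z y zb yb zy; rewrite szy eqxx.
have fin w : w \in N -> ~ s w = s x -> ~ mt z w -> Rx x z w \/ Rx x w z ->
    exists2 y, y \in N & exists2 z, z \in N & ~ (y = z \/ mt y z) /\ Rx x y z.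
  move=> wb swx nzw [Rzw|Rzw]; [exists z => //; exists w | exists w => //; exists z] => //; split=> //.
    by case=> // e; apply: swx; rewrite -e.
  case=> [e|wz]; first by apply: swx; rewrite e.
  by apply: nzw; have [] := m1 w z wb zb wz.
have [zy|nzy] := boolP (mt z y); last exact: (fin y yb syx (negP nzy) HR).
have [szy pz yz] := m1 z y zb yb zy.
case: H => [//|[q qb [yq [syq kq]]]].
have sxy : s x != s y by apply/eqP => e; apply: syx.
have [r1 r2] := resp xb zb yb qb (esym szx) syq sxy kq.
apply: (fin q) => //; first by rewrite -syq.
  by move=> zq; apply: yq; apply: m2 zy zq.
by case: HR => [/r1|/r2]; [left | right].
Qed.

End QueriesCorrect.

Section SmallAnnotated.
Variables (A : Type) (K : finType) (k0 : K).
Local Notation ann := (ann A K).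

Definition tmatching (t : bt ann) := matching (bmap (@base A K) t) (side t) (col k0 t) (pcol t).

Lemma bsum_mapi B C (w : C -> ssrint.int) (g : addr -> B -> C) (g' : B -> C) t :
  (forall p a, w (g p a) = w (g' a)) -> bsum w (bmapi g t) = bsum (fun a => w (g' a)) t.
Proof. by move=> gg; elim: t g gg => //= a l IHl r IHr g gg; rewrite gg IHl // IHr. Qed.

(** [Psi] does not mention the matching. The matching makes the group weights vanish, pumping keeps
    them zero together with the verdict on [Psi], and on the small tree vanishing weights yield a
    new matching, which need not be related to the old one. *)
Theorem small_annotated h (Psi : bpred ann void 'I_0) t mt v V : regular h Psi ->
    Psi t v V -> tmatching t mt ->
  exists t' mt', [/\ Psi t' v V, tmatching t' mt' & bsize t' <= pump_bound (tow h) (#|K| * #|K|)].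
Proof.
move=> [M hM MP] Pt mtt.
have vb (c : bt ann) : forall i : void, v i \in bnodes c by case.
pose w i (x : marked ann void 'I_0) := weight (nth (k0, k0) (enum {: K * K}) i) x.1.1.
have w_sum kl (c : bt ann) : bsum (fun x : marked ann void 'I_0 => weight kl x.1.1) (mark c v V) = bsum (weight kl) c.
  by rewrite /mark (@bsum_mapi _ _ _ _ (fun a => (a, [ffun=> false], [ffun=> false]))).
have sz : #|K| * #|K| = size (enum {: K * K}) by rewrite -cardE card_prod.
have [||c [rc wc zc]] := @pumping _ M (#|K| * #|K|) w (mark t v V).
- by move=> i x; apply: weight_bound.
- move=> i _; rewrite w_sum; case: (nth _ _ _) => k l.
  by rewrite (annotateE k0 t) bsum_weight (matching_group k l mtt) GRing.subrr.
pose t' := bmap (fun x => x.1.1) c.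
have cE : c = mark t' v V.
  apply: blabel_inj => p; rewrite /mark /t' !blabel_mapi; case: blabel => [[[a f] g]|] //=.
  by congr (Some (_, _, _)); apply/ffunP => -[].
have [mt' mt'P] : exists mt', tmatching t' mt'.
  apply: group_matching => k l.
  have kl : (index (k, l) (enum {: K * K}) < #|K| * #|K|) by rewrite sz index_mem mem_enum.
  have e := bsum_weight (bmap (@base A K) t') (side t') (col k0 t') (pcol t') k l.
  rewrite -annotateE in e; have := wc _ kl.
  by rewrite cE /w nth_index ?mem_enum // w_sum e => /GRing.subr0_eq [].
exists t', mt'; split=> //.
  by apply/(MP _ _ _ (vb t')); rewrite -cE rc; apply/(MP _ _ _ (vb t)).
rewrite bsize_mapi; apply: leq_trans zc _; exact: leq_pump_bound.
Qed.

End SmallAnnotated.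

(** * Data trees and annotated trees *)

Definition simulates A (D : data_tree A) (mt : rel addr) : Prop :=
  forall p q, p \in nodes D -> q \in nodes D -> dsim D p q <-> p = q \/ mt (0 :: p) (0 :: q).

Definition partial_matching (N s : pred addr) (mt : rel addr) : Prop :=
  {in N &, forall p q, mt p q -> s p != s q /\ mt q p} /\
  {in N & &, forall p q q', mt p q -> mt p q' -> q = q'}.

Lemma good_side_ext (N s s' : pred addr) : {in N, s =1 s'} -> good_side N s -> good_side N s'.
Proof.
move=> ss [s1 s2 s3]; split.
- by move=> p pN; rewrite -ss //; apply: s1.
- by move=> p q pN qN pq; rewrite -!ss //; apply: s2.
- by move=> p q p' q' pN qN p'N q'N; rewrite -!ss //; apply: s3.
Qed.

(** A class has at most one node on each side, so equivalence between distinct nodes is a partial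
    matching between the sides. *)
Lemma bipartite_partial_matching A (D : data_tree A) a l : dtree D = Node a (toF l) -> bipartite D ->
  exists s mt, [/\ good_side (bnodes (Nd a l Lf)) s, partial_matching (bnodes (Nd a l Lf)) s mt
    & simulates D mt].
Proof.
move=> Dt /bipartite_side[s [s1 s2 s3] sim].
have Db p : (p \in nodes D) = (0 :: p \in bnodes (Nd a l Lf)) by rewrite Dt nodes_root.
exists (fun q => s (behead q)), (fun p q => (p != q) && dsim D (behead p) (behead q)).
have eqD := dsim_equiv (d := D).
have sym p q : p \in nodes D -> q \in nodes D -> dsim D p q = dsim D q p.
  move=> pD qD; apply/idP/idP => pq.
    by have [_ /(_ pq) <-] := eqD p q p pD qD pD; have [] := eqD p p p pD pD pD.
  by have [_ /(_ pq) <-] := eqD q p q qD pD qD; have [] := eqD q q q qD qD qD.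
split.
- split.
  + move=> q qb; have [p def_q] := bnodes_root qb; subst q; rewrite -Db in qb.
    move=> /(s1 p qb)[r rD rp]; by exists (0 :: r); rewrite -?Db.
  + move=> p q pb qb; have [p' def_p] := bnodes_root pb; have [q' def_q] := bnodes_root qb; subst p q.
    by rewrite -!Db in pb qb; apply: (s2 p' q' pb qb).
  + move=> p q r u pb qb rb ub; have [p' def_p] := bnodes_root pb; have [q' def_q] := bnodes_root qb.
    have [r' def_r] := bnodes_root rb; have [u' def_u] := bnodes_root ub; subst p q r u.
    rewrite -!Db in pb qb rb ub => *; congr cons; exact: (s3 p' q' r' u').
- split=> [p q pb qb|p q r pb qb rb]; have [p' def_p] := bnodes_root pb; have [q' def_q] := bnodes_root qb; subst p q.
    rewrite -!Db in pb qb => /andP[npq pq]; split; last by rewrite eq_sym npq /= -sym.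
    by apply: contra npq => /eqP e; apply/eqP; congr cons; apply: (sim).
  have [r' def_r] := bnodes_root rb; subst r; rewrite -!Db in pb qb rb.
  move=> /andP[npq pq] /andP[npr pr]; congr cons; apply: (sim) => //.
    have np u : u \in nodes D -> 0 :: p' != 0 :: u -> dsim D p' u -> s p' != s u.
      by move=> uD npu pu; apply: contra npu => /eqP e; apply/eqP; congr cons; apply: (sim).
    by have := np _ qb npq pq; have := np _ rb npr pr; case: (s p'); case: (s q'); case: (s r').
  by have [_ /(_ pq) <-] := eqD p' q' r' pb qb rb.
- move=> p q pD qD; split=> [pq|[<-|/andP[]//]]; last by have [] := eqD p p p pD pD pD.
  by have [->|npq] := eqVneq p q; [left | right; rewrite /= pq andbT].
Qed.

Lemma partial_matching_matching A (K : finType) (b : bt A) s (kappa : addr -> K) mt :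
  partial_matching (bnodes b) s mt -> exists pi, matching b s kappa pi mt.
Proof.
move=> [m1 m2].
have partner p : exists o : option K, p \in bnodes b ->
    (forall q, q \in bnodes b -> mt p q -> o = Some (kappa q)) /\
    (forall k, o = Some k -> exists2 q, q \in bnodes b & mt p q).
  case: (pselect (exists2 q, q \in bnodes b & mt p q)) => [[q qb pq]|none].
    exists (Some (kappa q)) => pb; split=> [r rb pr|_ _]; last by exists q.
    by rewrite (m2 p q r).
  exists None => _; split=> // q qb pq; by case: none; exists q.
have [pi piP] := boolp.choice partner; exists pi; split=> //.
  by move=> p q pb qb pq; have [spq qp] := m1 p q pb qb pq; split=> //; apply: (piP p pb).1.
by move=> p pb k pk; apply: (piP p pb).2 pk.
Qed.

Lemma matching_ext A (K : finType) (b : bt A) s s' (kappa kappa' : addr -> K) pi pi' mt :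
    {in bnodes b, s =1 s'} -> {in bnodes b, kappa =1 kappa'} -> {in bnodes b, pi =1 pi'} ->
  matching b s kappa pi mt -> matching b s' kappa' pi' mt.
Proof.
move=> ss kk pp [m1 m2 m3]; split=> //.
  by move=> p q pb qb; rewrite -!ss // -kk // -pp //; apply: m1.
by move=> p pb k; rewrite -pp //; apply: m3.
Qed.

Lemma respects_ext A J (R : bpred A 'I_3 J) (K : eqType) b s s' V (kappa kappa' : addr -> K) :
    {in bnodes b, s =1 s'} -> {in bnodes b, kappa =1 kappa'} ->
  respects R b s V kappa -> respects R b s' V kappa'.
Proof. by move=> ss kk r x z y y' xb zb yb y'b; rewrite -!ss // -!kk //; apply: r. Qed.

(** A colour is a function that gathers the colours for all the relations [R i], so that one
    matching has to respect a single colouring only. *)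
Lemma annotation A (c h : nat) (R : 'I_c -> bpred A 'I_3 'I_0) b s mt V k0 :
    (forall i, regular h (R i)) -> good_side (bnodes b) s -> partial_matching (bnodes b) s mt ->
  exists t : bt (ann A {ffun 'I_c -> 'I_(tow (h + 5))}),
    [/\ bmap (@base _ _) t = b, good_side (bnodes t) (side t),
        forall i, respects (R i) b (side t) V (col k0 t) & tmatching k0 t mt].
Proof.
move=> rR gs pm.
have kex i : exists kappa : addr -> 'I_(tow (h + 5)), respects (R i) b s V kappa := colouring V (rR i) gs.
have [kap kapP] := fin_all_exists kex.
pose kappa p : {ffun 'I_c -> 'I_(tow (h + 5))} := [ffun i => kap i p].
have [pi piP] := partial_matching_matching kappa pm.
have sE : {in bnodes b, s =1 side (annotate b s kappa pi)} by move=> p pb; rewrite side_annotate.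
have kE : {in bnodes b, kappa =1 col k0 (annotate b s kappa pi)} by move=> p pb; rewrite col_annotate.
have pE : {in bnodes b, pi =1 pcol (annotate b s kappa pi)} by move=> p pb; rewrite pcol_annotate.
exists (annotate b s kappa pi); split.
- exact: bmap_annotate.
- have [g1 g2 g3] := good_side_ext sE gs.
  split.
  + by move=> p; rewrite bnodes_mapi => pb /(g1 p pb)[q qb qp]; exists q; rewrite ?bnodes_mapi.
  + by move=> p q; rewrite !bnodes_mapi; apply: g2.
  + by move=> p q p' q'; rewrite !bnodes_mapi; apply: g3.
- move=> i; apply: respects_ext sE kE _ => x z y y' xb zb yb y'b sxz syy sxy ky.
  apply: kapP => //; by move/ffunP/(_ i): ky; rewrite !ffunE.
- by rewrite /tmatching bmap_annotate; apply: matching_ext piP.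
Qed.

(** Being equal or matched is an equivalence: the matching is symmetric and partners are unique, so
    no class has more than two nodes. *)
Lemma data_tree_of A B (K : finType) k0 (g : A -> B) (x : ann A K) l mt :
    let t := Nd x l Lf in good_side (bnodes t) (side t) -> tmatching k0 t mt ->
  exists D : data_tree B,
    [/\ dtree D = Node (g (base x)) (toF (bmap (fun y => g (base y)) l)), bipartite D & simulates D mt].
Proof.
move=> t [s1 s2 s3] [m1 m2 m3].
pose T := Node (g (base x)) (toF (bmap (fun y => g (base y)) l)).
have Tb p : (p \in nodes T) = (0 :: p \in bnodes t).
  by rewrite nodes_root -(bnodes_mapi (fun _ y => g (base y)) t).
have Tb' p : p \in nodes T -> 0 :: p \in bnodes (bmap (@base A K) t) by rewrite Tb bnodes_mapi.
have equiv : {in nodes T & &, equivalence_rel (fun p q => (p == q) || mt (0 :: p) (0 :: q))}.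
  move=> p q r /Tb' pT /Tb' qT /Tb' rT; split=> [|pq]; first by rewrite eqxx.
  case/predU1P: pq => [-> //|pq]; have [_ _ qp] := m1 _ _ pT qT pq.
  apply/idP/idP => /predU1P[<-|].
  - by rewrite qp orbT.
  - by move=> pr; have [<-] := m2 _ _ _ pT qT rT pq pr; rewrite eqxx.
  - by rewrite pq orbT.
  - by move=> qr; have [<-] := m2 _ _ _ qT pT rT qp qr; rewrite eqxx.
exists (DataTree equiv); split=> //; last first.
  by move=> p q pT qT; split=> [/predU1P//|[->|pq]] /=; rewrite ?eqxx ?pq ?orbT.
apply: (@bipartite_of_side _ _ (fun p => side t (0 :: p))) => [|p q pT qT spq /predU1P[//|pq]]; last first.
  by have [] := m1 _ _ (Tb' _ pT) (Tb' _ qT) pq; rewrite spq eqxx.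
split.
- move=> p; rewrite [p \in _]Tb => pb /(s1 _ pb)[q qb qp].
  have [q' def_q] := bnodes_root qb; subst q; exists q' => //; by rewrite [_ \in _]Tb.
- by move=> p q; rewrite [p \in _]Tb [q \in _]Tb => pb qb pq; apply: s2.
- move=> p q p' q'; rewrite [p \in _]Tb [q \in _]Tb [p' \in _]Tb [q' \in _]Tb => pb qb p'b q'b pq pq' sp sq sp' sq'.
  by have [->] := s3 (0 :: p) (0 :: q) (0 :: p') (0 :: q') pb qb p'b q'b pq pq' sp sq sp' sq'.
Qed.

(** * Small models of queries *)

Lemma bnodes_mapiE A B (g : addr -> A -> B) b : bnodes (bmapi g b) = bnodes b.
Proof. by apply/funext => p; apply: bnodes_mapi. Qed.

Definition void_of_ord (i : 'I_0) : void. Proof. by case: i. Defined.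

Section Queries.
Variables (n c : nat).

(* A letter, and the truth at the node of the unary queries of code less than [c]. *)
Definition qlabel := ('I_n * {ffun 'I_c -> bool})%type.

Definition qletter (x : qlabel) : 'I_n := x.1.

Definition qholds (u : unary_query n) (x : qlabel) : bool :=
  oapp x.2 false (insub (code_unary u) : option 'I_c).

(** Inverts the coding by choice. Indexing queries by numbers below [c] gives a finite index set
    that contains all queries inside an instance of code at most [c]. *)
Definition query_of (i : nat) : option (unary_query n) :=
  if pselect (exists u : unary_query n, code_unary u = i) is left e then Some (projT1 (cid e)) else None.

Lemma query_of_code u : query_of (code_unary u) = Some u.
Proof.
rewrite /query_of; case: pselect => [e|]; last by case; exists u.
by congr Some; apply: (@code_unary_inj n); apply: (projT2 (cid e)).
Qed.

Definition ternary_of (i : nat) : bpred qlabel 'I_3 'I_0 :=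
  match query_of i with
  | Some (USim f) | Some (UNotSim f) => bsat qletter qholds f
  | _ => fun _ _ _ => False
  end.

Let K := {ffun 'I_c -> 'I_(tow (c + 5))}.
Local Notation ann := (ann qlabel K).
Variable k0 : K.

Definition query_at (i : nat) (t : bt ann) (p : addr) (V : 'I_0 -> pred addr) : Prop :=
  match query_of i with
  | Some (UMso f) => bsat qletter qholds f (bmap (@base _ _) t) (fun=> p) V
  | Some (USim _) => sim_query t (side t) (col k0 t) (pcol t)
        (fun x y z => ternary_of i (bmap (@base _ _) t) (v3 x y z) V) p
  | Some (UNotSim _) => unsim_query t (side t) (col k0 t) (pcol t)
        (fun x y z => ternary_of i (bmap (@base _ _) t) (v3 x y z) V) p
  | None => True
  end.

Lemma code_unary_gt (u : unary_query n) :
  match u with UMso f => code_mso (@code_unary n) f | USim f | UNotSim f => code_mso (@code_unary n) f end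
    < code_unary u.
Proof.
have H i m : m < CodeSeq.code [:: i; m].
  by apply: (lt_code _ (leqnn _)); rewrite !inE eqxx orbT.
by case: u => f; apply: H.
Qed.

Lemma query_of_some i u : query_of i = Some u -> code_unary u = i.
Proof. by rewrite /query_of; case: pselect => // e [<-]; apply: (projT2 (cid e)). Qed.

Lemma regular_ternary_of i : i <= c -> regular c (ternary_of i).
Proof.
move=> ic; rewrite /ternary_of; case q: (query_of i) => [[f|f|f]|].
1,4: exact: regular_const.
all: apply: regular_leq (regular_mso _ _ f); apply: leq_trans (mso_height_code (@code_unary n) f) _.
all: by apply: leq_trans ic; rewrite -(query_of_some q); apply: ltnW (code_unary_gt _).
Qed.

Local Notation isz := (info_size K).

Lemma regular_query_at i : i <= c ->
  regular (c + isz + 20) (fun t (v : option void -> addr) V => query_at i t (v None) V).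
Proof.
move=> ic; rewrite /query_at; case q: (query_of i) => [[f|f|f]|].
- apply: (regular_leq (h := c)); first lia.
  have := regular_map (@base qlabel K) (regular_mso qletter qholds f).
  move=> /(@regular_sub _ _ _ _ _ _ _ (fun _ : 'I_1 => None : option void) id).
  apply: regular_leq; apply: leq_trans (mso_height_code (@code_unary n) f) _.
  by apply: leq_trans ic; rewrite -(query_of_some q); apply: ltnW (code_unary_gt _).
- by apply: regular_sim_query; apply: regular_ternary_of.
- by apply: regular_unsim_query; apply: regular_ternary_of.
exact: regular_const.
Qed.

(* The conditions under which an annotated tree describes a data tree whose
   queries have the truth values in the labels. *)
Definition described (f : boolean_query n) : bpred ann void 'I_0 := fun t _ V =>
  [/\ single t, good_side (bnodes t) (side t),
      forall i : 'I_c, i \in enum 'I_c ->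
        respects (ternary_of i) (bmap (@base _ _) t) (side t) V (col k0 t),
      forall i : 'I_c, i \in enum 'I_c -> query_of i ->
        forall p, p \in bnodes t -> has_at (fun x : ann => (base x).2 i) t p <-> query_at i t p V
    & bsat qletter qholds f (bmap (@base _ _) t) (fun i : 'I_0 => [::]) V].

Definition query_height := (c + c + isz + 30)%N.

Lemma regular_described f : code_mso (@code_unary n) f <= c -> regular query_height (described f).
Proof.
move=> fc.
have r1 : regular (c + isz + 25 + c) (fun (t : bt ann) (_ : void -> addr) (V : 'I_0 -> pred addr) => forall i : 'I_c, i \in enum 'I_c ->
        respects (ternary_of i) (bmap (@base _ _) t) (side t) V (col k0 t)).
  have := @regular_all _ _ _ (c + isz + 25) _ (enum 'I_c).
  rewrite size_enum_ord; apply => i _; apply: (regular_leq (h := c + isz + 20)); first lia.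
  by apply: regular_respects; apply: regular_ternary_of; apply: ltnW.
have r2 : regular (c + isz + 25 + c) (fun (t : bt ann) (_ : void -> addr) (V : 'I_0 -> pred addr) => forall i : 'I_c, i \in enum 'I_c -> query_of i ->
        forall p, p \in bnodes t -> has_at (fun x : ann => (base x).2 i) t p <-> query_at i t p V).
  have := @regular_all _ _ _ (c + isz + 25) _ (enum 'I_c).
  rewrite size_enum_ord; apply => i _; apply: (regular_leq (h := (c + isz + 20).+2.+2.+1)); first lia.
  apply: regular_imp; first exact: regular_const.
  apply: (@regular_allnode _ _ _ _ (fun t v V => has_at (fun x : ann => (base x).2 i) t (v None) <-> query_at i t (v None) V)).
  apply: regular_iff; last by apply: regular_query_at; apply: ltnW.
  exact: (regular_label _ _ (fun x : ann => (base x).2 i)).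
have r3 : regular (c + isz + 25 + c) (fun (t : bt ann) (_ : void -> addr) (V : 'I_0 -> pred addr) =>
    bsat qletter qholds f (bmap (@base _ _) t) (fun i : 'I_0 => [::]) V).
  apply: (regular_leq (h := c)); first lia.
  have := regular_map (@base qlabel K) (regular_leq _ (regular_mso qletter qholds f)).
  move=> /(_ c (leq_trans (mso_height_code (@code_unary n) f) fc)).
  move=> /(@regular_sub _ _ _ _ _ _ _ void_of_ord id).
  by apply: regular_ext => t v V _; have -> : (fun i : 'I_0 => [::] : addr) = (fun i => v (void_of_ord i)) by apply/funext => -[].
have r4 : regular (c + isz + 25 + c) (fun (t : bt ann) (_ : void -> addr) (V : 'I_0 -> pred addr) => single t).
  by rewrite -(ltn_predK (m := 0) (n := c + isz + 25 + c)); [apply: regular_single | lia].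
have r5 : regular (c + isz + 25 + c) (fun (t : bt ann) (_ : void -> addr) (V : 'I_0 -> pred addr) => good_side (bnodes t) (side t)).
  by apply: (regular_leq (h := c + isz + 20)); [lia | apply: regular_good_side].
have := regular_and (regular_and (regular_and r4 r5) (regular_and r1 r2)) (regular_leq (k := (c + isz + 25 + c).+2) _ r3).
move=> H; apply: (regular_leq (h := (c + isz + 25 + c).+3)); first by rewrite /query_height; lia.
apply: regular_ext (H _) => [t v V _|]; last by lia.
by split=> [[[[? ?] [? ?]] ?]|[]].
Qed.

Lemma has_at_qholds (u : unary_query n) (lt : code_unary u < c) (t : bt ann) p :
  has_at (qholds u) (bmap (@base _ _) t) p <-> has_at (fun x : ann => (base x).2 (Ordinal lt)) t p.
Proof.
rewrite /has_at blabel_mapi /qholds insubT /=.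
case: blabel => [y|] /=; last by split=> -[].
by split=> [[_ [<-]]|[_ [<-]]] H; [exists y | exists (base y)].
Qed.

Section Correctness.
Variables (D : data_tree 'I_n) (x : ann) (l : bt ann) (mt : rel addr).
Let t := Nd x l Lf.
Let V0 (i : 'I_0) : pred addr := pred0.
Hypothesis Dt : dtree D = Node (qletter (base x)) (toF (bmap (fun y => qletter (base y)) l)).
Hypothesis simD : simulates D mt.
Hypothesis tm : tmatching k0 t mt.
Hypothesis resp : forall i : 'I_c, respects (ternary_of i) (bmap (@base _ _) t) (side t) V0 (col k0 t).

Lemma nodes_data p : (p \in nodes D) = (0 :: p \in bnodes (bmap (@base _ _) t)).
Proof. by rewrite Dt nodes_root [RHS]bnodes_mapi -(bnodes_mapi (fun _ y => qletter (base y)) t). Qed.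

Lemma bsat_data (N m : nat) (f : mso n (unary_query n) m 0) (v : m.-tuple addr) :
    (forall u p, code_unary u < N -> p \in nodes D ->
       selects D u p <-> has_at (qholds u) (bmap (@base _ _) t) (0 :: p)) ->
    code_mso (@code_unary n) f <= N -> (forall i, tnth v i \in nodes D) ->
  mso_sat D (selects D) f v [tuple] <->
  bsat qletter qholds f (bmap (@base _ _) t) (fun i => 0 :: tnth v i) V0.
Proof.
move=> H fN vD.
have Dt' : dtree D = Node (qletter (base x)) (toF (bmap qletter (bmap (@base _ _) l))).
  by rewrite Dt /bmap bmapi_comp.
have -> : V0 = (fun j => lift_set (tnth [tuple] j)) by apply/funext => -[].
exact: (bsat_mso Dt' H).
Qed.

Lemma ternary_data (f : mso n (unary_query n) 3 0) N p q r :
    (forall u p, code_unary u < N -> p \in nodes D ->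
       selects D u p <-> has_at (qholds u) (bmap (@base _ _) t) (0 :: p)) ->
    code_mso (@code_unary n) f <= N -> p \in nodes D -> q \in nodes D -> r \in nodes D ->
  mso_sat D (selects D) f [tuple p; q; r] [tuple] <->
  bsat qletter qholds f (bmap (@base _ _) t) (v3 (0 :: p) (0 :: q) (0 :: r)) V0.
Proof.
move=> H fN pD qD rD.
have -> : v3 (0 :: p) (0 :: q) (0 :: r) = (fun i => 0 :: tnth [tuple p; q; r] i).
  by apply/funext => -[[|[|[|]]]].
by apply: bsat_data H fN _ => -[[|[|[|]]]].
Qed.

Lemma ex_nodes (P : addr -> Prop) :
  (exists2 q, q \in bnodes (bmap (@base _ _) t) & P q) <-> (exists2 p, p \in nodes D & P (0 :: p)).
Proof.
split=> [[q qb]|[p pD Pp]]; last by exists (0 :: p); rewrite -?nodes_data.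
by have [p def_q] := bnodes_root qb; subst q => Pp; exists p; rewrite ?nodes_data.
Qed.

(** The induction step on codes: the answer for [u] depends only on annotated answers for queries of
    smaller code. *)
Lemma query_atP (u : unary_query n) p : code_unary u < c ->
    (forall w q, code_unary w < code_unary u -> q \in nodes D ->
       selects D w q <-> has_at (qholds w) (bmap (@base _ _) t) (0 :: q)) ->
    p \in nodes D ->
  selects D u p <-> query_at (code_unary u) t (0 :: p) V0.
Proof.
move=> uc IH pD; have lef := ltnW (code_unary_gt u).
have pb : 0 :: p \in bnodes (bmap (@base _ _) t) by rewrite -nodes_data.
have r := resp (Ordinal uc); rewrite /query_at.
move: r IH lef; rewrite /= /ternary_of query_of_code; case: u {uc} => f r IH lef.
- have -> : (fun=> 0 :: p) = (fun i : 'I_1 => 0 :: tnth [tuple p] i).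
    by apply/funext => i; rewrite (ord1 i).
  by apply: bsat_data IH lef _ => i; rewrite (ord1 i).
- have := sim_queryP tm r pb; rewrite /sim_query bnodes_mapiE => <-.
  rewrite -(bnodes_mapiE (fun=> @base _ _) t); apply: iff_trans (iff_sym (ex_nodes _)).
  split=> [[q [q' [qD q'D qq' sf]]]|[q qD /ex_nodes[q' q'D [qq' sf]]]].
    exists q => //; apply/ex_nodes; exists q' => //; split; last exact/(ternary_data IH lef).
    by move/(simD qD q'D): qq' => [->|]; [left | right].
  exists q, q'; split=> //; last exact/(ternary_data IH lef).
  by apply/(simD qD q'D); case: qq' => [[->]|]; [left | right].
- have := unsim_queryP tm r pb; rewrite /unsim_query bnodes_mapiE => <-.
  rewrite -(bnodes_mapiE (fun=> @base _ _) t); apply: iff_trans (iff_sym (ex_nodes _)).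
  split=> [[q [q' [qD q'D qq' sf]]]|[q qD /ex_nodes[q' q'D [qq' sf]]]].
    exists q => //; apply/ex_nodes; exists q' => //; split; last exact/(ternary_data IH lef).
    move=> H; move/negP: qq'; apply; apply/(simD qD q'D).
    by case: H => [[->]|]; [left | right].
  exists q, q'; split=> //; last exact/(ternary_data IH lef).
  by apply/negP => /(simD qD q'D) H; apply: qq'; case: H => [->|]; [left | right].
Qed.

(** Labels that satisfy the local equations with [query_at] are forced, by induction on codes, to be
    the true answers in the data tree. *)
Lemma described_correct (f : boolean_query n) v : described f t v V0 ->
  code_mso (@code_unary n) f <= c -> holds D f.
Proof.
move=> [_ _ _ bits sf] fc.
have qP N u p : code_unary u < N -> N <= c -> p \in nodes D ->
    selects D u p <-> has_at (qholds u) (bmap (@base _ _) t) (0 :: p).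
  elim: N u p => // N IHN u p uN Nc pD; have uc := leq_trans uN Nc.
  apply: (iff_trans (query_atP uc _ pD)) => [w q wu qD|].
    by apply: IHN => //; [apply: leq_trans wu _ | apply: ltnW].
  apply: iff_sym; apply: (iff_trans (has_at_qholds uc _ _)).
  apply: (bits (Ordinal uc)); rewrite ?mem_enum ?query_of_code //.
  by rewrite -(bnodes_mapiE (fun=> @base _ _)) -nodes_data.
apply/(bsat_data (N := c) _ fc) => [u p uc pD||]; first exact: (qP c).
  by case.
by have -> : (fun i : 'I_0 => 0 :: tnth ([tuple] : 0.-tuple addr) i) = (fun=> [::]) by apply/funext => -[].
Qed.

Lemma described_complete (f : boolean_query n) v :
    good_side (bnodes t) (side t) ->
    (forall (i : 'I_c) u p, query_of i = Some u -> p \in nodes D ->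
       selects D u p <-> has_at (fun x : ann => (base x).2 i) t (0 :: p)) ->
    code_mso (@code_unary n) f <= c -> holds D f ->
  described f t v V0.
Proof.
move=> gs bits fc hf.
have qP u p : code_unary u < c -> p \in nodes D ->
    selects D u p <-> has_at (qholds u) (bmap (@base _ _) t) (0 :: p).
  move=> uc pD; apply: iff_trans (iff_sym (has_at_qholds uc _ _)).
  by apply: bits; rewrite ?query_of_code.
split=> //; first by exists x, l.
  move=> i _ qi p pt; case q: (query_of i) qi => [u|] // _.
  have [p' def_p] := bnodes_root pt; subst p.
  have p'D : p' \in nodes D by rewrite nodes_data bnodes_mapiE.
  apply: (iff_trans (iff_sym (bits i u p' q p'D))).
  have ui := query_of_some q; have uc : code_unary u < c by rewrite ui.
  by rewrite -ui; apply: query_atP => // w r wu rD; apply: qP => //; apply: ltn_trans uc.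
have /(bsat_data (N := c) qP fc) : mso_sat D (selects D) f [tuple] [tuple] by [].
have -> : (fun i : 'I_0 => 0 :: tnth ([tuple] : 0.-tuple addr) i) = (fun=> [::]) by apply/funext => -[].
by apply; case.
Qed.

End Correctness.

Definition query_size := pump_bound (tow query_height) (#|K| * #|K|).

Theorem query_small (f : boolean_query n) (D : data_tree 'I_n) :
    code_mso (@code_unary n) f <= c -> bipartite D -> holds D f ->
  exists D' : data_tree 'I_n, [/\ bipartite D', holds D' f
    & exists2 al, dtree D' = Node al.1 (toF al.2) & bsize (Nd al.1 al.2 Lf) <= query_size].
Proof.
move=> fc bD hD.
have [a0 [l0 Dt]] : exists a l, dtree D = Node a (toF l).
  by case: (dtree D) => a ts; have [l <-] := toF_surj ts; exists a, l.
have [s [mt [gs pm sm]]] := bipartite_partial_matching Dt bD.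
pose b : bt qlabel := bmapi (fun q a => (a, [ffun i : 'I_c =>
   `[< exists2 u, query_of i = Some u & selects D u (behead q) >]])) (Nd a0 l0 Lf).
pose V0 (i : 'I_0) : pred addr := pred0.
have [|||t [bt_ gt rt mtt]] := @annotation _ c c (fun i => ternary_of i) b s mt V0 k0.
- by move=> i; apply: regular_ternary_of; apply: ltnW.
- by rewrite bnodes_mapiE.
- by rewrite bnodes_mapiE.
case: t bt_ gt rt mtt => [|x l r] // [bx bl br] gt rt mtt.
have r0 : r = Lf by case: r br {gt rt mtt}.
subst r.
have bE : bmap (@base _ _) (Nd x l Lf) = b by rewrite /b /= -bx /bmap /= -bl.
have Dt' : dtree D = Node (qletter (base x)) (toF (bmap (fun y => qletter (base y)) l)).
  rewrite Dt bx; congr (Node _ (toF _)).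
  have -> : bmap (fun y => qletter (base y)) l = bmap qletter (bmap (@base _ _) l).
    by rewrite /bmap bmapi_comp.
  by rewrite /bmap bl bmapi_comp; apply: blabel_inj => p; rewrite blabel_mapi; case: blabel.
have bits (i : 'I_c) u p : query_of i = Some u -> p \in nodes D ->
    selects D u p <-> has_at (fun y : ann => (base y).2 i) (Nd x l Lf) (0 :: p).
  move=> qi; rewrite Dt nodes_root => pb.
  have := congr1 (fun b => blabel b (0 :: p)) bE; rewrite /b !blabel_mapi /has_at.
  move: pb; rewrite inE; case: (blabel _ (0 :: p)) => // a _.
  case: blabel => // y [ey]; split=> [sp|[_ [<-]]].
    by exists y => //; rewrite ey ffunE; apply/asboolP; exists u.
  by rewrite ey ffunE => /asboolP[u']; rewrite qi => -[->].
rewrite -bE in rt; have dt := described_complete Dt' sm mtt rt (@of_void _) gt bits fc hD.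
have [t' [mt' [dt' mtt' zt']]] := small_annotated (regular_described fc) dt mtt.
have [[x' [l' t'E]] gs' rt' _ _] := dt'; subst t'.
have [D' [Dt1 bD' sD']] := data_tree_of qletter gs' mtt'.
exists D'; split=> //.
  by apply: (described_correct Dt1 sD' mtt' _ dt') => // i; apply: rt'; rewrite mem_enum.
exists (qletter (base x'), bmap (fun y => qletter (base y)) l') => //.
by move: zt'; rewrite /= bsize_mapi.
Qed.

End Queries.

(** * Small models of class automata *)

Lemma tensor_toF A B C (g : A -> B) (h : A -> C) a l :
  tensor (Node (g a) (toF (bmap g l))) (Node (h a) (toF (bmap h l))) =
  Node (g a, h a) (toF (bmap (fun x => (g x, h x)) l)).
Proof.
rewrite /=; congr Node; elim: l => //= x l IHl r IHr.
by rewrite -/(bmap g l) -/(bmap h l) IHl -/(bmap g r) -/(bmap h r) IHr.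
Qed.

Lemma tensor_set_toF A (a : A) l (X : pred addr) :
  tensor_set (Node a (toF l)) X = Node (a, X [::]) (toF (bmapi (fun p x => (x, X p)) l)).
Proof.
rewrite /=; congr Node.
(* The offset [0] makes the first child index explicit, to be generalised along [iota]. *)
have -> : bmapi (fun p x => (x, X p)) l =
    bmapi (fun p x => (x, if p is i :: p' then X ((0 + i) :: p') else X [::])) l.
  by apply: bmapi_eq => -[].
elim: l X 0 => //= x l IHl r IHr X i; congr cons.
  congr Node; first by rewrite addn0.
  rewrite (IHl (fun p => X (i :: p)) 0); congr toF.
  by apply: bmapi_eq => -[|j p]; rewrite ?bnodes_nil //= add0n addn0.
rewrite (IHr X i.+1); congr toF.
by apply: bmapi_eq => -[|j p]; rewrite ?bnodes_nil //= addnS addSn.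
Qed.

Lemma tree_pair A B (t : tree A) (s : tree B) : nodes t =i nodes s ->
  exists x (l : bt (A * B)), t = Node x.1 (toF (bmap fst l)) /\ s = Node x.2 (toF (bmap snd l)).
Proof.
case: t s => a ts [b ss]; have [l <-] := toF_surj ts; have [m <-] := toF_surj ss => nn.
exists (a, b), (bmapi (fun p x => (x, odflt b (blabel m p))) l); split.
  by rewrite /bmap bmapi_comp; congr (Node _ (toF _)); apply: blabel_inj => p; rewrite blabel_mapi; case: blabel.
rewrite /bmap bmapi_comp; congr (Node _ (toF _)); apply: blabel_inj => -[|i p]; first by rewrite !blabel_nil.
have := nn (i :: p); rewrite !nodes_root !bnodes0 !inE /= blabel_mapi.
by case: (blabel m _) => [y|]; case: (blabel l _).
Qed.

Section ClassAutomata.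
Variables (n k : nat) (f : transducer n k) (M : tree_automaton ('I_k * bool)%type) (c : nat).
Hypothesis fc : ta_height f <= c.
Hypothesis Mc : ta_height M <= c.

Let A := ('I_n * 'I_k)%type.

(* Acceptance by the class condition of the set formed by the last two nodes. *)
Definition pair_accepts : bpred A 'I_3 'I_0 := fun b v _ =>
  bta M (bmapi (fun p a => (a.2, (v (inord 1) == p) || (v (inord 2) == p))) b).

Lemma regular_pair_accepts : regular c pair_accepts.
Proof.
apply: regular_leq Mc _.
pose g (x : marked A 'I_3 'I_0) := (x.1.1.2, x.1.2 (inord 1) || x.1.2 (inord 2)).
have [N hN NP] := @regular_ta _ M _ 'I_0 'I_0 g.
have [N' hN' NP'] := run_map (fun x : marked A 'I_3 'I_0 => (x, [ffun i : 'I_0 => false], [ffun i : 'I_0 => false])) N.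
exists N' => [|b v V _]; first by rewrite hN'.
rewrite NP' /pair_accepts.
have := NP (mark b v V) (fun=> [::]) (fun=> pred0).
have -> : mark (mark b v V) (fun i : 'I_0 => [::]) (fun i : 'I_0 => pred0) =
    bmap (fun x : marked A 'I_3 'I_0 => (x, [ffun i : 'I_0 => false], [ffun i : 'I_0 => false])) (mark b v V).
  by apply: bmapi_eq => p _ a; congr (_, _, _); apply/ffunP => -[].
move=> <-; last by case.
suff -> : bmapi (fun p a => (a.2, (v (inord 1) == p) || (v (inord 2) == p))) b = bmap g (mark b v V) by [].
by rewrite /bmap /mark bmapi_comp; apply: bmapi_eq => p _ a; rewrite /g /= !ffunE.
Qed.

Let K := {ffun 'I_1 -> 'I_(tow (c + 5))}.
Local Notation ann := (ann A K).
Variable k0 : K.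
Local Notation isz := (info_size K).

(** The class of [x] consists of [x] and its partner, if any. Requiring acceptance for all [y] of
    the colour of the partner on the other side is no stronger than for the partner, because
    [pair_accepts] is respected by the colours. *)
Definition classes_accepted (t : bt ann) (V : 'I_0 -> pred addr) : Prop :=
  forall x, x \in bnodes t ->
    (pcol t x = None -> pair_accepts (bmap (@base _ _) t) (v3 x x x) V) /\
    (forall y, y \in bnodes t -> ~ side t y = side t x -> pcol t x = Some (col k0 t y) ->
       pair_accepts (bmap (@base _ _) t) (v3 x x y) V).

Definition accepted : bpred ann void 'I_0 := fun t _ V =>
  [/\ single t, good_side (bnodes t) (side t),
      respects pair_accepts (bmap (@base _ _) t) (side t) V (col k0 t),
      bta f (bmap (@base _ _) t) & classes_accepted t V].

Definition class_height := (c + isz + 30)%N.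

Lemma regular_accepted : regular class_height accepted.
Proof.
have r1 : regular (c + isz + 25) (fun (t : bt ann) (_ : void -> addr) (V : 'I_0 -> pred addr) => single t).
  by apply: (regular_leq (h := 1)); [lia | apply: regular_single].
have r2 : regular (c + isz + 25) (fun (t : bt ann) (_ : void -> addr) (V : 'I_0 -> pred addr) => good_side (bnodes t) (side t)).
  by apply: (regular_leq (h := c + isz + 20)); [lia | apply: regular_good_side].
have r3 : regular (c + isz + 25) (fun (t : bt ann) (_ : void -> addr) V => respects pair_accepts (bmap (@base _ _) t) (side t) V (col k0 t)).
  apply: (regular_leq (h := c + isz + 20)); first lia.
  exact: regular_respects regular_pair_accepts.
have r4 : regular (c + isz + 25) (fun (t : bt ann) (_ : void -> addr) (V : 'I_0 -> pred addr) => bta f (bmap (@base _ _) t)).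
  by apply: (regular_leq (h := ta_height f)); [lia | apply: regular_ta].
have r5 : regular (c + isz + 25) (fun (t : bt ann) (_ : void -> addr) V => classes_accepted t V).
  have := regular_map (@base A K) regular_pair_accepts; set R := (X in regular c X) => rR.
  pose x : option (option void) := Some None.
  have r : regular (c + isz + 25) (bAll (bAnd
     (bImp (bLabel (fun y : ann => y.2 == None) None) (bTernary R None None None))
     (bAll (bImp (bNot (bSameSide None x)) (bImp (bPartner k0 x None) (bTernary R x x None))))) : bpred ann void 'I_0).
    rewrite [_ + 25]addnC; regular_tac.
    all: try by apply: regular_leq rR; rewrite /isz; lia.
    all: try by apply: regular_leq (@regular_bSameSide _ _ _ 0 _ _ _); lia.
    by apply: regular_leq (@regular_bPartner _ _ _ _ 0 _ _ _); lia.
  have labE t y : y \in bnodes t -> has_at (fun y : ann => y.2 == None) t y <-> pcol t y = None.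
    rewrite inE /has_at /pcol; case: blabel => //= z _.
    by split=> [[_ [<-] /eqP]|zN] //; exists z => //; apply/eqP.
  apply: regular_ext r => t v V _; split=> H p pt; have [H1 H2] := H p pt; split.
  - by move=> /(labE _ _ pt); apply: H1.
  - move=> y yt syp pc; apply: (H2 y yt); last exact/bPartnerE.
    by move=> /bSameSideE e; apply: syp.
  - by move=> /(labE _ _ pt); apply: H1.
  - move=> y yt syp /bPartnerE; apply: (H2 y yt) => e; apply: syp; exact/bSameSideE.
have := regular_and (regular_and (regular_and r1 r2) (regular_and r3 r4)) (regular_leq (k := (c + isz + 25).+2) _ r5).
move=> H; apply: (regular_leq (h := (c + isz + 25).+3)); first by rewrite /class_height; lia.
apply: regular_ext (H _) => [t v V _|]; last by lia.
by split=> [[[[? ?] [? ?]] ?]|[]].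
Qed.

Section Correctness.
Variables (D : data_tree 'I_n) (x : ann) (l : bt ann) (mt : rel addr).
Let t := Nd x l Lf.
Let V0 (i : 'I_0) : pred addr := pred0.
Let s := Node (base x).2 (toF (bmap (fun y => (base y).2) l)).
Hypothesis Dt : dtree D = Node (base x).1 (toF (bmap (fun y => (base y).1) l)).
Hypothesis simD : simulates D mt.
Hypothesis tm : tmatching k0 t mt.

Let nodes_D p : (p \in nodes D) = (0 :: p \in bnodes t).
Proof. by rewrite Dt nodes_root -(bnodes_mapi (fun _ y => (base y).1) t). Qed.

Lemma nodes_work : nodes D =i nodes s.
Proof. by move=> p; rewrite nodes_D nodes_root -(bnodes_mapi (fun _ y => (base y).2) t). Qed.

Lemma transduces_bta : transduces f D s <-> bta f (bmap (@base _ _) t).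
Proof.
rewrite /transduces Dt /s (tensor_toF (fun y : ann => (base y).1) (fun y => (base y).2)).
have e (y : ann) : ((base y).1, (base y).2) = base y by case: (base y).
have -> : bmap (fun y : ann => ((base y).1, (base y).2)) l = bmap (@base _ _) l.
  by apply: bmapi_eq => p _ y; rewrite e.
by rewrite e -Dt; split=> [[]|] //; split=> //; apply: nodes_work.
Qed.

Lemma pair_acceptsE p q : p \in nodes D -> q \in nodes D ->
    (forall r, r \in nodes D -> dsim D p r <-> r = p \/ r = q) ->
  ta_accepts M (tensor_set s [pred y in nodes D | dsim D p y]) <->
  pair_accepts (bmap (@base _ _) t) (v3 (0 :: p) (0 :: p) (0 :: q)) V0.
Proof.
move=> pD qD pq; rewrite tensor_set_toF /pair_accepts /bta.
have v1 : v3 (0 :: p) (0 :: p) (0 :: q) (inord 1) = 0 :: p by rewrite /v3 inordK.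
have v2 : v3 (0 :: p) (0 :: p) (0 :: q) (inord 2) = 0 :: q by rewrite /v3 inordK.
rewrite v1 v2; set X := [pred y in nodes D | dsim D p y].
have E r : r \in nodes D -> X r = (0 :: p == 0 :: r) || (0 :: q == 0 :: r).
  move=> rD; rewrite /X /= rD /=; apply/idP/orP => [/(pq r rD)[->|->]|H]; rewrite ?eqxx; auto.
  by apply/(pq r rD); case: H => /eqP [->]; [left | right].
set G := fun r (a : A) => (a.2, (0 :: p == r) || (0 :: q == r)).
have -> : bmapi G (bmap (@base A K) t) =
    Nd (G [:: 0] (base x)) (bmapi (fun r => G (0 :: r)) (bmap (@base _ _) l)) Lf by [].
rewrite /G -E ?nodes_D ?bnodes0 // /bmap !bmapi_comp.
have -> : bmapi (fun r (y : ann) => ((base y).2, (0 :: p == 0 :: r) || (0 :: q == 0 :: r))) l =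
    bmapi (fun r (y : ann) => ((base y).2, X r)) l.
  by apply: bmapi_eq => r rl y; rewrite E // nodes_D bnodes0 rl orbT.
by [].
Qed.

Lemma partner_of p : p \in nodes D -> exists2 q, q \in nodes D &
  (forall r, r \in nodes D -> dsim D p r <-> r = p \/ r = q) /\
  (pcol t (0 :: p) = None /\ q = p \/ mt (0 :: p) (0 :: q)).
Proof.
have [m1 m2 m3] := tm; have nb r : (r \in nodes D) = (0 :: r \in bnodes (bmap (@base _ _) t)).
  by rewrite bnodes_mapi nodes_D.
move=> pD; case pp: (pcol t (0 :: p)) => [k'|]; last first.
  exists p => //; split; last by left.
  move=> r rD; split=> [/(simD pD rD)[->|pr]|]; [by left | | by case=> ->; apply/(simD pD pD); left].
  by have := pD; have := rD; rewrite !nb => rb pb; have [_] := m1 _ _ pb rb pr; rewrite pp.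
have := pD; rewrite nb => pb; have [q0 q0b pq] := m3 _ pb _ pp.
have q0b' := q0b; rewrite bnodes_mapi in q0b'; have [q def_q] := bnodes_root q0b'; subst q0.
have qD : q \in nodes D by rewrite nodes_D.
exists q => //; split; last by right.
move=> r rD; have rb := rD; rewrite nb in rb.
split=> [/(simD pD rD)[->|pr]|[->|->]]; [by left | | by apply/(simD pD pD); left | by apply/(simD pD qD); right].
by right; case: (m2 _ _ _ pb rb q0b pr pq).
Qed.

Lemma accepted_correct v : accepted t v V0 ->
  transduces f D s /\ {in nodes D, forall p, ta_accepts M (tensor_set s [pred y in nodes D | dsim D p y])}.
Proof.
move=> [_ _ _ ft ct]; split; first exact/transduces_bta.
move=> p pD; have [q qD [pq H]] := partner_of pD; apply/(pair_acceptsE pD qD pq).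
have pt := pD; have qt := qD; rewrite !nodes_D in pt qt; have [c1 c2] := ct _ pt.
case: H => [[pN ->]|mpq]; first exact: c1.
have [m1 _ _] := tm; have [||spq pc _] := m1 _ _ _ _ mpq; rewrite ?bnodes_mapi //.
by apply: c2 => // e; rewrite e eqxx in spq.
Qed.

Lemma accepted_complete v :
    good_side (bnodes t) (side t) -> respects pair_accepts (bmap (@base _ _) t) (side t) V0 (col k0 t) ->
    transduces f D s ->
    {in nodes D, forall p, ta_accepts M (tensor_set s [pred y in nodes D | dsim D p y])} ->
  accepted t v V0.
Proof.
move=> gs rt /transduces_bta ft ct; split=> //; first by exists x, l.
move=> p0 p0t; have [p def_p] := bnodes_root p0t; subst p0.
have pD : p \in nodes D by rewrite nodes_D.
have [q qD [pq H]] := partner_of pD.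
have /(pair_acceptsE pD qD pq) Rpq := ct p pD.
have [m1 _ _] := tm; have qt := qD; rewrite nodes_D in qt; split.
  case: H => [[_ e]|mpq] pN; first by rewrite e in Rpq.
  by have [||_] := m1 _ _ _ _ mpq; rewrite ?bnodes_mapi // pN.
move=> y yt syp py; case: H => [[pN _]|mpq]; first by rewrite pN in py.
have [||spq pc _] := m1 _ _ _ _ mpq; rewrite ?bnodes_mapi //.
have kq : col k0 t (0 :: q) = col k0 t y by move: pc; rewrite py => -[].
have sqy : side t (0 :: q) = side t y.
  by move: spq syp; case: (side t (0 :: p)); case: (side t (0 :: q)); case: (side t y).
have nb z : z \in bnodes t -> z \in bnodes (bmap (@base _ _) t) by rewrite bnodes_mapi.
by have [r _] := rt _ _ _ _ (nb _ p0t) (nb _ p0t) (nb _ qt) (nb _ yt) erefl sqy spq kq; apply: r.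
Qed.

End Correctness.

Definition class_size := pump_bound (tow class_height) (#|K| * #|K|).

Theorem class_small (D : data_tree 'I_n) (s : tree 'I_k) :
    bipartite D -> transduces f D s ->
    {in nodes D, forall p, ta_accepts M (tensor_set s [pred y in nodes D | dsim D p y])} ->
  exists (D' : data_tree 'I_n) (al : ('I_n * 'I_k) * bt ('I_n * 'I_k)),
    let s' := Node al.1.2 (toF (bmap snd al.2)) in
    [/\ bipartite D', transduces f D' s',
      {in nodes D', forall p, ta_accepts M (tensor_set s' [pred y in nodes D' | dsim D' p y])}
    & dtree D' = Node al.1.1 (toF (bmap fst al.2)) /\ bsize (Nd al.1 al.2 Lf) <= class_size].
Proof.
move=> bD fD cD; have [a0 [l0 [Dt st]]] := tree_pair fD.1.
have [s1 [mt [gs pm sm]]] := bipartite_partial_matching Dt bD.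
pose b := Nd a0 l0 Lf.
have nb : bnodes (Nd a0.1 (bmap fst l0) Lf) = bnodes b by rewrite -(bnodes_mapiE (fun=> fst) b).
rewrite nb in gs pm.
pose V0 (i : 'I_0) : pred addr := pred0.
have [|||t [bt_ gt rt mtt]] := @annotation _ 1 c (fun=> pair_accepts) b s1 mt V0 k0 => //.
  by move=> i; apply: regular_pair_accepts.
case: t bt_ gt rt mtt => [|x l r] // [bx bl br] gt rt mtt.
have r0 : r = Lf by case: r br {gt rt mtt}.
subst r.
have bE : bmap (@base _ _) (Nd x l Lf) = b by rewrite /b /= -bx /bmap /= -bl.
rewrite -bE in rt.
have Dt' : dtree D = Node (base x).1 (toF (bmap (fun y => (base y).1) l)).
  by rewrite Dt -bx -bl /bmap bmapi_comp.
have st' : s = Node (base x).2 (toF (bmap (fun y => (base y).2) l)).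
  by rewrite st -bx -bl /bmap bmapi_comp.
rewrite st' in fD cD.
have dt := accepted_complete Dt' sm mtt (@of_void _) gt (rt ord0) fD cD.
have [t' [mt' [dt' mtt' zt']]] := small_annotated regular_accepted dt mtt.
have [[x' [l' t'E]] gs' rt' _ _] := dt'; subst t'.
have [D' [Dt1 bD' sD']] := data_tree_of fst gs' mtt'.
have [fD' cD'] := accepted_correct Dt1 sD' mtt' dt'.
exists D', (base x', bmap (@base _ _) l').
have e1 : bmap fst (bmap (@base A K) l') = bmap (fun y => (base y).1) l' by rewrite /bmap bmapi_comp.
have e2 : bmap snd (bmap (@base A K) l') = bmap (fun y => (base y).2) l' by rewrite /bmap bmapi_comp.
rewrite /= e1 e2; split=> //; split=> //.
by move: zt'; rewrite /= bsize_mapi.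
Qed.

End ClassAutomata.

(** * Codes of data trees *)

(* Nodes are coded by their reversed addresses, which makes the code of the
   parent a component of that of the node. *)
Definition rcode (p : addr) : nat := CodeSeq.code (rev p).

Lemma rcode_rcons p i : rcode (rcons p i) = ccons i (rcode p).
Proof. by rewrite /rcode rev_rcons code_cons. Qed.

Lemma rcode_inj : injective rcode.
Proof. by move=> p q /code_inj /(can_inj revK). Qed.

Lemma rcodeK x : rcode (rev (lst x)) = x.
Proof. by rewrite /rcode revK code_lst. Qed.

(* A data tree is coded by the list of the triples formed by a node, its letter
   and its side, and the list of the pairs of equivalent nodes. *)
Definition entries z := lst (car z).
Definition eaddr e := car e.
Definition elab e := car (cdr e).
Definition eside e : bool := 0 < cdr (cdr e).
Definition addrs z := cmap eaddr (car z).
Definition sims z := lst (cdr z).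
Definition simz z p q : bool := (p == q) || (ccons p q \in sims z).

Definition valid_tree z : bool :=
  [&& has (fun e => eaddr e == 0) (entries z),
      all (fun e => (eaddr e == 0) || (cdr (eaddr e) \in lst (addrs z)) &&
             ((car (eaddr e) == 0) ||
              (ccons (car (eaddr e)).-1 (cdr (eaddr e)) \in lst (addrs z)))) (entries z)
    & all (fun e => all (fun e' => (eaddr e == eaddr e') ==> (e == e')) (entries z)) (entries z)].

Definition entry_point z e : bool :=
  eside e && has (fun e1 => [&& 0 < eaddr e, eaddr e1 == cdr (eaddr e) & ~~ eside e1]) (entries z).

Definition valid_side z : bool :=
  [&& all (fun e => (eaddr e == 0) ==> ~~ eside e) (entries z),
      all (fun e => all (fun e' => [&& 0 < eaddr e', cdr (eaddr e') == eaddr e & eside e]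
             ==> eside e') (entries z)) (entries z)
    & all (fun e => all (fun e' => entry_point z e && entry_point z e' ==> (eaddr e == eaddr e'))
             (entries z)) (entries z)].

Definition valid_sim z : bool :=
  [&& all (fun s => ccons (cdr s) (car s) \in sims z) (sims z),
      all (fun s => all (fun s' => (cdr s == car s') ==> simz z (car s) (cdr s')) (sims z)) (sims z)
    & all (fun s => all (fun e => all (fun e' =>
          [&& car s == eaddr e, cdr s == eaddr e' & eside e == eside e'] ==> (car s == cdr s))
             (entries z)) (entries z)) (sims z)].

Definition valid (ok : nat -> bool) z : bool :=
  [&& valid_tree z, all (fun e => ok (elab e)) (entries z), valid_side z & valid_sim z].

(** * Codes and the data trees they represent *)

Section Represents.
Variables (A : Type) (cA : A -> nat).
Hypothesis cA_inj : injective cA.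

Definition represents z (D : data_tree A) : Prop :=
  [/\ forall p, (p \in nodes D) = (rcode p \in lst (addrs z)),
      forall p a, label D p = Some a <->
        exists e, [/\ e \in entries z, eaddr e = rcode p & elab e = cA a]
    & {in nodes D &, forall p q, dsim D p q = simz z (rcode p) (rcode q)}].

Section Build.
Variables (dom : pred addr) (lab : addr -> A) (bound : nat).
Hypothesis dom_bound : forall p, dom p -> size p < bound /\ all (fun i => i < bound) p.
Hypothesis dom_rcons : forall p i, dom (rcons p i) -> dom p.
Hypothesis dom_pred : forall p i, dom (rcons p i.+1) -> dom (rcons p i).

(** [d] is fuel. As [dom] contains the earlier siblings of its elements, the number of children is
    the first index missing from it; [bound] exceeds all depths and indices. *)
Fixpoint build (d : nat) (p : addr) : tree A :=
  Node (lab p) (if d is d'.+1 then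
    [seq build d' (rcons p i) | i <- iota 0 (find (fun i => ~~ dom (rcons p i)) (iota 0 bound))] else [::]).

Lemma dom_cat p q : dom (p ++ q) -> dom p.
Proof.
elim/last_ind: q => [|q i IHq]; first by rewrite cats0.
by rewrite -rcons_cat => /dom_rcons.
Qed.

Lemma dom_le p i j : i <= j -> dom (rcons p j) -> dom (rcons p i).
Proof. by move=> /subnK <-; elim: (j - i) => // k IHk; rewrite addSn => /dom_pred. Qed.

Lemma label_build d p q : dom p -> bound <= size p + d ->
  label (build d p) q = if dom (p ++ q) then Some (lab (p ++ q)) else None.
Proof.
elim: d p q => [|d IHd] p [|i q] dp; rewrite ?cats0 ?dp //.
  by rewrite addn0 leqNgt (dom_bound dp).1.
move=> pd; set m := find (fun i => ~~ dom (rcons p i)) (iota 0 bound).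
have mP j : (j < m) = dom (rcons p j).
  have mb : m <= bound by rewrite -[X in _ <= X](size_iota 0); apply: find_size.
  apply/idP/idP => [jm|dj].
    have := before_find 0 jm; rewrite nth_iota ?add0n; last exact: leq_trans jm mb.
    by move/negbT; rewrite negbK.
  rewrite ltnNge; apply/negP => mj; have jb : j < bound.
    by have [_] := dom_bound dj; rewrite all_rcons => /andP[].
  have /(nth_find 0) : has (fun i => ~~ dom (rcons p i)) (iota 0 bound).
    by rewrite has_find -/m size_iota; apply: leq_ltn_trans mj jb.
  rewrite -/m nth_iota ?add0n; last exact: leq_ltn_trans mj jb.
  by rewrite (dom_le mj dj).
rewrite /label /= -/m -cat_rcons.
have -> : onth [seq build d (rcons p j) | j <- iota 0 m] i = if i < m then Some (build d (rcons p i)) else None.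
  case: ltnP => im; last by rewrite onth_default // size_map size_iota.
  by rewrite onthE -map_comp (nth_map 0) ?size_iota // nth_iota.
rewrite mP; case dpi: (dom (rcons p i)).
  by rewrite -/(label _ q) IHd // size_rcons addSnnS.
by case dq: (dom _) => //; move/dom_cat: dq; rewrite dpi.
Qed.

End Build.

Lemma mem_addrs z x : x \in lst (addrs z) -> exists2 e, e \in entries z & eaddr e = x.
Proof. by rewrite lst_code => /mapP[e ez ->]; exists e. Qed.

Lemma addrs_entry z e : e \in entries z -> eaddr e \in lst (addrs z).
Proof. by rewrite lst_code; apply: map_f. Qed.

Lemma valid_represents (ok : nat -> bool) z : (forall x, ok x -> exists a, cA a = x) ->
  valid ok z -> exists2 D : data_tree A, bipartite D & represents z D.
Proof.
move=> okA /and4P[/and3P[root closed funct] /allP labs /and3P[/allP side0 /allP side1 /allP side2]].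
move=> /and3P[/allP sym /allP trans /allP sim].
pose dom p := rcode p \in lst (addrs z).
have uniqE e e' : e \in entries z -> e' \in entries z -> eaddr e = eaddr e' -> e = e'.
  move=> ez e'z ee'; have /allP/(_ e ez)/allP/(_ e' e'z) := funct.
  by rewrite ee' eqxx => /eqP.
(* The code of a list exceeds its items and bounds its length, so an address is no longer than its
   code, and both its indices and its code are below the code of the list of addresses. *)
have dom_bound p : dom p -> size p < (addrs z).+1 /\ all (fun i => i < (addrs z).+1) p.
  rewrite /dom => dp; have pz : rcode p < addrs z.
    by have /allP/(_ _ dp) := CodeSeq.gtn_decode (addrs z).
  have rp : lst (rcode p) = rev p by rewrite /rcode lst_code.
  split; first by have := size_lst (rcode p); rewrite rp size_rev => H; apply: leq_trans H (ltnW pz).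
  apply/allP => i ip; have := CodeSeq.gtn_decode (rcode p).
  rewrite -/(lst _) rp => /allP/(_ i); rewrite mem_rev => /(_ ip) H.
  by apply: ltn_trans H (ltn_trans pz _).
have dom_closed p i : dom (rcons p i) -> dom p /\ (i = 0 \/ dom (rcons p i.-1)).
  rewrite /dom => /mem_addrs[e ez ep]; have /allP/(_ e ez) := closed.
  rewrite ep !rcode_rcons gtn_eqF ?cons_gt0 //= car_cons cdr_cons => /andP[-> /orP[/eqP|]]; auto.
have dom_rcons p i : dom (rcons p i) -> dom p by case/dom_closed.
have dom_pred p i : dom (rcons p i.+1) -> dom (rcons p i) by case/dom_closed=> _ [].
have [e0 e0z /eqP e00] := hasP root.
have [a0 _] := okA _ (labs _ e0z).
have labP p : exists a, dom p -> exists e, [/\ e \in entries z, eaddr e = rcode p & elab e = cA a].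
  case: (pselect (dom p)) => [dp|]; last by exists a0.
  have [e ez ep] := mem_addrs dp; have [a ae] := okA _ (labs _ ez).
  by exists a => _; exists e.
have [lab labE] := boolp.choice labP.
have dom0 : dom [::] by rewrite /dom -[rcode [::]]/0 -e00; apply: addrs_entry.
pose T := build dom lab (addrs z).+1 (addrs z).+1 [::].
have TE p : label T p = if dom p then Some (lab p) else None.
  by rewrite label_build // addn1 ltnW.
have nT p : (p \in nodes T) = dom p.
  by have := TE p; rewrite /label inE; case: subtree; case: (dom p).
pose sm p q := simz z (rcode p) (rcode q).
have smS x y : simz z x y -> simz z y x.
  by move=> /predU1P[->|/sym]; rewrite /simz ?eqxx // car_cons cdr_cons => ->; rewrite orbT.
have smT x y w : simz z x y -> simz z y w -> simz z x w.
  move=> /predU1P[-> //|xy] /predU1P[<-|yw]; first by rewrite /simz xy orbT.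
  have /allP/(_ _ yw) := trans _ xy; by rewrite !car_cons !cdr_cons eqxx.
have equiv : {in nodes T & &, equivalence_rel sm}.
  move=> p q r _ _ _; split=> [|pq]; first by rewrite /sm /simz eqxx.
  by apply/idP/idP => [/(smT _ _ _ (smS _ _ pq))|/(smT _ _ _ pq)].
exists (DataTree equiv); last first.
  split; [exact: nT | move=> p a | by []].
  rewrite [label _ _]TE; split.
    by case dp: (dom p) => // -[<-]; apply: labE.
  case=> e [ez ep ea]; have dp : dom p by rewrite /dom -ep; apply: addrs_entry.
  rewrite dp; have [e' [e'z e'p e'a]] := labE p dp; congr Some; apply: cA_inj.
  by rewrite -e'a -ea (uniqE e e') // ep.
pose s p := has (fun e => (eaddr e == rcode p) && eside e) (entries z).
have sE e p : e \in entries z -> eaddr e = rcode p -> s p = eside e.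
  move=> ez ep; apply/hasP/idP => [[e' e'z /andP[/eqP e'p se']]|se]; last by exists e; rewrite ?ep ?eqxx.
  by rewrite (uniqE e e') // ep.
apply: (@bipartite_of_side _ _ s) => /=; last first.
  move=> p q; rewrite !nT => dp dq spq /predU1P[/rcode_inj //|pq].
  have [e ez ep] := mem_addrs dp; have [e' e'z eq] := mem_addrs dq.
  have /allP/(_ e ez)/allP/(_ e' e'z) := sim _ pq.
  by rewrite car_cons cdr_cons ep eq !eqxx -(sE e p) // -(sE e' q) // spq eqxx => /eqP/rcode_inj.
split.
- move=> p; rewrite nT => dp; have [e ez ep] := mem_addrs dp; rewrite (sE e) // => se.
  case/lastP: p dp ep => [|p i] dp ep.
    by have := side0 _ ez; rewrite ep -[rcode [::]]/0 eqxx se.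
  by exists p; [rewrite nT; apply: dom_rcons dp | apply/childP; exists i].
- move=> p q; rewrite !nT => dp dq /childP[i qp].
  have [e ez ep] := mem_addrs dp; have [e' e'z eq] := mem_addrs dq.
  rewrite (sE e) // (sE e') // => se; have /allP/(_ e' e'z) := side1 e ez.
  by rewrite eq ep qp rcode_rcons cons_gt0 cdr_cons eqxx se.
move=> p q p' q'; rewrite !nT => dp dq dp' dq' /childP[i qp] /childP[i' qp'] sp sq sp' sq'.
have ept r j : dom r -> dom (rcons r j) -> ~~ s r -> s (rcons r j) -> exists e,
    [/\ e \in entries z, eaddr e = rcode (rcons r j) & entry_point z e].
  move=> dr drj sr srj; have [e ez er] := mem_addrs dr; have [e' e'z e'r] := mem_addrs drj.
  exists e'; split=> //; rewrite /entry_point -(sE e' _ e'z e'r) srj /=; apply/hasP; exists e => //.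
  by rewrite e'r er rcode_rcons cons_gt0 cdr_cons eqxx -(sE e r).
rewrite qp in dq sq *; rewrite qp' in dq' sq' *.
have [e [ez eq epe]] := ept p i dp dq sp sq; have [e' [e'z eq' epe']] := ept p' i' dp' dq' sp' sq'.
have /allP/(_ e' e'z) := side2 e ez.
by rewrite epe epe' eq eq' => /eqP/rcode_inj.
Qed.

End Represents.

Definition list_bound m k := iter k (ccons m) 0.

Lemma leq_cons a b c d : a <= c -> b <= d -> ccons a b <= ccons c d.
Proof. by move=> ac bd; rewrite leq_mul // ?leq_exp2l // ltnS leq_double. Qed.

Lemma leq_list_bound m k s : size s <= k -> all (fun x => x <= m) s -> CodeSeq.code s <= list_bound m k.
Proof.
elim: k s => [|k IHk] [|x s] //= sk /andP[xm sm].
by apply: leq_cons => //; apply: IHk.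
Qed.

Lemma bnodes_bound A (b : bt A) p : p \in bnodes b -> size p <= bsize b /\ all (fun i => i <= bsize b) p.
Proof.
elim: b p => [|a l IHl r IHr] p; first by case: p.
move=> pb; have [->|[q ql ->]|[q qr ->]] := bnodesP pb => //=.
  have [sq aq] := IHl q ql; split; first lia.
  by apply: sub_all aq => i; lia.
have [sq aq] := IHr q qr; case: q {qr} sq aq => //= i q sq /andP[iq aq]; split; first lia.
rewrite (leq_ltn_trans iq) /=; last lia.
by apply: sub_all aq => j; lia.
Qed.

Lemma nodes_pred A (t : tree A) p i : rcons p i.+1 \in nodes t -> rcons p i \in nodes t.
Proof.
have root_child (u : tree A) j : ([:: j] \in nodes u) = (j < size (children u)).
  by rewrite inE /= -onthTE; case: onth.
elim: p t => [|j p IHp] t; first by rewrite !root_child => /ltnW.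
by rewrite !inE /=; case: onth => // u; apply: IHp.
Qed.

(* Bounds the code of a data tree with at most [m] nodes and letters coded up to [k]. *)
Definition tree_bound m k :=
  let a := list_bound m m in
  ccons (list_bound (ccons a (ccons k 1)) m) (list_bound (ccons a a) (m * m)).

Lemma represents_valid A (cA : A -> nat) (ok : nat -> bool) (D : data_tree A) a l m k :
    injective cA -> (forall x, ok (cA x)) -> (forall x, cA x <= k) ->
    dtree D = Node a (toF l) -> bsize (Nd a l Lf) <= m -> bipartite D ->
  exists z, [/\ valid ok z, represents cA z D & z <= tree_bound m k].
Proof.
move=> cA_inj okA cAk Dt bm /bipartite_side[s [s1 s2 s3] sim].
have Db p : (p \in nodes D) = (0 :: p \in bnodes (Nd a l Lf)) by rewrite Dt nodes_root.
have [ns nsE sns] : exists2 ns, ns =i nodes D & size ns <= m.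
  exists [seq behead q | q <- bnodes_seq (Nd a l Lf)]; last by rewrite size_map size_bnodes_seq.
  move=> p; rewrite Db; apply/mapP/idP => [[q]|pb]; last by exists (0 :: p); rewrite ?mem_bnodes_seq.
  by rewrite mem_bnodes_seq => qb ->; have [q' e] := bnodes_root qb; subst q.
pose lab p := odflt a (label D p).
have labE p : p \in nodes D -> label D p = Some (lab p).
  by rewrite inE /lab /label; case: subtree.
pose ent p := ccons (rcode p) (ccons (cA (lab p)) (s p)).
pose ps := [seq pq <- [seq (p, q) | p <- ns, q <- ns] | dsim D pq.1 pq.2].
pose pr (pq : addr * addr) := ccons (rcode pq.1) (rcode pq.2).
pose z := ccons (CodeSeq.code (map ent ns)) (CodeSeq.code (map pr ps)).
have entE : entries z = map ent ns by rewrite /entries car_cons lst_code.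
have simE : sims z = map pr ps by rewrite /sims cdr_cons lst_code.
have entP e : e \in entries z -> exists2 p, p \in nodes D &
    [/\ e = ent p, eaddr e = rcode p, elab e = cA (lab p) & eside e = s p].
  rewrite entE => /mapP[p]; rewrite nsE => pD ->; exists p => //.
  by rewrite /eaddr /elab /eside /ent !(car_cons, cdr_cons) lt0b.
have addE p : (rcode p \in lst (addrs z)) = (p \in nodes D).
  rewrite lst_code; apply/mapP/idP => [[e /entP[q qD [_ -> _ _]] /rcode_inj ->] //|pD].
  exists (ent p); last by rewrite /eaddr car_cons.
  by rewrite -/(entries z) entE map_f // nsE.
have prE p q : (ccons (rcode p) (rcode q) \in sims z) = [&& p \in nodes D, q \in nodes D & dsim D p q].
  rewrite simE; apply/mapP/idP => [[[p' q']]|/and3P[pD qD pq]].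
    rewrite mem_filter => /andP[/= pq /allpairsPdep[u [v [un vn [e1 e2]]]]]; subst u v.
    by rewrite !nsE in un vn => /cons_inj[/rcode_inj -> /rcode_inj ->]; rewrite un vn.
  exists (p, q) => //; rewrite mem_filter pq /=; apply/allpairsPdep; exists p, q.
  by rewrite !nsE.
have eqD := dsim_equiv (d := D).
have refl p : p \in nodes D -> dsim D p p by move=> pD; have [] := eqD p p p pD pD pD.
have trans p q r : p \in nodes D -> q \in nodes D -> r \in nodes D -> dsim D p q -> dsim D p r = dsim D q r.
  by move=> pD qD rD; have [_] := eqD p q r pD qD rD.
have sym p q : p \in nodes D -> q \in nodes D -> dsim D p q -> dsim D q p.
  by move=> pD qD pq; rewrite -(trans p q p) ?refl.
have simzE p q : p \in nodes D -> q \in nodes D -> simz z (rcode p) (rcode q) = dsim D p q.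
  move=> pD qD; rewrite /simz prE pD qD /=; case: eqP => [/rcode_inj ->|//].
  by rewrite refl.
have simsP x : x \in sims z -> exists p q, [/\ x = ccons (rcode p) (rcode q), p \in nodes D, q \in nodes D & dsim D p q].
  rewrite simE => /mapP[[p q] pq ->]; exists p, q.
  by have := map_f pr pq; rewrite -simE prE => /and3P[].
exists z; split.
- apply/and4P; split.
  + apply/and3P; split.
    * apply/hasP; exists (ent [::]); last by rewrite /eaddr car_cons.
      by rewrite entE map_f // nsE nodes_nil.
    * apply/allP => e /entP[p pD [_ -> _ _]]; case/lastP: p pD => [|p i] pD; first by [].
      rewrite rcode_rcons car_cons cdr_cons addE (nodes_rcons pD) orbC.
      case: i pD => [|i] pD /=; rewrite ?orbT // -rcode_rcons addE.
      suff -> : rcons p i \in nodes D by [].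
      exact: nodes_pred pD.
    * apply/allP => e /entP[p pD [-> -> _ _]]; apply/allP => e' /entP[q qD [-> -> _ _]].
      by apply/implyP => /eqP/rcode_inj ->.
  + by apply/allP => e /entP[p pD [_ _ -> _]].
  + apply/and3P; split.
    * apply/allP => e /entP[p pD [_ -> _ ->]]; apply/implyP => p0; apply/negP => /(s1 p pD)[q qD /childP[i pq]].
      by move: p0; rewrite pq rcode_rcons gtn_eqF ?cons_gt0.
    * apply/allP => e /entP[p pD [_ -> _ ->]]; apply/allP => e' /entP[q qD [_ -> _ ->]].
      apply/implyP => /and3P[]; case/lastP: q qD => [//|q i] qD _.
      by rewrite rcode_rcons cdr_cons => /eqP/rcode_inj qp; subst q; apply: s2 => //; apply/childP; exists i.
    * have ept e : e \in entries z -> entry_point z e -> exists p q,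
          [/\ p \in nodes D, q \in nodes D & child p q] /\ [/\ eaddr e = rcode q, ~~ s p & s q].
        move=> /entP[q qD [_ eq _ sq]]; rewrite /entry_point sq => /andP[sq' /hasP[e1 /entP[p pD [_ -> _ ->]]]].
        rewrite eq => /and3P[q0 /eqP pq sp]; exists p, q; split; split=> //.
        case/lastP: q q0 pq {qD eq sq sq'} => // q i _; rewrite rcode_rcons cdr_cons => /rcode_inj ->.
        by apply/childP; exists i.
      apply/allP => e ez; apply/allP => e' e'z; apply/implyP => /andP[].
      move=> /(ept e ez)[p [q [[pD qD pq] [-> sp sq]]]] /(ept e' e'z)[p' [q' [[p'D q'D pq'] [-> sp' sq']]]].
      by rewrite (s3 p q p' q').
  + apply/and3P; split.
    * apply/allP => x /simsP[p [q [-> pD qD pq]]].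
      by rewrite car_cons cdr_cons prE pD qD sym.
    * apply/allP => x /simsP[p [q [-> pD qD pq]]]; apply/allP => y /simsP[q' [r [-> q'D rD qr]]].
      rewrite !(car_cons, cdr_cons); apply/implyP => /eqP/rcode_inj e; subst q'.
      by rewrite simzE // (trans p q).
    * apply/allP => x /simsP[p [q [-> pD qD pq]]].
      apply/allP => e /entP[p' p'D [_ -> _ ->]]; apply/allP => e' /entP[q' q'D [_ -> _ ->]].
      rewrite !(car_cons, cdr_cons); apply/implyP => /and3P[/eqP/rcode_inj e1 /eqP/rcode_inj e2 /eqP spq]; subst p' q'.
      by apply/eqP; congr rcode; apply: (sim).
- split=> [p|p a'|p q pD qD]; first by rewrite addE.
    split=> [pa|[e [/entP[q qD [_ -> -> _]] /rcode_inj <- /cA_inj <-]]]; last exact: labE.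
    have pD : p \in nodes D by move: pa; rewrite inE /label; case: subtree.
    exists (ent p); split; first by rewrite entE; apply: map_f; rewrite nsE.
      by rewrite /eaddr car_cons.
    by rewrite /elab cdr_cons car_cons; move: pa; rewrite labE // => -[->].
  by rewrite simzE.
have rb p : p \in nodes D -> rcode p <= list_bound m m.
  rewrite Db => /bnodes_bound[sp ap]; apply: leq_list_bound.
    by rewrite size_rev; apply: leq_trans (ltnW sp) bm.
  rewrite all_rev; case/andP: ap => _; apply: sub_all => i ib; exact: leq_trans ib bm.
apply: leq_cons; apply: leq_list_bound.
- by rewrite size_map.
- apply/allP => e; rewrite -entE => /entP[p pD [-> _ _ _]].
  by apply: leq_cons; [apply: rb | apply: leq_cons => //; case: (s p)].
- rewrite size_map; apply: (@leq_trans (size ns * size ns)); last exact: leq_mul.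
  by rewrite -(size_allpairs pair ns ns) size_filter; apply: count_size.
apply/allP => x; rewrite -simE => /simsP[p [q [-> pD qD _]]].
by apply: leq_cons; apply: rb.
Qed.

(** * Evaluation of programs *)

Section Evaluation.
Variable step : nat -> nat.
Local Notation ev := (evaluates step).

Lemma evaluates_has (T : eqType) x (F : T -> nat) (G : T -> bool) (ys : seq T) :
    step x = ccons 0 (CodeSeq.code [seq F y | y <- ys]) -> {in ys, forall y, ev (F y) (G y)} ->
  ev x (has G ys).
Proof.
move=> xE H; have [/hasP[y yys Gy]|/hasPn nG] := boolP (has G ys).
  have := @Evaluates_has step x (F y); rewrite xE car_cons cdr_cons lst_code.
  by apply; [apply: map_f | have := H y yys; rewrite Gy].
have := @Evaluates_all step x; rewrite xE car_cons cdr_cons lst_code; apply => _ /mapP[y yys ->].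
by have := H y yys; rewrite (negPf (nG y yys)).
Qed.

Lemma evaluates_nor (T : eqType) x (F : T -> nat) (G : T -> bool) (ys : seq T) :
    step x = ccons 1 (CodeSeq.code [seq F y | y <- ys]) -> {in ys, forall y, ev (F y) (G y)} ->
  ev x (~~ has G ys).
Proof.
move=> xE H; have [/hasP[y yys Gy]|/hasPn nG] := boolP (has G ys).
  have := @Evaluates_has step x (F y); rewrite xE car_cons cdr_cons lst_code.
  by apply; [apply: map_f | have := H y yys; rewrite Gy].
have := @Evaluates_all step x; rewrite xE car_cons cdr_cons lst_code; apply => _ /mapP[y yys ->].
by have := H y yys; rewrite (negPf (nG y yys)).
Qed.

Lemma evaluates_all (T : eqType) x (F : T -> nat) (G : T -> bool) (ys : seq T) :
    step x = ccons 2 (CodeSeq.code [seq F y | y <- ys]) -> {in ys, forall y, ev (F y) (G y)} ->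
  ev x (all G ys).
Proof.
move=> xE H; have [/allP aG|/allPn[y yys nGy]] := boolP (all G ys).
  have := @Evaluates_all step x; rewrite xE car_cons cdr_cons lst_code; apply => _ /mapP[y yys ->].
  by have := H y yys; rewrite (aG y yys).
have := @Evaluates_has step x (F y); rewrite xE car_cons cdr_cons lst_code.
by apply; [apply: map_f | have := H y yys; rewrite (negPf nGy)].
Qed.

Definition atom (b : bool) : nat := ccons (if b then 2 else 0) 0.

Lemma evaluates_atom x b : step x = atom b -> ev x b.
Proof.
move=> xE; case: b xE => xE.
  exact: (@evaluates_all bool x (fun=> 0) id [::]).
exact: (@evaluates_has bool x (fun=> 0) id [::]).
Qed.

End Evaluation.

(** * Computability of the bounds and of validity *)

Lemma comp_tow f : comp1 f -> comp1 (fun x => tow (f x)).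
Proof.
move=> cf; apply: (comp1_ext (f := fun x => iter (f x) (expn 2) 2)) => [x|]; last by comp_tac.
by elim: (f x) => //= h ->.
Qed.

Lemma comp_block_bound f g : comp1 f -> comp1 g -> comp1 (fun x => block_bound (f x) (g x)).
Proof.
move=> cf cg.
apply: (comp1_ext (f := fun x => iter (f x) (fun y => y * (2 * (y * g x)).+1) 1)) => [x|].
  by elim: (f x) => //= d ->; rewrite mul2n.
comp_tac; exact: comp1_comp cg (comp_car comp_id).
Qed.

Lemma comp_pump_bound f g : comp1 f -> comp1 g -> comp1 (fun x => pump_bound (f x) (g x)).
Proof.
move=> cf cg; rewrite /pump_bound.
have cS : comp1 (fun x => 2 ^ (f x * 2 ^ f x)) by comp_tac.
by comp_tac; apply: comp_block_bound.
Qed.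

Lemma comp_list_bound f g : comp1 f -> comp1 g -> comp1 (fun x => list_bound (f x) (g x)).
Proof.
move=> cf cg; rewrite /list_bound; comp_tac.
by apply: comp1_comp cf (comp_car comp_id).
Qed.

Lemma comp_tree_bound f g : comp1 f -> comp1 g -> comp1 (fun x => tree_bound (f x) (g x)).
Proof.
move=> cf cg; rewrite /tree_bound.
by repeat first [apply: comp_list_bound | comp_step].
Qed.

Lemma comp_simz f g h : comp1 f -> comp1 g -> comp1 h -> comp1 (fun x => simz (f x) (g x) (h x)).
Proof. by move=> cf cg ch; rewrite /simz /sims; comp_tac. Qed.

Lemma comp_addrs f : comp1 f -> comp1 (fun x => addrs (f x)).
Proof. by move=> cf; rewrite /addrs /eaddr; comp_tac. Qed.

Lemma comp_valid (ok : nat -> nat -> bool) g : comp1 (fun x => ok (car x) (cdr x)) -> comp1 g ->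
  comp1 (fun x => valid (ok x) (g x)).
Proof.
move=> cok cg; apply: (@comp_app2 (fun x z => valid (ok x) z) (fun x => x) g) => //; last exact: comp_id.
 rewrite /valid /valid_tree /valid_side /valid_sim /entry_point /entries /sims /simz /sims /addrs /eaddr /elab /eside.
comp_tac.
have := @comp_app2 ok (fun x => car (car x)) (fun x => car (cdr (cdr x))) cok.
by apply; comp_tac.
Qed.

(** * Satisfiability of queries *)

#[local] Opaque CodeSeq.code.

(** All sublists: every set of nodes is the set of members of one of them. *)
Definition csubsets l := foldr (fun e s => ccat s (cmap (ccons e) s)) (ccons 0 0) (lst l).

Lemma csubsets_filter (P : pred nat) l : CodeSeq.code (filter P (lst l)) \in lst (csubsets l).
Proof.
rewrite /csubsets; elim: (lst l) => [|e s IHs]; first by rewrite lst_cons mem_head.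
rewrite [foldr _ _ _]/= /ccat lst_code mem_cat; rewrite [filter _ _]/=.
case: (P e); last by rewrite IHs.
by rewrite /cmap lst_code; apply/orP; right; rewrite code_cons map_f.
Qed.

Lemma cnth_code s i : cnth (CodeSeq.code s) i = nth 0 s i.
Proof. by rewrite /cnth lst_code. Qed.

Lemma cnth_cons0 a b : cnth (ccons a b) 0 = a.
Proof. by rewrite /cnth lst_cons. Qed.

Lemma cnth_consS a b i : cnth (ccons a b) i.+1 = cnth b i.
Proof. by rewrite /cnth lst_cons. Qed.

(* The calls are [sat_call], the truth of a formula, [sel_call], the truth of a
   unary query at a node, and, with the code [x] of an instance, [ccons 0 x]. *)
Definition sat_call z f v V := ccons 1 (ccons z (ccons f (ccons v V))).
Definition sel_call z u p := ccons 2 (ccons z (ccons u p)).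

Definition sat_step z f v V : nat :=
  let x1 := cnth v (cnth f 1) in let x2 := cnth v (cnth f 2) in
  if cnth f 0 == 0 then atom (has (fun e => (eaddr e == x2) && (elab e == cnth f 1)) (entries z))
  else if cnth f 0 == 1 then atom (x1 == x2)
  else if cnth f 0 == 2 then atom ((0 < x2) && (cdr x2 == x1))
  else if cnth f 0 == 3 then
    atom [&& 0 < x1, 0 < x2, cdr x2 == cdr x1 & car x2 == (car x1).+1]
  else if cnth f 0 == 4 then atom (x1 \in lst (cnth V (cnth f 2)))
  else if cnth f 0 == 5 then ccons 0 (ccons (sel_call z (cnth f 1) x2) 0)
  else if cnth f 0 == 6 then ccons 1 (ccons (sat_call z (cnth f 1) v V) 0)
  else if cnth f 0 == 7 then
    ccons 2 (ccons (sat_call z (cnth f 1) v V) (ccons (sat_call z (cnth f 2) v V) 0))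
  else if cnth f 0 == 8 then
    ccons 0 (cmap (fun p => sat_call z (cnth f 1) (ccons p v) V) (addrs z))
  else ccons 0 (cmap (fun X => sat_call z (cnth f 1) v (ccons X V)) (csubsets (addrs z))).

(** The tag is 0 for [UMso], 1 for [USim] and 2 for [UNotSim]; the filter keeps the pairs that are
    equivalent exactly when the tag is 1. *)
Definition sel_step z u p : nat :=
  if cnth u 0 == 0 then ccons 0 (ccons (sat_call z (cnth u 1) (ccons p 0) 0) 0)
  else ccons 0 (cflat (fun y => cmap (fun y' => sat_call z (cnth u 1) (ccons p (ccons y (ccons y' 0))) 0)
    (cfilter (fun y' => (cnth u 0 == 1) == simz z y y') (addrs z))) (addrs z)).

Definition colour_count c := tow (c + 5) ^ c.

(** The numerical form of [query_size]: there are [k] colours, and [2 * k * k.+1] triples of a side,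
    a colour and an optional colour of the partner. *)
Definition query_bound c :=
  let k := colour_count c in pump_bound (tow (c + c + 2 * k * k.+1 + 30)) (k * k).

(** Here [c] is the code of the whole instance, which exceeds the size of the alphabet and therefore
    the codes of all letters. *)
Definition model_bound c := tree_bound (query_bound c) c.

Definition query_step x : nat :=
  let y := cdr x in
  if car x == 0 then
    ccons 0 (cmap (fun z => sat_call z (cnth y 1) 0 0)
      (cfilter (valid (fun a => a < cnth y 0)) (ciota 0 (model_bound y).+1)))
  else if car x == 1 then
    sat_step (car y) (car (cdr y)) (car (cdr (cdr y))) (cdr (cdr (cdr y)))
  else sel_step (car y) (car (cdr y)) (cdr (cdr y)).

Lemma comp_model_bound : comp1 model_bound.
Proof.
rewrite /model_bound /query_bound /colour_count; cbv zeta.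
repeat lazymatch goal with
  | |- comp1 (fun x => tree_bound (@?f x) (@?g x)) => apply: (@comp_tree_bound f g)
  | |- comp1 (fun x => pump_bound (@?f x) (@?g x)) => apply: (@comp_pump_bound f g)
  | |- comp1 (fun x => tow (@?f x)) => apply: (@comp_tow f)
  | _ => comp_step
  end.
Qed.

Lemma comp_csubsets f : comp1 f -> comp1 (fun x => csubsets (f x)).
Proof. by move=> cf; rewrite /csubsets; comp_tac. Qed.

Ltac query_comp :=
  cbv beta zeta;
  repeat (lazymatch goal with
  | |- comp1 (fun x => csubsets (@?f x)) => apply: (@comp_csubsets f)
  | |- comp1 (fun x => addrs (@?f x)) => apply: (@comp_addrs f)
  | |- comp1 (fun x => nat_of_bool (simz (@?f x) (@?g x) (@?h x))) => apply: (@comp_simz f g h)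
  | _ => comp_step
  end; cbv beta zeta).

Lemma comp_query_step : comp1 query_step.
Proof.
rewrite /query_step /sat_step /sel_step /sat_call /sel_call /atom /entries /eaddr /elab.
query_comp.
all: try (apply: (comp1_comp comp_model_bound); comp_tac).
apply: (@comp_valid (fun x a => a < cnth (cdr (car x)) 0) cdr); comp_tac.
all: exact: comp_cdr comp_id.
Qed.

Lemma query_step_sat z f v V : query_step (sat_call z f v V) = sat_step z f v V.
Proof. by rewrite /query_step /sat_call !(car_cons, cdr_cons). Qed.

Lemma query_step_sel z u p : query_step (sel_call z u p) = sel_step z u p.
Proof. by rewrite /query_step /sel_call !(car_cons, cdr_cons). Qed.

Local Notation ev := (evaluates query_step).

Lemma code_seq1 x : ccons x 0 = CodeSeq.code [:: x]. Proof. by rewrite code_cons. Qed.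

Lemma evaluates_same x y b : query_step x = ccons 0 (ccons y 0) -> ev y b -> ev x b.
Proof.
move=> xy yb; rewrite -[b]orbF; apply: (@evaluates_has _ nat x id (fun=> b) [:: y]).
  by rewrite xy code_seq1.
by move=> _ /[1!inE] /eqP ->.
Qed.

Lemma evaluates_not x y b : query_step x = ccons 1 (ccons y 0) -> ev y b -> ev x (~~ b).
Proof.
move=> xy yb; rewrite -[b]orbF; apply: (@evaluates_nor _ nat x id (fun=> b) [:: y]).
  by rewrite xy code_seq1.
by move=> _ /[1!inE] /eqP ->.
Qed.

Lemma evaluates_and x y y' b b' : query_step x = ccons 2 (ccons y (ccons y' 0)) ->
  ev y b -> ev y' b' -> ev x (b && b').
Proof.
move=> xy yb yb'; rewrite -[b']andbT.
apply: (@evaluates_all _ bool x (fun c => if c then y else y') (fun c => if c then b else b') [:: true; false]).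
  by rewrite xy !code_cons.
by case.
Qed.

Lemma asbool_not P : `[< ~ P >] = ~~ `[< P >].
Proof. by apply/asboolP/negP => [nP /asboolP|nP p] //; apply: nP; apply/asboolP. Qed.

(** * Correctness of the program for queries *)

Section Sat.
Variables (n : nat) (z : nat) (D : data_tree 'I_n).
Hypothesis zD : represents (@nat_of_ord n) z D.

Lemma node_of x : x \in lst (addrs z) -> rev (lst x) \in nodes D.
Proof. by have [nz _ _] := zD; rewrite nz rcodeK. Qed.

(** The sets [V] are compared with the coded ones on nodes only, as the coded ones may contain codes
    of other addresses. The bound [N] again prepares the induction on the codes of queries. *)
Lemma sat_evaluates N :
    (forall (u : unary_query n) p, code_unary u < N -> p \in nodes D ->
       ev (sel_call z (code_unary u) (rcode p)) `[< selects D u p >]) ->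
  forall m k (f : mso n (unary_query n) m k) v V vc Vc,
    code_mso (@code_unary n) f <= N ->
    (forall i, tnth v i \in nodes D) -> (forall i : 'I_m, cnth vc i = rcode (tnth v i)) ->
    (forall (j : 'I_k) p, p \in nodes D -> tnth V j p = (rcode p \in lst (cnth Vc j))) ->
  ev (sat_call z (code_mso (@code_unary n) f) vc Vc) `[< mso_sat D (selects D) f v V >].
Proof.
have [nz lz sz] := zD.
move=> IHq m k; elim=> {m k} m k.
- move=> a x v V vc Vc _ vD vcE VcE; apply: evaluates_atom.
  rewrite query_step_sat /sat_step !cnth_code vcE; congr atom.
  apply/hasP/asboolP => [[e ez /andP[/eqP ex /eqP ea]]|/lz[e [ez ex ea]]].
    by apply/lz; exists e.
  by exists e => //; rewrite ex ea !eqxx.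
- move=> x y v V vc Vc _ vD vcE VcE; apply: evaluates_atom.
  rewrite query_step_sat /sat_step !cnth_code !vcE; congr atom.
  by apply/eqP/asboolP => [/rcode_inj|/= ->].
- move=> x y v V vc Vc _ vD vcE VcE; apply: evaluates_atom.
  rewrite query_step_sat /sat_step !cnth_code !vcE [X in `[< X >]]/=; congr atom.
  apply/andP/asboolP => [[y0 /eqP yx]|/childP[i ->]].
    case/lastP: (tnth v y) y0 yx => // p i _; rewrite rcode_rcons cdr_cons => /rcode_inj <-.
    by apply/childP; exists i.
  by rewrite rcode_rcons cons_gt0 cdr_cons.
- move=> x y v V vc Vc _ vD vcE VcE; apply: evaluates_atom.
  rewrite query_step_sat /sat_step !cnth_code !vcE [X in `[< X >]]/=; congr atom.
  apply/and4P/asboolP => [[]|[r [i [-> ->]]]]; last first.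
    by rewrite !rcode_rcons !cons_gt0 !cdr_cons !car_cons.
  case/lastP: (tnth v x) => // p i _; case/lastP: (tnth v y) => // q j _.
  rewrite !rcode_rcons !cdr_cons !car_cons => /eqP/rcode_inj -> /eqP ->.
  by exists p, i.
- move=> x Z v V vc Vc _ vD vcE VcE; apply: evaluates_atom.
  rewrite query_step_sat /sat_step !cnth_code !vcE -VcE //; congr atom.
  by rewrite /= asboolb.
- move=> u x v V vc Vc le vD vcE VcE.
  apply: evaluates_same; first by rewrite query_step_sat /sat_step !cnth_code !vcE.
  by apply: IHq => //; apply: lt_code le; rewrite !inE eqxx orbT.
- move=> f IHf v V vc Vc le vD vcE VcE; rewrite [X in `[< X >]]/= asbool_not.
  apply: evaluates_not; first by rewrite query_step_sat /sat_step !cnth_code.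
  by apply: IHf => //; apply: ltnW; apply: lt_code le; rewrite !inE eqxx orbT.
- move=> f IHf g IHg v V vc Vc le vD vcE VcE; rewrite [X in `[< X >]]/= asbool_and.
  apply: evaluates_and; first by rewrite query_step_sat /sat_step !cnth_code.
    by apply: IHf => //; apply: ltnW; apply: lt_code le; rewrite !inE eqxx orbT.
  by apply: IHg => //; apply: ltnW; apply: lt_code le; rewrite !inE eqxx !orbT.
- move=> f IHf v V vc Vc le vD vcE VcE.
  have lef : code_mso (@code_unary n) f <= N by apply: ltnW; apply: lt_code le; rewrite !inE eqxx orbT.
  have -> : `[< mso_sat D (selects D) (MExNode f) v V >] =
      has (fun p => `[< mso_sat D (selects D) f [tuple of rev (lst p) :: v] V >]) (lst (addrs z)).
    apply/asboolP/hasP => [[p pD sf]|[x xz /asboolP sf]].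
      by exists (rcode p); [rewrite -nz | apply/asboolP; rewrite /rcode lst_code revK].
    by exists (rev (lst x)) => //; apply: node_of.
  apply: evaluates_has; first by rewrite query_step_sat /sat_step !cnth_code.
  move=> x xz; apply: IHf => // i; case: (unliftP ord0 i) => [j ->|->].
  + by rewrite tnthS.
  + by rewrite tnth0; apply: node_of.
  + by rewrite tnthS lift0 cnth_consS.
  + by rewrite tnth0 cnth_cons0 rcodeK.
- move=> f IHf v V vc Vc le vD vcE VcE.
  have lef : code_mso (@code_unary n) f <= N by apply: ltnW; apply: lt_code le; rewrite !inE eqxx orbT.
  pose S x : pred addr := fun p => (p \in nodes D) && (rcode p \in lst x).
  have -> : `[< mso_sat D (selects D) (MExSet f) v V >] =
      has (fun x => `[< mso_sat D (selects D) f v [tuple of S x :: V] >]) (lst (csubsets (addrs z))).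
    apply/asboolP/hasP => [[X XD sf]|[x xz /asboolP sf]]; last first.
      by exists (S x) => // p /andP[].
    exists (CodeSeq.code (filter (fun x => X (rev (lst x))) (lst (addrs z)))); first exact: csubsets_filter.
    apply/asboolP; suff -> : S (CodeSeq.code (filter (fun x => X (rev (lst x))) (lst (addrs z)))) = X by [].
    apply/funext => p; rewrite /S lst_code mem_filter -nz /rcode lst_code revK.
    by case Xp: (X p); rewrite ?andbF // (XD p Xp).
  apply: evaluates_has; first by rewrite query_step_sat /sat_step !cnth_code.
  move=> x xz; apply: IHf => // j p pD; case: (unliftP ord0 j) => [i ->|->].
    by rewrite tnthS lift0 cnth_consS VcE.
  by rewrite tnth0 cnth_cons0 /S pD.
Qed.

Lemma sel_evaluates (u : unary_query n) p : p \in nodes D ->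
  ev (sel_call z (code_unary u) (rcode p)) `[< selects D u p >].
Proof.
have [nz lz sz] := zD.
have [N] := ubnP (code_unary u); elim: N u p => // N IHN u p; rewrite ltnS => uN pD.
have IHq (w : unary_query n) q : code_unary w < N -> q \in nodes D ->
    ev (sel_call z (code_unary w) (rcode q)) `[< selects D w q >] by move=> wN; apply: IHN.
have fN := leq_trans (ltnW (code_unary_gt u)) uN.
have pair (f : mso n (unary_query n) 3 0) x y : code_mso (@code_unary n) f <= N -> x \in lst (addrs z) -> y \in lst (addrs z) ->
    ev (sat_call z (code_mso (@code_unary n) f) (ccons (rcode p) (ccons x (ccons y 0))) 0)
       `[< mso_sat D (selects D) f [tuple p; rev (lst x); rev (lst y)] [tuple] >].
  move=> {}fN xz yz; have xD := node_of xz; have yD := node_of yz.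
  apply: (sat_evaluates IHq) => //; last by case.
    by case=> -[|[|[|//]]].
  by case=> -[|[|[|//]]] ? /=; rewrite ?cnth_consS cnth_cons0 ?rcodeK.
have pairs (f : mso n (unary_query n) 3 0) (b : bool) x : code_mso (@code_unary n) f <= N ->
    query_step x = ccons 0 (cflat (fun y => cmap (fun y' => sat_call z (code_mso (@code_unary n) f) (ccons (rcode p) (ccons y (ccons y' 0))) 0)
    (cfilter (fun y' => b == simz z y y') (addrs z))) (addrs z)) ->
    ev x `[< exists y1 y2, [/\ y1 \in nodes D, y2 \in nodes D, b = dsim D y1 y2
        & mso_sat D (selects D) f [tuple p; y1; y2] [tuple]] >].
  move=> {}fN xE.
  pose ys := [seq (y, y') | y <- lst (addrs z), y' <- [seq y' <- lst (addrs z) | b == simz z y y']].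
  have ysP y y' : (y, y') \in ys = [&& y \in lst (addrs z), y' \in lst (addrs z) & b == simz z y y'].
    apply/allpairsPdep/and3P => [[u1 [u2 [u1z]]]|[yz y'z yy']]; last first.
      by exists y, y'; rewrite mem_filter yy' y'z.
    by rewrite mem_filter => /andP[u12 u2z] [-> ->].
  have -> : `[< exists y1 y2, [/\ y1 \in nodes D, y2 \in nodes D, b = dsim D y1 y2
        & mso_sat D (selects D) f [tuple p; y1; y2] [tuple]] >] =
     has (fun y => `[< mso_sat D (selects D) f [tuple p; rev (lst y.1); rev (lst y.2)] [tuple] >]) ys.
    apply/asboolP/hasP => [[q [r [qD rD qr sf]]]|[[y y'] + /asboolP /= sf]].
      exists (rcode q, rcode r); first by rewrite ysP -!nz qD rD qr sz // eqxx.
      by apply/asboolP; rewrite /rcode /= !lst_code !revK.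
    rewrite ysP => /and3P[yz y'z /eqP yy']; have yD := node_of yz; have y'D := node_of y'z.
    by exists (rev (lst y)), (rev (lst y')); split=> //; rewrite sz // !rcodeK.
  apply: (@evaluates_has _ (nat * nat)%type x (fun y => sat_call z (code_mso (@code_unary n) f) (ccons (rcode p) (ccons y.1 (ccons y.2 0))) 0)).
    rewrite xE; congr (ccons 0 (CodeSeq.code _)); rewrite map_allpairs /allpairs_dep; congr flatten.
    by apply: eq_map => y; rewrite /cmap lst_code /cfilter lst_code.
  by case=> y y'; rewrite ysP => /and3P[yz y'z _]; apply: pair.
case: u uN fN => f uN fN.
- apply: evaluates_same; first by rewrite query_step_sel /sel_step !cnth_code.
  apply: (sat_evaluates IHq) => //; last by case.
    by move=> i; rewrite (ord1 i).
  by move=> i; rewrite (ord1 i) cnth_cons0.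
- have -> : `[< selects D (USim f) p >] = `[< exists y1 y2, [/\ y1 \in nodes D, y2 \in nodes D, true = dsim D y1 y2
        & mso_sat D (selects D) f [tuple p; y1; y2] [tuple]] >].
    by apply/asboolP/asboolP => -[q [r [qD rD qr sf]]]; exists q, r; split.
  by apply: pairs => //; rewrite query_step_sel /sel_step !cnth_code.
- have -> : `[< selects D (UNotSim f) p >] = `[< exists y1 y2, [/\ y1 \in nodes D, y2 \in nodes D, false = dsim D y1 y2
        & mso_sat D (selects D) f [tuple p; y1; y2] [tuple]] >].
    by apply/asboolP/asboolP => -[q [r [qD rD qr sf]]]; exists q, r; split=> //; [apply/esym/negbTE | rewrite -qr].
  by apply: pairs => //; rewrite query_step_sel /sel_step !cnth_code.
Qed.

Lemma holds_evaluates (f : boolean_query n) :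
  ev (sat_call z (code_mso (@code_unary n) f) 0 0) `[< holds D f >].
Proof.
apply: (sat_evaluates (N := code_mso (@code_unary n) f)) => //; try by case.
by move=> u p _; apply: sel_evaluates.
Qed.

End Sat.

Lemma card_info (K : finType) : info_size K = 2 * #|K| * #|K|.+1.
Proof. by rewrite /info_size !card_prod card_bool card_option. Qed.

Lemma query_size_bound c : query_size c = query_bound c.
Proof.
by rewrite /query_size /query_bound /query_height /colour_count card_info card_ffun !card_ord.
Qed.

Lemma query_evaluates n (f : boolean_query n) :
  evaluates query_step (ccons 0 (CodeSeq.code [:: n; code_mso (@code_unary n) f]))
    `[< exists D : data_tree 'I_n, bipartite D /\ holds D f >].
Proof.
set cf := code_mso _ f; set x := CodeSeq.code _.
pose ok a := a < n; pose G z := `[< exists D, [/\ represents (@nat_of_ord n) z D, bipartite D & holds D f] >].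
have okP a : ok a -> exists b : 'I_n, nat_of_ord b = a by move=> an; exists (Ordinal an).
pose zs := [seq z <- iota 0 (model_bound x).+1 | valid ok z].
have -> : `[< exists D : data_tree 'I_n, bipartite D /\ holds D f >] = has G zs.
  apply/asboolP/hasP => [[D [bD fD]]|[z _ /asboolP[D []]]]; last by exists D.
  have fx : cf <= x by apply: ltnW; apply: (lt_code _ (leqnn _)); rewrite !inE eqxx orbT.
  have t0 : 0 < tow (x + 5) by elim: (x + 5) => //= m; rewrite expn_gt0.
  have [D' [bD' fD' [[a l] Dt sz]]] := query_small [ffun=> Ordinal t0] fx bD fD.
  have [|||z [zok zD zb]] := represents_valid (cA := @nat_of_ord n) (ok := ok) (k := x) _ _ _ Dt sz bD'.
  - exact: ord_inj.
  - exact: ltn_ord.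
  - move=> b; apply: leq_trans (ltnW (ltn_ord b)) _; apply: ltnW.
    by apply: (lt_code _ (leqnn _)); rewrite !inE eqxx.
  exists z; last by apply/asboolP; exists D'.
  by rewrite mem_filter zok mem_iota ltnS /model_bound -query_size_bound.
apply: (evaluates_has (F := fun z => sat_call z cf 0 0)).
  by rewrite /query_step car_cons cdr_cons !cnth_code /cmap /cfilter /ciota !lst_code.
move=> z; rewrite mem_filter => /andP[zok _].
have [D bD zD] := valid_represents (@ord_inj n) okP zok.
have ez D' : represents (@nat_of_ord n) z D' -> evaluates query_step (sat_call z cf 0 0) `[< holds D' f >].
  by move=> zD'; apply: holds_evaluates.
(* [z] may represent several data trees. Instead of comparing them, determinism of [evaluates] is
   used: the same call computes the truth of [f] in each of them. *)
suff -> : G z = `[< holds D f >] by apply: ez.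
apply/asboolP/asboolP => [[D' [zD' _ fD']]|fD]; last by exists D.
by apply/asboolP; rewrite (evaluates_inj (ez D zD) (ez D' zD')); apply/asboolP.
Qed.

Lemma evaluates_decidable step g I (code : I -> nat) (P : I -> Prop) : comp1 step -> comp1 g ->
  (forall i, evaluates step (g (code i)) `[< P i >]) -> decidable_problem code P.
Proof.
move=> /evaluates_recursive[r rP] [s sP] H; exists (RComp r (fun _ : 'I_1 => s)) => i.
have rs b : evaluates step (g (code i)) b -> reval (RComp r (fun=> s)) [tuple code i] b.
  move=> /rP rb; exists [tuple g (code i)] => // j.
  by rewrite (ord1 j); apply: sP.
by have := rs _ (H i); case: asboolP => Pi h; split.
Qed.

Lemma boolean_queries_decidable :
  decidable_problem code_boolean_instance
    (fun q : {n : nat & boolean_query n} =>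
       exists D : data_tree 'I_(tag q), bipartite D /\ holds D (tagged q)).
Proof.
apply: (evaluates_decidable (g := ccons 0) comp_query_step); first exact: comp_cons (comp_const 0) comp_id.
by case=> n f; apply: query_evaluates.
Qed.

Lemma unary_queries_decidable :
  decidable_problem code_unary_instance
    (fun q : {n : nat & unary_query n} =>
       exists D : data_tree 'I_(tag q),
         bipartite D /\ exists2 x, x \in nodes D & selects D (tagged q) x).
Proof.
(* The unary query is turned into a sentence that some node satisfies it; 8 and 5 are the tags of
   [MExNode] and [MQuery], and the last [0] is the bound variable. *)
pose g x := ccons 0 (ccons (cnth x 0) (ccons (ccons 8 (ccons (ccons 5 (ccons (cnth x 1) (ccons 0 0))) 0)) 0)).
apply: (evaluates_decidable (g := g) comp_query_step); first by rewrite /g; comp_tac.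
case=> n u.
have -> : `[< exists D : data_tree 'I_n, bipartite D /\ exists2 x, x \in nodes D & selects D u x >] =
    `[< exists D : data_tree 'I_n, bipartite D /\ holds D (MExNode (MQuery n 0 u ord0)) >].
  by apply/asboolP/asboolP.
have := query_evaluates (MExNode (MQuery n 0 u ord0)).
by rewrite /g !cnth_code !code_cons.
Qed.

(** * Emptiness of class automata *)

(* A context [x = ccons z (ccons M mode)] stands for a run of the automaton [M] on
   the tree coded by [z], with the letters of the transducer for [mode = 0], and
   for [mode = ccons 1 p] with those of the class condition for the class of [p].
   The other calls are [ta_call], the acceptance of the whole tree, [reach_call],
   the state [q] at the node [r], and [forest_call], the acceptance by [N] of the
   children of [r] from the [i]-th one on. *)
Definition acceptance_call z C := ccons 1 (ccons z C).
Definition ta_call x := ccons 2 x.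
Definition reach_call x q r := ccons 3 (ccons x (ccons q r)).
Definition forest_call x N p i r := ccons 4 (ccons x (ccons N (ccons p (ccons i r)))).
Definition pair_call x q N p i r := ccons 5 (ccons x (ccons q (ccons N (ccons p (ccons i r))))).

Definition node_letter z mode e :=
  if mode == 0 then ccons (car (elab e)) (ccons (cdr (elab e)) 0)
  else ccons (cdr (elab e)) (ccons (simz z (cdr mode) (eaddr e)) 0).

Definition has_letter x r a :=
  has (fun e => (eaddr e == r) && (node_letter (car x) (cdr (cdr x)) e == a)) (entries (car x)).

Definition ta_step x : nat := ccons 0 (cmap (fun q => reach_call x q 0) (cnth (car (cdr x)) 2)).

Definition reach_step x q r : nat :=
  ccons 0 (cflat (fun e => cmap (fun p => forest_call x (cnth (cnth e 0) 1) p 0 r) (cnth (cnth (cnth e 0) 1) 1))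
    (cfilter (fun e => has_letter x r (cnth (cnth e 0) 0) && (cnth e 1 == q)) (cnth (car (cdr x)) 1))).

(** [ccons i r] is the code of child number [i] of the node of code [r]; if it is not listed, the
    siblings have ended and [p] has to be final. *)
Definition forest_step x N p i r : nat :=
  if ccons i r \in lst (addrs (car x)) then
    ccons 0 (cmap (fun t => pair_call x (cnth (cnth t 0) 1) N (cnth t 1) i r)
      (cfilter (fun t => cnth (cnth t 0) 0 == p) (cnth N 2)))
  else atom (p \in lst (cnth N 3)).

(** A class automaton gives rise to a single ternary relation, [pair_accepts], so [k] colours come
    from one colouring only. *)
Definition class_bound c :=
  let k := tow (c + 5) in pump_bound (tow (c + 2 * k * k.+1 + 30)) (k * k).

Definition class_model_bound C := tree_bound (class_bound C) (ccons C C).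

(** The output of the transducer is guessed by enumerating trees over pairs of an input letter and a
    work letter. *)
Definition pair_letter C a : bool := [&& 0 < a, car a < cnth C 0 & cdr a < cnth C 1].

Definition class_step w : nat :=
  let y := cdr w in
  if car w == 0 then
    ccons 0 (cmap (fun z => acceptance_call z y)
      (cfilter (valid (pair_letter y)) (ciota 0 (class_model_bound y).+1)))
  else if car w == 1 then
    ccons 2 (ccons (ta_call (ccons (car y) (ccons (cnth (cdr y) 2) 0)))
      (cmap (fun p => ta_call (ccons (car y) (ccons (cnth (cdr y) 3) (ccons 1 p)))) (addrs (car y))))
  else if car w == 2 then ta_step y
  else if car w == 3 then reach_step (car y) (car (cdr y)) (cdr (cdr y))
  else if car w == 4 then
    forest_step (car y) (car (cdr y)) (car (cdr (cdr y))) (car (cdr (cdr (cdr y)))) (cdr (cdr (cdr (cdr y))))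
  else let t := cdr (cdr y) in
    ccons 2 (ccons (reach_call (car y) (car (cdr y)) (cdr (cdr t)))
      (ccons (forest_call (car y) (car t) (car (cdr t)) (car (cdr (cdr t))).+1 (cdr (cdr (cdr t)))) 0)).

Lemma comp_class_model_bound : comp1 class_model_bound.
Proof.
rewrite /class_model_bound /class_bound; cbv zeta.
repeat lazymatch goal with
  | |- comp1 (fun x => tree_bound (@?f x) (@?g x)) => apply: (@comp_tree_bound f g)
  | |- comp1 (fun x => pump_bound (@?f x) (@?g x)) => apply: (@comp_pump_bound f g)
  | |- comp1 (fun x => tow (@?f x)) => apply: (@comp_tow f)
  | _ => comp_step
  end.
Qed.

Lemma comp_class_step : comp1 class_step.
Proof.
rewrite /class_step /ta_step /reach_step /forest_step /has_letter /node_letter.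
rewrite /acceptance_call /ta_call /reach_call /forest_call /pair_call /atom /entries /eaddr /elab.
query_comp.
all: try (apply: (comp1_comp comp_class_model_bound); comp_tac).
- by apply: (@comp_valid (fun x a => pair_letter (cdr (car x)) a) cdr); [rewrite /pair_letter; comp_tac | exact: comp_cdr comp_id].
- exact: comp_cdr comp_id.
Qed.

Local Notation class_ev := (evaluates class_step).

(** Rules and horizontal automata have no decidable equality, so the list is indexed by
    positions. *)
Lemma evaluates_has_map step (T : Type) x (F : T -> nat) (G : T -> bool) (ys : seq T) :
    step x = ccons 0 (CodeSeq.code [seq F y | y <- ys]) -> (forall y, evaluates step (F y) (G y)) ->
  evaluates step x (has G ys).
Proof.
move=> xE H; have ysE : map (tnth (in_tuple ys)) (enum _) = ys := map_tnth_enum (in_tuple ys).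
rewrite -[in has _ _]ysE has_map.
apply: (evaluates_has (F := F \o tnth (in_tuple ys))); last by move=> y _; apply: H.
by rewrite xE -[in LHS]ysE -map_comp.
Qed.

Lemma subtree_rcons A (t : tree A) p i :
  subtree t (rcons p i) = obind (fun u => onth (children u) i) (subtree t p).
Proof. by elim: p t => [|j p IHp] t /=; case: onth. Qed.

Lemma cmap_map T (c : T -> nat) F s : cmap F (code_seq c s) = CodeSeq.code [seq F (c y) | y <- s].
Proof. by rewrite /cmap lst_code -map_comp. Qed.

Lemma cfilter_map T (c : T -> nat) P s :
  cfilter P (code_seq c s) = code_seq c [seq y <- s | P (c y)].
Proof. by rewrite /cfilter lst_code filter_map. Qed.

(** * Runs of tree automata on coded trees *)

Section Run.
Variables (B : eqType) (c : B -> nat) (M : tree_automaton B) (z mode : nat) (T : tree B).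
Local Notation x := (ccons z (ccons (code_ta c M) mode)).
Hypothesis nodesT : forall p, (p \in nodes T) = (rcode p \in lst (addrs z)).
Hypothesis labelT : forall p b, has_letter x (rcode p) (c b) = (label T p == Some b).

(** The calls for a node and for a list of siblings are mutually recursive. The statement for
    siblings, [l] being the children of [p] from number [i] on, is the one proved by induction on
    [l]; [reach_evaluates] takes it as a hypothesis. *)
Let A l := forall p i, (forall j, subtree T (rcons p (i + j)) = onth (toF l) j) ->
  forall (N : nfa 'I_(ta_size M)) (q : 'I_(nfa_size N)),
  class_ev (forest_call x (code_nfa (@code_ord _) N) q i (rcode p)) (forest_accepts q (toF l)).

Lemma reach_evaluates b l p (q : 'I_(ta_size M)) : A l -> subtree T p = Some (Node b (toF l)) ->
  class_ev (reach_call x q (rcode p)) (ta_reach M (Node b (toF l)) q).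
Proof.
move=> IHl pl; rewrite ta_reach_forest.
pose ys := flatten [seq [seq Tagged (fun N => 'I_(nfa_size N)) p' | p' <- nfa_init r.1.2]
  | r <- ta_rules M & has_letter x (rcode p) (c r.1.1) && (code_ord r.2 == code_ord q)].
have -> : has (fun r => [&& r.1.1 == b, r.2 == q & has (fun p' => forest_accepts p' (toF l)) (nfa_init r.1.2)])
    (ta_rules M) = has (fun y => forest_accepts (tagged y) (toF l)) ys.
  have labelE r : has_letter x (rcode p) (c r.1.1) = (r.1.1 == b).
    by rewrite labelT /label pl /= eq_sym (inj_eq Some_inj).
  rewrite /ys; elim: (ta_rules M) => [|r rs IH] //=; rewrite IH labelE.
  rewrite /code_ord (inj_eq (@ord_inj _)).
  by case: eqP => //= _; case: eqP => //= _; rewrite has_cat has_map.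
apply: (evaluates_has_map (F := fun y : {N : nfa 'I_(ta_size M) & 'I_(nfa_size N)} =>
    forest_call x (code_nfa (@code_ord _) (tag y)) (code_ord (tagged y)) 0 (rcode p))).
  rewrite /class_step /reach_call !(car_cons, cdr_cons) /= /reach_step !(car_cons, cdr_cons) cnth_code.
  rewrite cfilter_map /cflat lst_code -map_comp /ys map_flatten -map_comp.
  congr (ccons 0 (CodeSeq.code (flatten _))).
  rewrite (eq_filter (a2 := fun r => has_letter x (rcode p) (c r.1.1) && (code_ord r.2 == code_ord q))).
    by apply: eq_map => r /=; rewrite !cnth_code cmap_map lst_code -map_comp.
  by move=> r /=; rewrite !cnth_code.
case=> N p' /=; apply: IHl => j.
by rewrite subtree_rcons pl.
Qed.

Lemma forest_evaluates l : A l.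
Proof.
elim: l => [|b l IHl r IHr] p i sub N q; last first.
  have pi : subtree T (rcons p i) = Some (Node b (toF l)) by have := sub 0; rewrite addn0.
  have piz : ccons i (rcode p) \in lst (addrs z) by rewrite -rcode_rcons -nodesT inE pi.
  rewrite forest_accepts_cons.
  pose ts := [seq t <- nfa_trans N | code_ord t.1.1 == code_ord q].
  have -> : [exists q', ta_reach M (Node b (toF l)) q' && [exists p', ((q, q', p') \in nfa_trans N) && forest_accepts p' (toF r)]] =
      has (fun t => ta_reach M (Node b (toF l)) t.1.2 && forest_accepts t.2 (toF r)) ts.
    apply/existsP/hasP => [[q' /andP[lq' /existsP[p' /andP[tr rp']]]]|[[[q1 q'] p']]].
      by exists (q, q', p'); [rewrite mem_filter eqxx | rewrite lq'].
    rewrite mem_filter /= /code_ord (inj_eq (@ord_inj _)) => /andP[/eqP -> tr] /andP[lq' rp'].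
    by exists q'; rewrite lq'; apply/existsP; exists p'; rewrite tr.
  apply: (evaluates_has_map (F := fun t => pair_call x (code_ord t.1.2) (code_nfa (@code_ord _) N) (code_ord t.2) i (rcode p))).
    rewrite /class_step /forest_call !(car_cons, cdr_cons) [LHS]/= /forest_step !(car_cons, cdr_cons) piz.
    rewrite cnth_code [nth _ _ _]/= cfilter_map cmap_map; congr (ccons 0 (CodeSeq.code _)).
    rewrite (eq_filter (a2 := fun t => code_ord t.1.1 == code_ord q)).
      by apply: eq_map => t; rewrite !cnth_code.
    by move=> t; rewrite !cnth_code.
  case=> -[q1 q'] p'.
  set cl := pair_call _ _ _ _ _ _.
  rewrite -[X in _ && X]andbT.
  pose y1 := reach_call x q' (rcode (rcons p i)).
  pose y2 := forest_call x (code_nfa (@code_ord _) N) p' i.+1 (rcode p).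
  apply: (@evaluates_all _ bool cl (fun d => if d then y1 else y2)
    (fun d => if d then ta_reach M (Node b (toF l)) q' else forest_accepts p' (toF r)) [:: true; false]).
    by rewrite /cl /class_step /pair_call !(car_cons, cdr_cons) /= /y1 /y2 rcode_rcons !code_cons.
  case=> _ /=; first exact: reach_evaluates IHl pi.
  by apply: IHr => j; have := sub j.+1; rewrite addnS addSn.
rewrite [toF _]/= forest_accepts_nil; apply: evaluates_atom.
have piz : (ccons i (rcode p) \in lst (addrs z)) = false.
  by have := sub 0; rewrite -rcode_rcons -nodesT inE addn0 => ->.
rewrite /class_step /forest_call !(car_cons, cdr_cons) [LHS]/= /forest_step !(car_cons, cdr_cons) piz.
rewrite cnth_code [nth _ _ _]/= lst_code; congr atom.
by rewrite (mem_map (@ord_inj _)).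
Qed.

Lemma ta_evaluates : class_ev (ta_call x) (ta_accepts M T).
Proof.
apply: (evaluates_has_map (F := fun q => reach_call x (code_ord q) 0)).
  by rewrite /class_step /ta_call !(car_cons, cdr_cons) [LHS]/= /ta_step !(car_cons, cdr_cons) cnth_code cmap_map.
move=> q; case def_T: T => [b ts]; have [l def_l] := toF_surj ts.
rewrite -def_l; apply: (reach_evaluates (p := [::])) (@forest_evaluates l) _.
by rewrite /= def_T def_l.
Qed.

End Run.

Lemma label_bmapi A B (g : addr -> A -> B) a l p :
  label (Node (g [::] a) (toF (bmapi g l))) p = omap (g p) (label (Node a (toF l)) p).
Proof.
have := blabel_mapi (fun q => g (behead q)) (Nd a l Lf) (0 :: p).
by rewrite !blabel_toF.
Qed.

Lemma nodes_bmapi A B (g : addr -> A -> B) a b l :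
  nodes (Node b (toF (bmapi g l))) =i nodes (Node a (toF l)).
Proof. by case=> // i p; rewrite !nodes_root !bnodes0 bnodes_mapi. Qed.

Lemma change_letters A B (D : data_tree A) (t : tree B) : nodes t =i nodes D ->
  exists D' : data_tree B, [/\ dtree D' = t, dsim D' = dsim D & bipartite D -> bipartite D'].
Proof.
move=> tD; have eq : {in nodes t & &, equivalence_rel (dsim D)}.
  by move=> p q r; rewrite !tD; apply: dsim_equiv.
exists (DataTree eq); split=> // -[X [Y [XY dXY cX cY sim]]].
by exists X, Y; split=> // p; rewrite tD.
Qed.

Lemma class_size_bound c : class_size c = class_bound c.
Proof.
rewrite /class_size /class_bound /class_height; cbv zeta.
by rewrite card_info card_ffun !card_ord expn1.
Qed.

(** * Class automata on coded trees *)

Section ClassAutomaton.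
Variable C : class_automaton.
Local Notation n := (ca_input C).
Local Notation k := (ca_work C).
Local Notation A := ('I_n * 'I_k)%type.
Local Notation cC := (code_class_automaton C).
Local Notation f := (ca_transducer C).
Local Notation M := (ca_condition C).

Definition cons_letters (a : A) := ccons a.1 a.2.

Lemma cons_letters_inj : injective cons_letters.
Proof. by move=> [a b] [a' b'] /cons_inj[/ord_inj /= -> /ord_inj /= ->]. Qed.

Lemma pair_letterE x : pair_letter cC x = [&& 0 < x, car x < n & cdr x < k].
Proof. by rewrite /pair_letter /code_class_automaton !cnth_code. Qed.

Lemma pair_letterP x : pair_letter cC x -> exists a, cons_letters a = x.
Proof.
rewrite pair_letterE => /and3P[x0 xn xk]; exists (Ordinal xn, Ordinal xk).
by rewrite [RHS]cons_car.
Qed.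

Lemma pair_letter_cons a : pair_letter cC (cons_letters a).
Proof. by rewrite pair_letterE cons_gt0 car_cons cdr_cons !ltn_ord. Qed.

(* [D] carries both the input letters and the work letters. *)
Definition class_accepts (D : data_tree A) (a : A) (l : bt A) : Prop :=
  ta_accepts f D /\ {in nodes D, forall p, ta_accepts M (Node (a.2, dsim D p [::])
    (toF (bmapi (fun q (b : A) => (b.2, dsim D p q)) l)))}.

Section Fixed.
Variables (z : nat) (D : data_tree A) (a : A) (l : bt A).
Hypothesis zval : valid (pair_letter cC) z.
Hypothesis zD : represents cons_letters z D.
Hypothesis Dal : dtree D = Node a (toF l).

Lemma entry_label e p : e \in entries z -> eaddr e = rcode p ->
  exists2 b, label D p = Some b & elab e = cons_letters b.
Proof.
move=> ez ep; case/and4P: zval => _ /allP/(_ e ez)/pair_letterP[b be] _ _.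
by exists b => //; have [_ lz _] := zD; apply/lz; exists e.
Qed.

Lemma label_entry p b : label D p = Some b ->
  exists e, [/\ e \in entries z, eaddr e = rcode p & elab e = cons_letters b].
Proof. by have [_ lz _] := zD; move/lz. Qed.

Lemma has_letterE (B : eqType) (c : B -> nat) (g : addr -> A -> B) M' mode p b :
    injective c ->
    (forall e q a', label D q = Some a' -> eaddr e = rcode q -> elab e = cons_letters a' ->
       node_letter z mode e = c (g q a')) ->
  has_letter (ccons z (ccons M' mode)) (rcode p) (c b) = (omap (g p) (label D p) == Some b).
Proof.
move=> c_inj H; rewrite /has_letter !(car_cons, cdr_cons); apply/hasP/eqP.
  move=> [e ez /andP[/eqP ep /eqP eb]]; have [a' pa' ea'] := entry_label ez ep.
  by rewrite pa' /=; congr Some; apply: c_inj; rewrite -eb (H e p a').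
case pa': (label D p) => [a'|] //= [<-]; have [e [ez ep ea']] := label_entry pa'.
by exists e => //; rewrite ep (H e p a') // !eqxx.
Qed.

Lemma acceptance_evaluates : class_ev (acceptance_call z cC) `[< class_accepts D a l >].
Proof.
have [nz lz sz] := zD.
pose T x := Node (a.2, simz z x (rcode [::])) (toF (bmapi (fun q (b : A) => (b.2, simz z x (rcode q))) l)).
have -> : `[< class_accepts D a l >] = ta_accepts f D && all (fun x => ta_accepts M (T x)) (lst (addrs z)).
  have TE p : p \in nodes D -> T (rcode p) = Node (a.2, dsim D p [::])
      (toF (bmapi (fun q (b : A) => (b.2, dsim D p q)) l)).
    move=> pD; rewrite /T -sz // ?Dal //; congr (Node _ (toF _)).
    apply: bmapi_eq => q ql b; rewrite -sz //.
    by rewrite Dal nodes_root bnodes0 ql orbT.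
  apply/asboolP/andP => -[fD H]; split=> //.
    apply/allP => x xz; have xD : rev (lst x) \in nodes D by rewrite nz rcodeK.
    by rewrite -(rcodeK x) TE ?H.
  by move=> p pD; rewrite -TE //; apply: (allP H); rewrite -nz.
pose G y := if y is Some x then ta_accepts M (T x) else ta_accepts f D.
pose F y := if y is Some x then ta_call (ccons z (ccons (cnth cC 3) (ccons 1 x)))
  else ta_call (ccons z (ccons (cnth cC 2) 0)).
have -> : ta_accepts f D && all (fun x => ta_accepts M (T x)) (lst (addrs z)) =
    all G (None :: [seq Some x | x <- lst (addrs z)]) by rewrite [RHS]/= all_map.
apply: (evaluates_all (F := F)).
  rewrite /class_step /acceptance_call !(car_cons, cdr_cons) [LHS]/= code_cons.
  by rewrite /cmap -/(map F _) -map_comp.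
case=> [x|] _; rewrite /F /G /code_class_automaton !cnth_code [nth _ _ _]/=.
  have c_inj : injective (code_pair (@code_ord k) nat_of_bool).
    by apply: code_pair_inj; [apply: code_ord_inj | do 2 case].
  pose g p (b : A) := (b.2, simz z x (rcode p)).
  have labelE p : label (T x) p = omap (g p) (label D p) by rewrite Dal -(label_bmapi g).
  apply: ta_evaluates => [p|p b]; first by rewrite -nz Dal (nodes_bmapi _ a).
  rewrite labelE; apply: has_letterE => // e q a' _ eq ea'.
  by rewrite /node_letter gtn_eqF ?cons_gt0 // ea' cdr_cons cdr_cons eq /code_pair !code_cons.
have c_inj : injective (code_pair (@code_ord n) (@code_ord k)).
  by apply: code_pair_inj; apply: code_ord_inj.
apply: ta_evaluates => [p|p b]; first exact: nz.
have -> : label D p = omap (fun b => b) (label D p) by case: label.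
apply: (has_letterE (g := fun _ b => b)) => // e q a' _ _ ea'.
by rewrite /node_letter ea' car_cons cdr_cons /code_pair !code_cons.
Qed.

End Fixed.

Definition class_model z := exists (D : data_tree A) a l,
  [/\ represents cons_letters z D, bipartite D, dtree D = Node a (toF l) & class_accepts D a l].

Lemma class_modelP z : class_model z -> exists D : data_tree 'I_n, bipartite D /\ ca_accepts D.
Proof.
move=> [D [a [l [zD bD Dal [fD MD]]]]].
have DD : nodes (Node a.1 (toF (bmap fst l))) =i nodes D by move=> p; rewrite Dal /bmap (nodes_bmapi _ a).
have [D1 [D1E sD1 /(_ bD) bD1]] := change_letters DD.
exists D1; split=> //; exists (Node a.2 (toF (bmap snd l))).
  split; first by move=> p; rewrite D1E DD Dal /bmap (nodes_bmapi _ a).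
  rewrite D1E tensor_toF -surjective_pairing.
  suff -> : bmap (fun x : A => (x.1, x.2)) l = l by rewrite -Dal.
  by rewrite /bmap; elim: (l) => //= -[b b'] r1 -> r2 ->.
move=> p pD1; have pD : p \in nodes D by rewrite -DD -D1E.
have := MD p pD; rewrite tensor_set_toF sD1 /bmap bmapi_comp.
congr (is_true (ta_accepts _ (Node (_, _) (toF _)))).
apply: bmapi_eq => q ql b; congr pair; rewrite [RHS]/= D1E DD Dal.
by rewrite nodes_root bnodes0 ql orbT.
Qed.

Lemma class_model_small : (exists D : data_tree 'I_n, bipartite D /\ ca_accepts D) ->
  exists z, [/\ valid (pair_letter cC) z, class_model z & z <= class_model_bound cC].
Proof.
move=> [D [bD [s fs Ms]]].
have hf : ta_height f <= cC.
  apply: leq_trans (ta_height_code _ (code_pair (@code_ord _) (@code_ord _))) (ltnW (lt_code _ (leqnn _))).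
  by rewrite !inE eqxx !orbT.
have hM : ta_height M <= cC.
  apply: leq_trans (ta_height_code _ (code_pair (@code_ord _) nat_of_bool)) (ltnW (lt_code _ (leqnn _))).
  by rewrite !inE eqxx !orbT.
have t0 : 0 < tow (cC + 5) by elim: (cC + 5) => //= m; rewrite expn_gt0.
have [D1 [[a l]]] := class_small hf hM [ffun=> Ordinal t0] bD fs Ms.
set s' := Node _ _ => -[bD1 [_ fs'] Ms' [D1E sz]]; rewrite /= in D1E sz s' fs' Ms'.
have DD : nodes (Node a (toF l)) =i nodes D1.
  by move=> p; rewrite D1E /bmap (nodes_bmapi _ a).
have [D2 [D2E sD2 /(_ bD1) bD2]] := change_letters DD.
have nC : n < cC by apply: (lt_code _ (leqnn _)); rewrite !inE eqxx.
have kC : k < cC by apply: (lt_code _ (leqnn _)); rewrite !inE eqxx orbT.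
have [||b|z [zval zD zb]] := represents_valid (cA := cons_letters) (ok := pair_letter cC) (k := ccons cC cC) _ _ _ D2E sz bD2.
- exact: cons_letters_inj.
- exact: pair_letter_cons.
- by apply: leq_cons; apply: ltnW; apply: ltn_trans (ltn_ord _) _.
exists z; rewrite /class_model_bound -class_size_bound; split=> //; exists D2, a, l; split=> //; split.
  move: fs'; rewrite D1E /s' tensor_toF D2E -surjective_pairing.
  suff -> : bmap (fun x : A => (x.1, x.2)) l = l by [].
  by rewrite /bmap; elim: (l) => //= -[b b'] r1 -> r2 ->.
move=> p pD; have pD1 : p \in nodes D1 by rewrite -DD -D2E.
have := Ms' p pD1; rewrite /s' tensor_set_toF sD2 /bmap bmapi_comp.
congr (is_true (ta_accepts _ (Node (_, _) (toF _)))).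
apply: bmapi_eq => q ql b; congr pair; rewrite [LHS]/= -DD.
by rewrite nodes_root bnodes0 ql orbT.
Qed.

Lemma class_evaluates : class_ev (ccons 0 cC)
  `[< exists D : data_tree 'I_n, bipartite D /\ ca_accepts D >].
Proof.
pose zs := [seq z <- iota 0 (class_model_bound cC).+1 | valid (pair_letter cC) z].
have -> : `[< exists D : data_tree 'I_n, bipartite D /\ ca_accepts D >] = has (fun z => `[< class_model z >]) zs.
  apply/asboolP/hasP => [/class_model_small[z [zval zm zb]]|[z _ /asboolP/class_modelP //]].
  by exists z; [rewrite mem_filter zval mem_iota ltnS | apply/asboolP].
apply: (evaluates_has (F := fun z => acceptance_call z cC)).
  by rewrite /class_step car_cons cdr_cons [LHS]/= /cmap /cfilter /ciota !lst_code.
move=> z; rewrite mem_filter => /andP[zval _].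
have [D bD zD] := valid_represents cons_letters_inj pair_letterP zval.
case def_D: (dtree D) => [a ts]; have [l def_l] := toF_surj ts.
have Dal : dtree D = Node a (toF l) by rewrite def_D def_l.
suff -> : `[< class_model z >] = `[< class_accepts D a l >] by apply: acceptance_evaluates.
apply/asboolP/asboolP => [[D' [a' [l' [zD' _ Dal' aD']]]]|aD]; last by exists D, a, l.
have e := acceptance_evaluates zval zD Dal; have e' := acceptance_evaluates zval zD' Dal'.
by apply/asboolP; rewrite (evaluates_inj e e'); apply/asboolP.
Qed.

End ClassAutomaton.

Lemma class_automata_decidable :
  decidable_problem code_class_automaton
    (fun C : class_automaton =>
       exists D : data_tree 'I_(ca_input C), bipartite D /\ ca_accepts D).
Proof.
apply: (evaluates_decidable (g := ccons 0) comp_class_step); first exact: comp_cons (comp_const 0) comp_id.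
exact: class_evaluates.
Qed.

Theorem theorem5 :
  decidable_problem code_class_automaton
    (fun C : class_automaton =>
       exists D : data_tree 'I_(ca_input C), bipartite D /\ ca_accepts D)
  /\
  decidable_problem code_boolean_instance
    (fun q : {n : nat & boolean_query n} =>
       exists D : data_tree 'I_(tag q), bipartite D /\ holds D (tagged q))
  /\
  decidable_problem code_unary_instance
    (fun q : {n : nat & unary_query n} =>
       exists D : data_tree 'I_(tag q),
         bipartite D /\ exists2 x, x \in nodes D & selects D (tagged q) x).
Proof.
split; first exact: class_automata_decidable.
by split; [apply: boolean_queries_decidable | apply: unary_queries_decidable].
Qed.
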